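(* For $\alpha\in(0,1)$ let $\tilde m_\alpha$ and $\tilde\mu_\alpha$ denote respectively the median and the mean of $\mathbf{M}_\alpha$, and let $m_{\mathbf{S}}$ be the median of $\mathbf{S}$. Then $$\tilde m_\alpha\;>\;\tilde\mu_\alpha$$ as soon as $\alpha\in[1-m_{\mathbf{S}},1)$.
   Context: For $\alpha\in(0,1)$, $\mathbf{Z}_\alpha$ is the positive random variable with $\mathbb{E}[e^{-\lambda \mathbf{Z}_\alpha}]=e^{-\lambda^\alpha}$ for all $\lambda\ge0$, and $\mathbf{M}_\alpha\stackrel{d}{=}\mathbf{Z}_\alpha^{-\alpha}$ is the Mittag-Leffler random variable (its mean is $\tilde\mu_\alpha=1/\Gamma(1+\alpha)$). $\mathbf{S}=e^{\mathbf{X}}$, where $\mathbf{X}$ is the real random variable with characteristic function $\mathbb{E}[e^{\mathrm{i}\lambda\mathbf{X}}]=e^{\mathrm{i}\lambda(\log|\lambda|-1)-\pi|\lambda|/2}$, $\lambda\in\mathbb{R}$. The median of a random variable $X$ whose density does not vanish on its support is the unique number $m_X$ with $\mathbb{P}[X\le m_X]=\mathbb{P}[X\ge m_X]=\frac12$. *)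

(* Defs.v *)
From HB Require Import structures.
From mathcomp Require Import all_boot all_order all_algebra.
From mathcomp Require Import complex.
From mathcomp Require Import all_classical all_reals all_analysis.

Set Implicit Arguments.
Unset Strict Implicit.
Unset Printing Implicit Defensive.

Import Order.TTheory GRing.Theory Num.Theory.
Import numFieldNormedType.Exports.

Local Open Scope classical_set_scope.
Local Open Scope ring_scope.
Local Open Scope complex_scope.

Definition cexp (R : realType) (z : R[i]) : R[i] :=
  (expR (complex.Re z) * cos (complex.Im z)) +i*
  (expR (complex.Re z) * sin (complex.Im z)).

(* Meant for [f] with integrable real and imaginary parts: [Rintegral] sends
   a divergent integral to a junk value. *)
Definition cexpectation d (T : measurableType d) (R : realType)
    (P : probability T R) (f : T -> R[i]) : R[i] :=
  (\int[P]_t complex.Re (f t)) +i* (\int[P]_t complex.Im (f t)).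

Definition char_fun d (T : measurableType d) (R : realType)
    (P : probability T R) (X : T -> R) (l : R) : R[i] :=
  cexpectation P (fun t => cexp ((l * X t)*i)).

Definition eq_in_law d1 (T1 : measurableType d1) d2 (T2 : measurableType d2)
    (R : realType) (P1 : probability T1 R) (X1 : T1 -> R)
    (P2 : probability T2 R) (X2 : T2 -> R) : Prop :=
  forall A : set R, measurable A -> pushforward P1 X1 A = pushforward P2 X2 A.

(* Uniqueness of [m] is not part of the predicate: it is automatic when the law
   has a density that does not vanish on its (interval) support. *)
Definition is_median d (T : measurableType d) (R : realType)
    (P : probability T R) (X : T -> R) (m : R) : Prop :=
  P [set t | X t <= m] = (2^-1)%:E /\ P [set t | m <= X t] = (2^-1)%:E.

Definition positive_stable d (T : measurableType d) (R : realType)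
    (alpha : R) (P : probability T R) (Z : T -> R) : Prop :=
  {ae P, forall t, 0 < Z t} /\
  forall l : R, 0 <= l ->
    ('E_P[(fun t => expR (- (l * Z t)))%R] = (expR (- (l `^ alpha)))%:E)%E.

(* At [l = 0] the value [ln 0 = 0] is irrelevant: it is multiplied by [l]. *)
Definition log_S_law d (T : measurableType d) (R : realType)
    (P : probability T R) (X : T -> R) : Prop :=
  forall l : R, char_fun P X l =
    cexp ((l * (ln `|l| - 1))*i - (pi * `|l| / 2)%:C).

(* Main.v *)
(* Let W = Z^(-alpha) and Y = alpha^(-alpha) (S / (1-alpha))^(1-alpha).  The Laplace transform of
   Z gives E W^j = j! / Gamma(1 + alpha j), and moving the argument of the characteristic function
   of X to the imaginary axis gives E S^s = s^s e^(-s).  Hence E Y^j = r_j E W^j with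
   r_j = exp(h(alpha j) - h(j)), h(z) = ln Gamma(1+z) - z ln z + z.  By Binet's formula - ln r_j is
   an integral of 1 - e^(-j t) against a positive Levy measure, so r_j = E V^j where V = e^(-T) for
   an infinitely divisible T >= 0, and Y has the law of V W with V and W independent.  As the Levy
   measure charges the half-line beyond some l >= 4, P(V > xi) <= p with p < 1 and xi <= 1/3, so
   P(Y >= e) <= p P(W > c) + (1-p) P(xi W > c) for c < e.  Take e = alpha^(-alpha) and
   c = E W = 1 / Gamma(1+alpha) < e.  Since m_S >= 1-alpha the left-hand side is at least 1/2, while
   P(xi W > c) <= xi < 1/2 by Markov's inequality, which forces P(W > E W) > 1/2.

   The variable V is never constructed: it only acts on power series of exponential type,
   sum a_j x^j |-> sum r_j a_j x^j, which is enough since indicators of half-lines are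
   limits of (1 - e^(-N x))^q with q ~ e^(N b). *)

Require Import Defs.
From HB Require Import structures.
From mathcomp Require Import all_boot all_order all_algebra.
From mathcomp Require Import ring lra.
From mathcomp Require Import complex.
From mathcomp Require Import all_classical all_reals all_analysis.
From mathcomp Require Import measurable_realfun.

Set Implicit Arguments.
Unset Strict Implicit.
Unset Printing Implicit Defensive.

Import Order.TTheory GRing.Theory Num.Theory.
Import numFieldNormedType.Exports.

Local Open Scope classical_set_scope.
Local Open Scope ring_scope.

(** * Integrals over half-lines *)

(** The law of X is given on the real frequency line only, so the existence of E S^s is itself at
    stake. A factor e^(-sg^2 X^2 / 2) turns the exponential moment into a Gaussian average of the
    characteristic function; a vertical contour is moved to where the phase dies out as sg tends to
    0, and monotone convergence removes the damping.

    The Levy density is positive because 1/t - 1/(e^t - 1) decreases: rescaling Binet's density by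
    alpha gives both terms of - ln r_j the factor 1 - e^(-j t), and that function is compared at t
    and t / alpha.

    Exchanging sums and expectations needs a dominating function. It comes from Y, whose exponential
    moments are all finite since the exponent 1 - alpha of S is below 1, and passes to W through the
    identity of moments.

    The level alpha^(-alpha) is the one for which Y >= e means S >= 1 - alpha. The strict gap c < e
    is room for the smoothed indicators; it amounts to Gamma(1+alpha) > alpha^alpha, a strict
    concavity. The final contradiction is p/2 + (1-p)/3 < 1/2, so 1/3 only has to be below 1/2. *)

Section integration.
Context {R : realType}.
Notation mu := (@lebesgue_measure R).

Lemma cvg_is_derive (f : R -> R) (x d : R) : is_derive x 1 f d -> f z @[z --> x] --> f x.
Proof.
move=> df; apply: (@differentiable_continuous R R^o R^o).
by apply/derivable1_diffP; exact: ex_derive.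
Qed.

Lemma ge0_FTC2y (f F : R -> R) (a l : R) :
  (forall x, a <= x -> 0 <= f x) ->
  {within `[a, +oo[, continuous f} ->
  F x @[x --> +oo%R] --> l ->
  (forall x, a < x -> is_derive x 1 F (f x)) -> F x @[x --> a^'+] --> F a ->
  (\int[mu]_(x in `]a, +oo[) (f x)%:E = l%:E - (F a)%:E)%E.
Proof.
move=> f0 cf Fl dF Fa.
rewrite integral_itv_obnd_cbnd.
  apply: ge0_continuous_FTC2y => //.
    by move=> x /dF df; exact: ex_derive.
  move=> x; rewrite in_itv/= andbT => /dF df.
  by rewrite derive1E; exact: derive_val.
move: cf => /continuous_within_itvcyP[cf _].
apply/measurable_EFinP; apply: open_continuous_measurable_fun => //.
by apply/in_continuous_mksetP.
Qed.

Lemma FTC2 (f F : R -> R) (a b : R) : a < b ->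
  {within `[a, b], continuous f} -> {within `[a, b], continuous F} ->
  (forall x, a < x < b -> is_derive x 1 F (f x)) ->
  (\int[mu]_(x in `[a, b]) (f x)%:E = (F b)%:E - (F a)%:E)%E.
Proof.
move=> ab cf cF dF; apply: continuous_FTC2 => //.
  move: cF => /(continuous_within_itvP _ ab)[_ Fa Fb]; split => //.
  by move=> x; rewrite in_itv/= => /dF df; exact: ex_derive.
move=> x; rewrite in_itv/= => /dF df.
by rewrite derive1E; exact: derive_val.
Qed.

Lemma cvg_expR_linear (c : R) : 0 < c -> expR (- (c * x)) @[x --> +oo] --> (0 : R).
Proof.
move=> c0; have -> : (fun x : R => expR (- (c * x))) = (fun z => expR (- z)) \o (fun z => c * z) by [].
by apply: (@cvg_comp _ _ _ _ _ _ (pinfty_nbhs R)); [exact: gt0_cvgMry|exact: cvgr_expR].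
Qed.

Lemma is_derive_expRM (c x : R) : is_derive x 1 (fun x => expR (- (c * x))) (- c * expR (- (c * x))).
Proof.
by apply: is_derive_eq; rewrite /GRing.scale/=; ring.
Qed.

Lemma continuous_expRM (c : R) : continuous (fun x : R => expR (- (c * x))).
Proof. by move=> x; apply: cvg_is_derive; exact: is_derive_expRM. Qed.

Lemma integral_expR (c a : R) : 0 < c ->
  (\int[mu]_(x in `]a, +oo[) (expR (- (c * x)))%:E = (expR (- (c * a)) / c)%:E)%E.
Proof.
move=> c0; have -> : (expR (- (c * a)) / c)%:E = (0%:E - (- c^-1 * expR (- (c * a)))%:E :> \bar R)%E.
  by rewrite -EFinB sub0r mulNr opprK mulrC.
apply: (@ge0_FTC2y _ (fun x => - c^-1 * expR (- (c * x)))).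
- by move=> *; exact: expR_ge0.
- exact/continuous_subspaceT/continuous_expRM.
- by rewrite -[X in _ --> X](mulr0 (- c^-1)); apply: cvgM; [exact: cvg_cst|exact: cvg_expR_linear].
- move=> x _; have := is_derive_expRM c x => d.
  by apply: is_derive_eq; rewrite /GRing.scale/=; field; rewrite gt_eqF.
- by apply: cvg_at_right_filter; apply: cvgM; [exact: cvg_cst|exact: continuous_expRM].
Qed.

Lemma integral_powR (q y : R) : 0 <= q -> 0 < y ->
  (\int[mu]_(x in `]0%R, y]) ((q + 1) * x `^ q)%:E = (y `^ (q + 1))%:E)%E.
Proof.
move=> q0 y0.
have cpow p : 0 < p -> {within `[0, y], continuous (fun x => x `^ p)}.
  move=> p0; apply/(continuous_within_itvP _ y0); split.
  - move=> x; rewrite in_itv/= => /andP[x0 _].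
    by apply: cvg_is_derive; exact: is_derive1_powR.
  - by rewrite powR0 ?gt_eqF//; exact: powR_cvg0.
  - apply: cvg_at_left_filter.
    by apply: cvg_is_derive; exact: is_derive1_powR.
have cq : {within `[0, y], continuous (fun x => (q + 1) * x `^ q)}.
  (* [cpow] asks for a positive exponent; at [q = 0] the integrand is constant, because [powR] gives
     0^0 = 1. *)
  have [->|qn0] := eqVneq q 0.
    rewrite (_ : (fun x : R => _) = fun=> (0 + 1) * 1).
      by apply: continuous_subspaceT => x; exact: cvg_cst.
    by apply/funext => z; rewrite powRr0.
  by move=> x; apply: cvgM; [exact: cvg_cst|apply: cpow; rewrite lt_def qn0].
rewrite integral_itv_obnd_cbnd; last first.
  apply/measurable_EFinP; apply: measurable_funM => //.
  exact/measurable_funTS.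
have q1 : 0 < q + 1 by rewrite ltr_wpDl.
have -> : (y `^ (q + 1))%:E = ((y `^ (q + 1))%:E - (0 `^ (q + 1))%:E :> \bar R)%E.
  by rewrite powR0 ?sube0// gt_eqF.
apply: (@FTC2 _ (fun x => x `^ (q + 1))) => //; first exact: cpow.
move=> x /andP[x0 _]; apply: is_derive_eq; first exact: is_derive1_powR.
by rewrite addrK.
Qed.

End integration.

(** * Tonelli's theorem over a product of two sets *)

Section tonelli.
Local Open Scope ereal_scope.
Context d1 d2 (T1 : measurableType d1) (T2 : measurableType d2) (R : realType).
Variables (m1 : {sigma_finite_measure set T1 -> \bar R})
          (m2 : {sigma_finite_measure set T2 -> \bar R}).

Lemma tonelliD (D1 : set T1) (D2 : set T2) (f : T1 -> T2 -> \bar R) :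
  measurable D1 -> measurable D2 ->
  measurable_fun (D1 `*` D2) (fun z => f z.1 z.2) ->
  (forall x y, D1 x -> D2 y -> 0 <= f x y) ->
  \int[m1]_(x in D1) \int[m2]_(y in D2) f x y =
  \int[m2]_(y in D2) \int[m1]_(x in D1) f x y.
Proof.
move=> mD1 mD2 mf f0.
pose g := (fun z => f z.1 z.2) \_ (D1 `*` D2).
have := @fubini_tonelli _ _ T1 T2 R m1 m2 g.
have -> : \int[m1]_x \int[m2]_y g (x, y) = \int[m1]_(x in D1) \int[m2]_(y in D2) f x y.
  rewrite [RHS]integral_mkcond; apply: eq_integral => x _.
  rewrite patchE; case: ifPn => xD1.
    rewrite [RHS]integral_mkcond; apply: eq_integral => y _.
    by rewrite /g !patchE in_setX xD1.
  by rewrite integral0_eq// => y _; rewrite /g patchE in_setX (negbTE xD1).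
have -> : \int[m2]_y \int[m1]_x g (x, y) = \int[m2]_(y in D2) \int[m1]_(x in D1) f x y.
  rewrite [RHS]integral_mkcond; apply: eq_integral => y _.
  rewrite patchE; case: ifPn => yD2.
    rewrite [RHS]integral_mkcond; apply: eq_integral => x _.
    by rewrite /g !patchE in_setX yD2 andbT.
  by rewrite integral0_eq// => x _; rewrite /g patchE in_setX (negbTE yD2) andbF.
apply.
  by apply/(measurable_restrictT _ _).1 => //; exact: measurableX.
move=> z; rewrite /g patchE; case: ifPn => //.
by rewrite inE => -[/= zD1 zD2]; exact: f0.
Qed.

End tonelli.

(** * The Gamma function *)

Section gamma.
Context {R : realType}.
Notation mu := (@lebesgue_measure R).

Lemma integral_setIb d (T : measurableType d) (m : {measure set T -> \bar R})
    (D : set T) (f : T -> R) (b : T -> bool) :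
  (\int[m]_(x in D) (f x * (b x)%:R)%:E = \int[m]_(x in D `&` [set x | b x]) (f x)%:E)%E.
Proof.
rewrite integral_mkcondr; apply: eq_integral => x _; rewrite patchE mem_setE.
by rewrite unfold_in /=; case: (b x); rewrite ?mulr1 ?mulr0.
Qed.

Lemma measurable_fun_bool2R d (T : measurableType d) (D : set T) (f : T -> bool) :
  measurable_fun D f -> measurable_fun D (fun x => (f x)%:R : R).
Proof.
move=> mf; apply: (@measurableT_comp _ _ _ _ _ _ (fun b : bool => b%:R : R)) => //.
Qed.

(* [Gamma(1 + q)] *)
Definition gammaE (q : R) : \bar R := (\int[mu]_(x in `]0%R, +oo[) (x `^ q * expR (- x))%:E)%E.

(** Layer cake: the power of l is the integral of (q + 1) x^q over 0 < x <= (l / c)^a. After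
    exchanging the integrals the condition reads c x^(1/a) <= l, and e^(-l) integrates explicitly.
    With [a = c = 1] this replaces integration by parts in the functional equation of Gamma; with
    [c] a value of the stable variable it yields the negative moments. *)
Lemma integral_powR_expR (a c q : R) : 0 < a -> 0 < c -> 0 <= q ->
  (\int[mu]_(l in `]0%R, +oo[) (((l / c) `^ a) `^ (q + 1) * expR (- l))%:E =
   \int[mu]_(x in `]0%R, +oo[) ((q + 1) * x `^ q * expR (- (x `^ a^-1 * c)))%:E)%E.
Proof.
move=> a0 c0 q0.
transitivity (\int[mu]_(l in `]0%R, +oo[) \int[mu]_(x in `]0%R, +oo[)
    ((q + 1) * x `^ q * expR (- l) * (x <= (l / c) `^ a)%R%:R)%:E)%E.
  apply: eq_integral => l; rewrite inE/= in_itv/= andbT => l0.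
  have y0 : 0 < (l / c) `^ a by rewrite powR_gt0// divr_gt0.
  rewrite EFinM -integral_powR// -ge0_integralZr//; last 2 first.
  - apply/measurable_EFinP; apply: measurable_funM => //.
    exact/measurable_funTS.
  - by move=> x _; rewrite lee_fin mulr_ge0 ?powR_ge0// addr_ge0.
  rewrite integral_setIb (_ : _ `&` _ = `]0, (l / c) `^ a]%classic).
    by apply: eq_integral => x _; rewrite EFinM.
  by apply/seteqP; split=> x /=; rewrite !in_itv/= ?andbT; [move=> [-> ->]|move=> /andP[-> ->]].
rewrite tonelliD//; last 2 first.
- apply/measurable_EFinP; apply: measurable_funTS.
  apply: measurable_funM; first apply: measurable_funM.
  + apply: measurable_funM => //.
    apply: (@measurableT_comp _ _ _ _ _ _ (fun x => x `^ q)) => //.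
  + by apply: measurableT_comp => //; apply: measurableT_comp.
  + apply: measurable_fun_bool2R; apply: measurable_fun_ler => //.
    apply: (@measurableT_comp _ _ _ _ _ _ (fun x => x `^ a)) => //.
    exact: measurable_funM.
- move=> l x _ _; rewrite lee_fin !mulr_ge0 ?powR_ge0 ?expR_ge0//.
  by rewrite addr_ge0.
apply: eq_integral => x; rewrite inE/= in_itv/= andbT => x0.
have A0 : 0 < x `^ a^-1 * c by rewrite mulr_gt0// powR_gt0.
transitivity (\int[mu]_(l in `]0%R, +oo[) ((q + 1) * x `^ q * expR (- l) * (x `^ a^-1 * c <= l)%R%:R)%:E)%E.
  apply: eq_integral => l; rewrite inE/= in_itv/= andbT => l0.
  congr ((_ * (nat_of_bool _)%:R)%:E); rewrite -ler_pdivlMr//.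
  have lc0 : 0 <= l / c by rewrite divr_ge0 ?(ltW l0) ?(ltW c0).
  have x0' := ltW x0; have a0' := ltW a0.
  apply/idP/idP => h.
    rewrite -[leRHS](@powRr1 _ (l / c))// -(@mulfV _ a) ?gt_eqF// powRrM.
    by rewrite ge0_ler_powR ?invr_ge0 ?nnegrE ?powR_ge0.
  rewrite -[leLHS](@powRr1 _ x)// -(@mulVf _ a) ?gt_eqF// powRrM.
  by rewrite ge0_ler_powR ?nnegrE ?powR_ge0.
rewrite integral_setIb (_ : _ `&` _ = `[x `^ a^-1 * c, +oo[%classic); last first.
  apply/seteqP; split=> l /=; rewrite !in_itv/= ?andbT; [by case|move=> Al].
  by rewrite (lt_le_trans A0).
under eq_integral do rewrite EFinM.
rewrite ge0_integralZl//; last 2 first.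
- exact/measurable_EFinP/measurable_funTS/measurableT_comp.
- by rewrite lee_fin mulr_ge0 ?powR_ge0// addr_ge0.
rewrite -integral_itv_obnd_cbnd//; last exact/measurable_EFinP/measurable_funTS/measurableT_comp.
have := integral_expR (x `^ a^-1 * c) (ltr01 : 0 < 1 :> R).
under eq_integral do rewrite mul1r.
by move=> ->; rewrite mul1r divr1 EFinM.
Qed.

Lemma gammaE_ge0 q : (0 <= gammaE q)%E.
Proof. by apply: integral_ge0 => x _; rewrite lee_fin mulr_ge0 ?powR_ge0 ?expR_ge0. Qed.

Lemma gammaE0 : gammaE 0 = 1%E.
Proof.
have := integral_expR 0 (ltr01 : 0 < 1 :> R).
rewrite mulr0 oppr0 expR0 divr1 => <-; apply: eq_integral => x _.
by rewrite powRr0 !mul1r.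
Qed.

Let measurable_powR_expR (q : R) (D : set R) :
  measurable_fun D (fun x : R => (x `^ q * expR (- x))%:E).
Proof.
apply/measurable_EFinP/measurable_funTS; apply: measurable_funM => //.
exact: measurableT_comp.
Qed.

Lemma gammaED1 q : 0 <= q -> gammaE (q + 1) = ((q + 1)%:E * gammaE q)%E.
Proof.
move=> q0; rewrite /gammaE -ge0_integralZl//; last 3 first.
- exact: measurable_powR_expR.
- by move=> x _; rewrite lee_fin mulr_ge0 ?powR_ge0 ?expR_ge0.
- by rewrite lee_fin addr_ge0.
transitivity (\int[mu]_(l in `]0%R, +oo[) (((l / 1) `^ 1) `^ (q + 1) * expR (- l))%:E)%E.
  apply: eq_integral => x; rewrite inE/= in_itv/= andbT => x0.
  by rewrite divr1 powRr1 ?(ltW x0).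
rewrite integral_powR_expR//; apply: eq_integral => x.
rewrite inE/= in_itv/= andbT => x0.
by rewrite invr1 powRr1 ?(ltW x0)// mulr1 -EFinM mulrA.
Qed.

Lemma gammaE_nat n : gammaE n%:R = (n`!%:R)%:E.
Proof.
elim: n => [|n ih]; first by rewrite gammaE0.
by rewrite -natr1 gammaED1// ih -EFinM natr1 -natrM factS.
Qed.

(** Gamma integrates powers against a positive weight, so linear bounds between powers of x pass to
    it. Its finiteness and its log-convexity estimates are both obtained this way. *)
Lemma gammaE_le_comb (r p q a b : R) : 0 <= a -> 0 <= b ->
  (forall x : R, 0 < x -> x `^ r <= a * x `^ p + b * x `^ q) ->
  (gammaE r <= a%:E * gammaE p + b%:E * gammaE q)%E.
Proof.
move=> a0 b0 le.
have f0 (s x : R) : (`]0%R, +oo[%classic) x -> (0 <= (x `^ s * expR (- x))%:E)%E.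
  by move=> _; rewrite lee_fin mulr_ge0 ?powR_ge0 ?expR_ge0.
rewrite -!ge0_integralZl//; try by [exact: measurable_powR_expR|exact: f0].
rewrite -ge0_integralD//; last 4 first.
- by move=> x x0; rewrite mule_ge0// f0.
- by apply: measurable_funeM; exact: measurable_powR_expR.
- by move=> x x0; rewrite mule_ge0// f0.
- by apply: measurable_funeM; exact: measurable_powR_expR.
apply: ge0_le_integral => //.
- exact: f0.
- exact: measurable_powR_expR.
- by apply: emeasurable_funD; apply: measurable_funeM; exact: measurable_powR_expR.
move=> x; rewrite /= in_itv/= andbT => x0.
by rewrite -!EFinM -EFinD lee_fin !mulrA -mulrDl ler_wpM2r ?expR_ge0// le.
Qed.

Lemma gammaE_fin q : 0 <= q -> gammaE q \is a fin_num.
Proof.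
move=> q0; rewrite ge0_fin_numE ?gammaE_ge0//.
have [n qn] : exists n : nat, q <= n%:R.
  by exists (Num.truncn q).+1; rewrite ltW// truncnS_gt.
apply: (@le_lt_trans _ _ (1%:E * gammaE 0 + 1%:E * gammaE n%:R)%E); last first.
  by rewrite gammaE0 gammaE_nat !mul1e ltry.
apply: gammaE_le_comb => // x x0; rewrite powRr0 !mul1r.
have [x1|x1] := leP x 1.
  rewrite (@le_trans _ _ 1) ?lerDl ?powR_ge0//.
  by rewrite -[leRHS](powRr0 x) ger_powR// x0.
by rewrite (@le_trans _ _ (x `^ n%:R)) ?lerDr// ler_powR// ltW.
Qed.

(** Euler's Gamma at [1 + q], like [gammaE]. *)
Definition gamma q : R := fine (gammaE q).

Lemma gammaK q : 0 <= q -> (gamma q)%:E = gammaE q.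
Proof. by move=> q0; rewrite fineK// gammaE_fin. Qed.

Lemma gamma_nat n : gamma n%:R = n`!%:R.
Proof. by rewrite /gamma gammaE_nat. Qed.

Lemma gammaD1 q : 0 <= q -> gamma (q + 1) = (q + 1) * gamma q.
Proof. by move=> q0; rewrite /gamma gammaED1// fineM// gammaE_fin. Qed.

(** Weighted arithmetic-geometric mean of u and 1. The inequality 1 + t <= e^t is taken at (1 - z)
    ln u with weight z and at - z ln u with weight 1 - z, so that the logarithms cancel. *)
Lemma powR_bernoulli (u z : R) : 0 < u -> 0 <= z <= 1 -> u `^ z <= z * u + (1 - z).
Proof.
move=> u0 /andP[z0 z1]; rewrite /powR gt_eqF//.
have := expR_ge1Dx (ln u - z * ln u).
have := expR_ge1Dx (- (z * ln u)).
rewrite expRN expRB lnK ?posrE// => h1 h2.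
have E0 := expR_gt0 (z * ln u); set E := expR _ in h1 h2 E0 *.
rewrite -(ler_pM2r E0) mulVf ?gt_eqF// in h1.
rewrite -(ler_pM2r E0) divfK ?gt_eqF// in h2.
have := lerD (ler_wpM2l z0 h2) (ler_wpM2l (_ : 0 <= 1 - z) h1).
rewrite subr_ge0 => /(_ z1); nra.
Qed.

Lemma gamma_le_comb (r p q a b : R) : 0 <= a -> 0 <= b -> 0 <= r -> 0 <= p -> 0 <= q ->
  (forall x : R, 0 < x -> x `^ r <= a * x `^ p + b * x `^ q) ->
  gamma r <= a * gamma p + b * gamma q.
Proof.
move=> a0 b0 r0 p0 q0 le; have h := gammaE_le_comb a0 b0 le.
by rewrite -(gammaK r0) -(gammaK p0) -(gammaK q0) -!EFinM -EFinD lee_fin in h.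
Qed.

(** Upper half of Wendel's inequality: x^(n+z) is interpolated between x^n and x^(n+1) by
    [powR_bernoulli] at x / c. The scale [c = n + 1] is the ratio of the two Gamma values, which
    makes both terms collapse to n! c^z. *)
Lemma gamma_le (n : nat) (z : R) : 0 <= z <= 1 -> gamma (n%:R + z) <= n`!%:R * (n%:R + 1) `^ z.
Proof.
move=> z01; have /andP[z0 z1] := z01.
pose c : R := n%:R + 1; rewrite -/c.
have c0 : 0 < c by rewrite ltr_wpDl.
have -> : n`!%:R * c `^ z = ((1 - z) * c `^ z) * gamma n%:R + (z * c `^ z / c) * gamma (n%:R + 1).
  by rewrite gammaD1// gamma_nat -/c; field; rewrite gt_eqF.
apply: gamma_le_comb; rewrite ?divr_ge0 ?mulr_ge0 ?powR_ge0 ?subr_ge0 ?addr_ge0 ?(ltW c0)//.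
move=> x x0.
have pD r s : x `^ (r + s) = x `^ r * x `^ s by rewrite powRD // (gt_eqF x0) implybT.
rewrite pD (pD _ 1) powRr1 ?(ltW x0)//.
have xc0 : 0 < x / c by rewrite divr_gt0.
have := powR_bernoulli xc0 z01.
rewrite -(ler_pM2r (powR_gt0 z c0)) -powRM ?(ltW xc0) ?(ltW c0)// divfK ?gt_eqF//.
rewrite -(ler_pM2l (powR_gt0 n%:R x0)) => /le_trans; apply.
by rewrite le_eqVlt; apply/orP; left; apply/eqP; field; rewrite gt_eqF.
Qed.

(** Lower half: the exponent n + 1 is interpolated between n + z and n + z + 1 with weight 1 - z,
    and [c] is again the ratio of the Gamma values at the end points. *)
Lemma gamma_ge (n : nat) (z : R) : 0 <= z <= 1 ->
  n.+1`!%:R <= gamma (n%:R + z) * (n%:R + 1 + z) `^ (1 - z).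
Proof.
move=> z01; have /andP[z0 z1] := z01.
pose c : R := n%:R + 1 + z; rewrite -/c.
have c0 : 0 < c by rewrite ltr_wpDr// ltr_wpDl.
have nz0 : 0 <= n%:R + z by rewrite addr_ge0.
have -> : gamma (n%:R + z) * c `^ (1 - z) =
    (z * c `^ (1 - z)) * gamma (n%:R + z) + ((1 - z) * c `^ (1 - z) / c) * gamma (n%:R + z + 1).
  rewrite gammaD1// (_ : n%:R + z + 1 = c); last by rewrite /c addrAC.
  by field; rewrite gt_eqF.
rewrite -gamma_nat -natr1.
apply: gamma_le_comb; rewrite ?divr_ge0 ?mulr_ge0 ?powR_ge0 ?subr_ge0 ?addr_ge0 ?(ltW c0)//.
move=> x x0.
have pD r s : x `^ (r + s) = x `^ r * x `^ s by rewrite powRD // (gt_eqF x0) implybT.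
rewrite (_ : n%:R + 1 = n%:R + z + (1 - z)); last by ring.
rewrite pD (pD _ 1) pD powRr1 ?(ltW x0)//.
have xc0 : 0 < x / c by rewrite divr_gt0.
have z01' : 0 <= 1 - z <= 1 by rewrite subr_ge0 z1 gerBl.
have := powR_bernoulli xc0 z01'.
rewrite -(ler_pM2r (powR_gt0 (1 - z) c0)) -powRM ?(ltW xc0) ?(ltW c0)// divfK ?gt_eqF//.
rewrite -(ler_pM2l (powR_gt0 (n%:R) x0)) -(ler_pM2l (powR_gt0 z x0)) => h.
apply: (le_trans _ (le_trans h _)).
  by rewrite !mulrA [x `^ z * _]mulrC.
by rewrite le_eqVlt; apply/orP; left; apply/eqP; field; rewrite gt_eqF.
Qed.

Lemma gamma_gt0 q : 0 <= q -> 0 < gamma q.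
Proof.
move=> q0; have /andP[nq qn] := truncn_itv q0.
have z01 : 0 <= q - (Num.truncn q)%:R <= 1.
  by rewrite subr_ge0 nq lerBlDr addrC natr1 ltW.
have := gamma_ge (Num.truncn q) z01; rewrite addrC subrK => h.
have : 0 < (Num.truncn q).+1`!%:R :> R by rewrite ltr0n fact_gt0.
move=> /lt_le_trans/(_ h).
by rewrite pmulr_lgt0// powR_gt0// ltr_wpDr//; case/andP: z01.
Qed.

End gamma.

(** * Binet's formula *)

Section binet.
Context {R : realType}.
Notation mu := (@lebesgue_measure R).

Lemma measurable_invr : measurable_fun [set: R] (fun x : R => x^-1).
Proof.
have -> : (fun x : R => x^-1) = (fun x => x * (x ^+ 2) `^ (-1)).
  apply/funext => x; rewrite powR_inv1 ?sqr_ge0//.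
  by have [->|x0] := eqVneq x 0; [rewrite mul0r invr0|field].
apply: measurable_funM => //.
by apply: (@measurableT_comp _ _ _ _ _ _ (fun x => x `^ (-1))).
Qed.

Lemma measurable_funV d (T : measurableType d) (D : set T) (f : T -> R) :
  measurable_fun D f -> measurable_fun D (fun x => (f x)^-1).
Proof. by move=> mf; apply: (measurableT_comp measurable_invr). Qed.

(** Kernel that represents ln Gamma(1+z) - z ln z + z as an integral of 1 - e^(-z t); times t, it is
    the Laplace kernel of the derivative digamma(1+z) - ln z. *)
Definition binet_kernel (t : R) : R := (t^-1 - (expR t - 1)^-1) / t.

Lemma measurable_binet_kernel : measurable_fun [set: R] binet_kernel.
Proof.
apply: measurable_funM; last exact: measurable_invr.
apply: measurable_funB; first exact: measurable_invr.
by apply: measurable_funV; exact: measurable_funB.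
Qed.

Lemma expRB1_gt (t : R) : 0 < t -> t < expR t - 1.
Proof. by move=> t0; rewrite ltrBrDl expR_gt1Dx// gt_eqF. Qed.

Lemma binet_kernel_ge0 t : 0 < t -> 0 <= binet_kernel t.
Proof.
move=> t0; have et := expRB1_gt t0.
rewrite divr_ge0 ?(ltW t0)// subr_ge0 lef_pV2 ?posrE//; first exact: ltW.
exact: lt_trans et.
Qed.

(** Turns the increment of Binet's integral into a double integral of y e^(-(z+y) t); integrating in
    t first leaves y / (z + y). *)
Lemma binet_kernelE t : 0 < t ->
  (\int[mu]_(y in `]0%R, 1%R]) (y * expR (- (t * y)))%:E = ((1 - expR (- t)) * binet_kernel t)%:E)%E.
Proof.
move=> t0; have t0' : t != 0 by rewrite gt_eqF.
pose F (y : R) : R := - (y / t + t ^- 2) * expR (- (t * y)).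
have dF (y : R) : is_derive y (1:R) F (y * expR (- (t * y))).
  have d := is_derive_expRM t y.
  by apply: is_derive_eq; rewrite /GRing.scale/=; field.
have cf : continuous (fun y : R => y * expR (- (t * y))).
  move=> y; apply: (@cvg_is_derive _ _ _ (expR (- (t * y)) + y * (- t * expR (- (t * y))))).
  have d := is_derive_expRM t y.
  by apply: is_derive_eq; rewrite /GRing.scale/=; ring.
rewrite integral_itv_obnd_cbnd; last first.
  by apply/measurable_EFinP; apply: measurable_funTS; exact: continuous_measurable_fun.
have -> : ((1 - expR (- t)) * binet_kernel t)%:E = ((F 1)%:E - (F 0)%:E :> \bar R)%E.
  rewrite -EFinB; congr (_%:E); rewrite /F /binet_kernel !mulr0 oppr0 expR0 mulr1 mul1r expRN.
  have et0 : expR t - 1 != 0.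
    by rewrite gt_eqF// (lt_trans t0)// expRB1_gt.
  by field; rewrite t0' et0 (gt_eqF (expR_gt0 t)).
apply: FTC2 => //; first exact: continuous_subspaceT.
by apply: continuous_subspaceT => y; exact: (cvg_is_derive (dF y)).
Qed.

(* The increment [stirling (z + 1) - stirling z] of the Stirling remainder defined below. *)
Definition stirling_incr (z : R) : R := 1 + z * ln z - z * ln (z + 1).

Lemma stirling_incrE z : 0 <= z ->
  (\int[mu]_(y in `]0%R, 1%R]) (y / (z + y))%:E = (stirling_incr z)%:E)%E.
Proof.
(* [z = 0] is separate because the antiderivative y - z ln (z + y) is differentiated at y = 0
   below. *)
rewrite le_eqVlt => /predU1P[<-|z0].
  rewrite /stirling_incr !mul0r addr0 subr0.
  rewrite (eq_integral (cst 1%E)).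
    by rewrite integral_cst//= lebesgue_measure_itv/= lte01 sube0 mul1e.
  move=> y; rewrite inE/= in_itv/= => /andP[y0 _].
  by rewrite add0r divff// gt_eqF.
pose F (y : R) : R := y - z * ln (z + y).
have dln (y : R) : 0 <= y -> is_derive y (1:R) F (y / (z + y)).
  move=> y0; have zy : 0 < z + y by rewrite ltr_wpDr.
  have d := is_derive1_ln zy.
  have d1 : is_derive y (1:R) (fun y => z + y) 1 by apply: is_derive_eq; rewrite add0r mulr1.
  have d2 := is_derive1_comp d d1.
  by apply: is_derive_eq; rewrite /GRing.scale/=; field; rewrite gt_eqF.
have cf (y : R) : 0 <= y -> (y' / (z + y')) @[y' --> y] --> y / (z + y).
  move=> y0; have zy : z + y != 0 by rewrite gt_eqF// ltr_wpDr.
  by apply: cvgM; [exact: cvg_id|apply: cvgV => //; apply: cvgD; [exact: cvg_cst|exact: cvg_id]].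
rewrite integral_itv_obnd_cbnd; last first.
  apply/measurable_EFinP/measurable_funTS; apply: measurable_funM => //.
  by apply: measurable_funV; exact: measurable_funD.
have -> : (stirling_incr z)%:E = ((F 1)%:E - (F 0)%:E :> \bar R)%E.
  by rewrite -EFinB; congr (_%:E); rewrite /F /stirling_incr addr0; ring.
apply: FTC2 => //.
- apply/(continuous_within_itvP _ ltr01); split.
  + by move=> y; rewrite in_itv/= => /andP[/ltW y0 _]; exact: cf.
  + by apply: cvg_at_right_filter; exact: cf.
  + by apply: cvg_at_left_filter; exact: cf.
- apply/(continuous_within_itvP _ ltr01); split.
  + by move=> y; rewrite in_itv/= => /andP[/ltW y0 _]; exact: (cvg_is_derive (dln _ y0)).
  + by apply: cvg_at_right_filter; exact: (cvg_is_derive (dln _ (lexx _))).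
  + by apply: cvg_at_left_filter; exact: (cvg_is_derive (dln _ ler01)).
- by move=> y /andP[/ltW y0 _]; exact: dln.
Qed.

(** Density of the image of Binet's measure under t -> a t. *)
Definition binet_dens (a t : R) : R := binet_kernel (t / a) / a.

Lemma measurable_binet_dens a : measurable_fun [set: R] (binet_dens a).
Proof.
apply: measurable_funM => //.
by apply: (measurableT_comp measurable_binet_kernel); exact: measurable_funM.
Qed.

Lemma binet_dens_ge0 a t : 0 < a -> 0 < t -> 0 <= binet_dens a t.
Proof. by move=> a0 t0; rewrite divr_ge0 ?(ltW a0)// binet_kernel_ge0// divr_gt0. Qed.

Lemma integral_stirling_incr a z : 0 < a -> 0 <= z ->
  (\int[mu]_(t in `]0%R, +oo[)
     (expR (- (z * (t / a))) * ((1 - expR (- (t / a))) * binet_dens a t))%:E = (stirling_incr z)%:E)%E.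
Proof.
move=> a0 z0.
transitivity (\int[mu]_(t in `]0%R, +oo[) \int[mu]_(y in `]0%R, 1%R])
    (y / a * expR (- ((z + y) / a * t)))%:E)%E.
  apply: eq_integral => t; rewrite inE/= in_itv/= andbT => t0.
  have ta0 : 0 < t / a by rewrite divr_gt0.
  rewrite /binet_dens mulrA [_ * (_ / a)]mulrA -[in LHS](mulrA _ _ (binet_kernel _)) mulrAC.
  rewrite EFinM -binet_kernelE// -ge0_integralZl//.
  - apply: eq_integral => y _; rewrite -EFinM; congr (_%:E).
    rewrite (_ : - ((z + y) / a * t) = - (z * (t / a)) + - (t / a * y)); last by ring.
    by rewrite expRD; ring.
  - apply/measurable_EFinP/measurable_funTS; apply: measurable_funM => //.
    by apply: measurableT_comp => //; apply: measurableT_comp => //; exact: measurable_funM.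
  - by move=> y; rewrite /= in_itv/= => /andP[/ltW y0 _]; rewrite lee_fin mulr_ge0 ?expR_ge0.
  - by rewrite lee_fin divr_ge0 ?expR_ge0 ?(ltW a0).
rewrite tonelliD//; last 2 first.
- apply/measurable_EFinP/measurable_funTS; apply: measurable_funM; first exact: measurable_funM.
  do 2 apply: measurableT_comp => //; apply: measurable_funM => //.
  by apply: measurable_funM => //; exact: measurable_funD.
- move=> t y _; rewrite /= in_itv/= => /andP[/ltW y0 _].
  by rewrite lee_fin mulr_ge0 ?expR_ge0// divr_ge0// ltW.
rewrite -stirling_incrE//; apply: eq_integral => y; rewrite inE/= in_itv/= => /andP[y0 _].
have zy0 : 0 < z + y by rewrite ltr_wpDl.
under eq_integral do rewrite EFinM.
rewrite ge0_integralZl//; last 2 first.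
- apply/measurable_EFinP/measurable_funTS.
  by do 2 apply: measurableT_comp => //; exact: measurable_funM.
- by rewrite lee_fin divr_ge0 ?(ltW y0) ?(ltW a0).
rewrite integral_expR ?divr_gt0// mulr0 oppr0 expR0 -EFinM; congr (_%:E).
by field; rewrite !gt_eqF.
Qed.

End binet.

Section binet_formula.
Context {R : realType}.
Notation mu := (@lebesgue_measure R).

Lemma ln_le_subr1 (w : R) : 0 < w -> ln w <= w - 1.
Proof.
move=> w0; rewrite -[in leLHS](subrKC 1 w) le_ln1Dx//.
by rewrite ltrBrDr addNr.
Qed.

Lemma ln_ge_1subV (w : R) : 0 < w -> 1 - w^-1 <= ln w.
Proof.
move=> w0; have w0' : 0 < w^-1 by rewrite invr_gt0.
by have := ln_le_subr1 w0'; rewrite lnV ?posrE// lerNl opprB.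
Qed.

(** Bounds the oscillation of Binet's integral between consecutive integers. *)
Lemma stirling_incr_le (z : R) : 0 < z -> stirling_incr z <= z^-1.
Proof.
move=> z0; have z10 : 0 < z + 1 by rewrite addr_gt0.
have := ln_ge_1subV (divr_gt0 z10 z0); rewrite ln_div ?posrE// invf_div.
move=> /(ler_wpM2l (ltW z0)) h.
rewrite /stirling_incr (@le_trans _ _ (1 - z * (1 - z / (z + 1))))//.
  by rewrite -addrA lerD2l -mulrBr -opprB mulrN lerN2 h.
rewrite (_ : 1 - _ = (z + 1)^-1); last by field; rewrite gt_eqF.
by rewrite lef_pV2 ?posrE// lerDl.
Qed.

(** Kept in [\bar R]: finiteness comes out of the comparison with [stirling] at the integers. *)
Definition binetE (a z : R) : \bar R :=
  (\int[mu]_(t in `]0%R, +oo[) ((1 - expR (- (z * (t / a)))) * binet_dens a t)%:E)%E.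

(** The [h] of the overview. As [ln 0 = 0], its value at 0 is the limit 0. *)
Definition stirling (z : R) : R := ln (gamma z) - z * ln z + z.

Lemma stirling0 : stirling 0 = 0.
Proof. by rewrite /stirling (@gamma_nat R 0) ln1 mul0r subrr addr0. Qed.

Lemma stirlingD1 z : 0 <= z -> stirling (z + 1) = stirling z + stirling_incr z.
Proof.
move=> z0; have z10 : 0 < z + 1 by rewrite ltr_wpDl.
by rewrite /stirling gammaD1// lnM ?posrE ?gamma_gt0// /stirling_incr; ring.
Qed.

(** Wendel's two bounds differ by a factor 1 + O(1/n). After taking logarithms, those of ratios of
    points near n are linearised by 1 - 1/w <= ln w <= w - 1. *)
Lemma stirling_near_nat (n : nat) (z : R) : (0 < n)%N -> 0 <= z <= 1 ->
  `|stirling (n%:R + z) - stirling n%:R| <= 2 / n%:R.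
Proof.
move=> n0 z01; have /andP[z0 z1] := z01.
have N0 : 0 < n%:R :> R by rewrite ltr0n.
have := gamma_le n z01; have := gamma_ge n z01.
rewrite /stirling gamma_nat; set N : R := n%:R in N0 *.
have Nz0 : 0 < N + z by rewrite ltr_wpDr.
have N10 : 0 < N + 1 by rewrite ltr_wpDr.
have N1z0 : 0 < N + 1 + z by rewrite ltr_wpDr.
have nf0 : 0 < n`!%:R :> R by rewrite ltr0n fact_gt0.
have gp := gamma_gt0 (ltW Nz0).
rewrite factS natrM -natr1 -/N.
have up0 := powR_gt0 z N10; have lo0 := powR_gt0 (1 - z) N1z0.
move=> lo up.
have {}lo : ln (N + 1) + ln n`!%:R <= ln (gamma (N + z)) + (1 - z) * ln (N + 1 + z).
  by rewrite -ln_powR -!lnM ?posrE// ler_ln ?posrE ?mulr_gt0.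
have {}up : ln (gamma (N + z)) <= ln n`!%:R + z * ln (N + 1).
  by rewrite -ln_powR -!lnM ?posrE// ler_ln ?posrE ?mulr_gt0.
have u1 : ln (N + 1) - ln (N + z) <= N^-1.
  rewrite -ln_div ?posrE// (le_trans (ln_le_subr1 (divr_gt0 N10 Nz0)))//.
  rewrite (_ : _ - 1 = (1 - z) / (N + z)); last by field; rewrite gt_eqF.
  by rewrite ler_pdivrMr// mulrC ler_pdivlMr//; nra.
have u2 : z / (N + z) <= ln (N + z) - ln N.
  rewrite -ln_div ?posrE// (le_trans _ (ln_ge_1subV (divr_gt0 Nz0 N0)))//.
  by rewrite invf_div le_eqVlt; apply/orP; left; apply/eqP; field; rewrite gt_eqF.
have u3 : ln (N + z) - ln N <= z / N.
  rewrite -ln_div ?posrE// (le_trans (ln_le_subr1 (divr_gt0 Nz0 N0)))//.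
  by rewrite le_eqVlt; apply/orP; left; apply/eqP; field; rewrite gt_eqF.
have u4 : ln (N + 1 + z) - ln (N + 1) <= N^-1.
  rewrite -ln_div ?posrE// (le_trans (ln_le_subr1 (divr_gt0 N1z0 N10)))//.
  rewrite (_ : _ - 1 = z / (N + 1)); last by field; rewrite gt_eqF.
  by rewrite ler_pdivrMr// mulrC ler_pdivlMr//; nra.
have u5 : 0 <= ln (N + 1 + z) - ln (N + z).
  by rewrite subr_ge0 ler_ln ?posrE// lerD2r lerDl.
have u6 : z - N * (z / (N + z)) <= N^-1.
  rewrite (_ : z - _ = z ^+ 2 / (N + z)); last by field; rewrite gt_eqF.
  have z2 : z ^+ 2 <= 1 by rewrite exprn_ile1.
  have zN := ler_wpM2l (ltW N0) z2.
  by rewrite ler_pdivrMr// [leRHS]mulrC ler_pdivlMr//; lra.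
have zu1 := ler_wpM2l z0 u1.
have zu5 := mulr_ge0 z0 u5.
have Nu2 := ler_wpM2l (ltW N0) u2.
have Nu3 := ler_wpM2l (ltW N0) u3.
have eN : N * (z / N) = z by field; rewrite gt_eqF.
rewrite eN in Nu3.
have iN : 0 < N^-1 by rewrite invr_gt0.
have ziN : z * N^-1 <= N^-1 by rewrite ler_piMl// ltW.
by rewrite ler_norml; apply/andP; split; lra.
Qed.

Section formula.
Variable a : R.
Hypothesis a0 : 0 < a.

Let f_ge0 z t : 0 <= z -> 0 < t -> 0 <= (1 - expR (- (z * (t / a)))) * binet_dens a t.
Proof.
move=> z0 t0; rewrite mulr_ge0 ?binet_dens_ge0// subr_ge0 expR_le1 oppr_le0.
by rewrite !mulr_ge0 ?invr_ge0 ?(ltW t0) ?(ltW a0).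
Qed.

Let mf z (D : set R) : measurable_fun D (fun t => ((1 - expR (- (z * (t / a)))) * binet_dens a t)%:E).
Proof.
apply/measurable_EFinP/measurable_funTS; apply: measurable_funM; last exact: measurable_binet_dens.
apply: measurable_funB => //; do 2 apply: measurableT_comp => //.
by apply: measurable_funM => //; exact: measurable_funM.
Qed.

Lemma binetE0 : binetE a 0 = 0%E.
Proof. by apply: integral0_eq => x _; rewrite mul0r oppr0 expR0 subrr mul0r. Qed.

Lemma binetED1 z : 0 <= z -> binetE a (z + 1) = (binetE a z + (stirling_incr z)%:E)%E.
Proof.
move=> z0; rewrite -(integral_stirling_incr a0 z0) -ge0_integralD//.
- apply: eq_integral => t _; rewrite -EFinD; congr (_%:E).
  rewrite (_ : - ((z + 1) * (t / a)) = - (z * (t / a)) + - (t / a)); last by ring.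
  by rewrite expRD; ring.
- by move=> t; rewrite /= in_itv/= andbT => t0; rewrite lee_fin f_ge0.
- exact: mf.
- move=> t; rewrite /= in_itv/= andbT => t0.
  rewrite lee_fin mulr_ge0 ?expR_ge0// mulr_ge0 ?binet_dens_ge0//.
  by rewrite subr_ge0 expR_le1 oppr_le0 divr_ge0 ?(ltW t0) ?(ltW a0).
- apply/measurable_EFinP/measurable_funTS; apply: measurable_funM.
    do 2 apply: measurableT_comp => //; apply: measurable_funM => //; exact: measurable_funM.
  apply: measurable_funM; last exact: measurable_binet_dens.
  apply: measurable_funB => //; do 2 apply: measurableT_comp => //; exact: measurable_funM.
Qed.

Lemma binetE_ge0 z : 0 <= z -> (0 <= binetE a z)%E.
Proof.
move=> z0; apply: integral_ge0 => t; rewrite /= in_itv/= andbT => t0.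
by rewrite lee_fin f_ge0.
Qed.

Lemma binetE_le z w : 0 <= z -> z <= w -> (binetE a z <= binetE a w)%E.
Proof.
move=> z0 zw; apply: ge0_le_integral => //.
- by move=> t; rewrite /= in_itv/= andbT => t0; rewrite lee_fin f_ge0.
- exact: mf.
- exact: mf.
- move=> t; rewrite /= in_itv/= andbT => t0; rewrite lee_fin ler_wpM2r ?binet_dens_ge0//.
  by rewrite lerD2l lerN2 ler_expR lerN2 ler_wpM2r// divr_ge0 ?(ltW t0) ?(ltW a0).
Qed.

(** Each increment is computed exactly, so the induction also yields finiteness at the integers;
    monotonicity in z then gives it everywhere. *)
Lemma binetE_nat n : binetE a n%:R = (stirling n%:R)%:E.
Proof.
elim: n => [|n ih]; first by rewrite binetE0 stirling0.
by rewrite -natr1 binetED1// ih stirlingD1.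
Qed.

Lemma binetE_fin z : 0 <= z -> binetE a z \is a fin_num.
Proof.
move=> z0; rewrite ge0_fin_numE ?binetE_ge0//.
have zn : z <= (Num.truncn z).+1%:R by rewrite ltW// truncnS_gt.
by rewrite (le_lt_trans (binetE_le z0 zn))// binetE_nat ltry.
Qed.

(* The difference of both sides has period 1 and tends to [0] along [n + z].  The scale [a] is
   free, so that [stirling (alpha * j)] and [stirling j] become integrals of the same [1 - e^(-j t)]. *)
Lemma stirling_binet z : 0 <= z -> (stirling z)%:E = binetE a z.
Proof.
move=> z0; rewrite -[RHS]fineK ?binetE_fin//; congr (_%:E).
pose h z := stirling z - fine (binetE a z).
have hD1 w : 0 <= w -> h (w + 1) = h w.
  move=> w0; rewrite /h (stirlingD1 w0) (binetED1 w0).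
  rewrite (@fineD R (binetE a w) (stirling_incr w)%:E (binetE_fin w0) isT).
  by rewrite opprD addrACA subrr addr0.
have hDn w n : 0 <= w -> h (w + n%:R) = h w.
  move=> w0; elim: n => [|n ih]; first by rewrite addr0.
  by rewrite -natr1 addrA hD1 ?addr_ge0.
have h01 w : 0 <= w <= 1 -> h w = 0.
  move=> w01; have /andP[w0 w1] := w01.
  apply/eqP; rewrite -normr_le0; apply/ler_addgt0Pl => e e0; rewrite addr0.
  (* By periodicity w may be replaced by n + w. There [stirling] is within 2 / n of its value at n,
     and the monotone integral lies between its values at n and n + 1, which differ by at most 1 /
     n. *)
  pose n := (Num.truncn (3 / e)).+1.
  have n0 : 0 < n%:R :> R by rewrite ltr0n.
  have ne : 3 / n%:R <= e.
    by rewrite ler_pdivrMr// mulrC -ler_pdivrMr// ltW// truncnS_gt.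
  apply: le_trans ne; rewrite -(hDn w n w0) addrC.
  have -> : h (n%:R + w) = stirling (n%:R + w) - stirling n%:R - (fine (binetE a (n%:R + w)) - stirling n%:R).
    by rewrite /h; ring.
  apply: (le_trans (ler_normB _ _)); rewrite (_ : 3 / n%:R = 2 / n%:R + n%:R^-1); last by ring.
  apply: lerD; first exact: stirling_near_nat.
  have nw0 : 0 <= n%:R + w by rewrite addr_ge0.
  have lo : stirling n%:R <= fine (binetE a (n%:R + w)).
    by rewrite -lee_fin fineK ?binetE_fin// -binetE_nat binetE_le// lerDl.
  have up : fine (binetE a (n%:R + w)) <= stirling n%:R + stirling_incr n%:R.
    by rewrite -lee_fin fineK ?binetE_fin// -stirlingD1// natr1 -binetE_nat binetE_le// -natr1 lerD2l.
  rewrite ger0_norm ?subr_ge0// lerBlDl (le_trans up)// lerD2l.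
  exact: stirling_incr_le.
have /andP[nz zn] := truncn_itv z0.
have : h z = 0.
  rewrite -(subrK (Num.truncn z)%:R z) hDn ?subr_ge0// h01// subr_ge0 nz.
  by rewrite lerBlDr addrC natr1 ltW.
by rewrite /h => /eqP; rewrite subr_eq0 => /eqP.
Qed.

End formula.
End binet_formula.

(** * Moments of negative powers of a positive stable variable *)

Section stable_moments.
Context d (T : measurableType d) (R : realType) (P : probability T R).
Notation mu := (@lebesgue_measure R).

(** For n > 0, scaling writes Gamma(1 + a n) Z^(-a n) as the integral of n x^(n-1) e^(-x^(1/a) Z).
    Its expectation involves the Laplace transform at x^(1/a), that is e^(-x), and n Gamma(n) = n!
    remains. The product form makes sense before the moment is known to be finite. *)
Lemma stable_moment (a : R) (Z : T -> R) (n : nat) : 0 < a ->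
  measurable_fun [set: T] Z -> (forall t, 0 < Z t) ->
  (forall l : R, 0 <= l -> (\int[P]_t (expR (- (l * Z t)))%:E = (expR (- (l `^ a)))%:E)%E) ->
  ((gamma (a * n%:R))%:E * \int[P]_t ((Z t `^ (- a)) ^+ n)%:E = (n`!%:R)%:E)%E.
Proof.
move=> a0 mZ Z0 LZ; case: n => [|n].
  rewrite mulr0 (@gamma_nat R 0) mul1e.
  under eq_integral do rewrite expr0.
  by rewrite integral_cst//= mul1e probability_setT.
have an0 : 0 <= a * n.+1%:R by rewrite mulr_ge0 ?(ltW a0).
have mZn : measurable_fun [set: T] (fun t => (Z t `^ (- a)) ^+ n.+1).
  apply: measurable_funX.
  exact: (@measurableT_comp _ _ _ _ _ _ (fun x => x `^ (- a))).
rewrite -ge0_integralZl//; last 3 first.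
- exact/measurable_EFinP.
- by move=> t _; rewrite lee_fin exprn_ge0// powR_ge0.
- by rewrite lee_fin ltW// gamma_gt0.
transitivity (\int[P]_t \int[mu]_(x in `]0%R, +oo[)
    ((n%:R + 1) * x `^ n%:R * expR (- (x `^ a^-1 * Z t)))%:E)%E.
  apply: eq_integral => t _; rewrite -integral_powR_expR//.
  rewrite gammaK// muleC /gammaE -ge0_integralZl//.
  - apply: eq_integral => l; rewrite inE/= in_itv/= andbT => l0.
    rewrite -EFinM; congr (_%:E); rewrite mulrA; congr (_ * _).
    rewrite natr1 powRM ?invr_ge0 ?(ltW l0) ?(ltW (Z0 t))//.
    rewrite powRM ?powR_ge0// -powRrM mulrC; congr (_ * _).
    by rewrite powR_mulrn ?powR_ge0// -powR_inv1 ?(ltW (Z0 t))// -powRrM mulN1r.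
  - apply/measurable_EFinP/measurable_funTS; apply: measurable_funM => //.
    exact: measurableT_comp.
  - by move=> l _; rewrite lee_fin mulr_ge0 ?powR_ge0 ?expR_ge0.
  - by rewrite lee_fin exprn_ge0// powR_ge0.
rewrite tonelliD//; last 2 first.
- apply/measurable_EFinP/measurable_funTS; apply: measurable_funM.
    apply: measurable_funM => //.
    by apply: (@measurableT_comp _ _ _ _ _ _ (fun x => x `^ n%:R)).
  do 2 apply: measurableT_comp => //.
  apply: measurable_funM.
    by apply: (@measurableT_comp _ _ _ _ _ _ (fun x => x `^ a^-1)).
  exact: (measurableT_comp mZ).
- by move=> t x _ _; rewrite lee_fin !mulr_ge0 ?powR_ge0 ?expR_ge0// addr_ge0.
transitivity ((n%:R + 1)%:E * @gammaE R n%:R)%E; last first.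
  by rewrite gammaE_nat -EFinM natr1 -natrM factS.
rewrite /gammaE -ge0_integralZl//; last 2 first.
- apply/measurable_EFinP/measurable_funTS; apply: measurable_funM => //.
  exact: measurableT_comp.
- by move=> l _; rewrite lee_fin mulr_ge0 ?powR_ge0 ?expR_ge0.
apply: eq_integral => x; rewrite inE/= in_itv/= andbT => x0.
under eq_integral do rewrite EFinM.
rewrite ge0_integralZl//; last 2 first.
- apply/measurable_EFinP; do 2 apply: measurableT_comp => //.
  exact: measurable_funM.
- by rewrite lee_fin mulr_ge0 ?powR_ge0 ?addr_ge0.
by rewrite LZ ?powR_ge0// -powRrM mulVf ?gt_eqF// powRr1 ?(ltW x0)// -!EFinM mulrA.
Qed.

End stable_moments.

(** * Contour shift *)

Section contour.
Context {R : realType}.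
Notation mu := (@lebesgue_measure R).

Lemma pos_itv (x : R) : (x \in (`]0%R, +oo[%classic : set R)) = (0 < x).
Proof. by rewrite mem_setE in_itv/= andbT. Qed.

Lemma integrable_expRN (c : R) : mu.-integrable `]0%R, +oo[ (fun x => (c * expR (- x))%:E).
Proof.
have -> : (fun x : R => (c * expR (- x))%:E) = (fun x => c%:E * (expR (- x))%:E)%E by apply/funext => x; rewrite EFinM.
apply: integrableZl => //; apply/integrableP; split.
  exact/measurable_EFinP/measurable_funTS/measurableT_comp.
have h := integral_expR 0 (ltr01 : 0 < 1 :> R).
rewrite [X in (X < _)%E](_ : _ = \int[mu]_(x in `]0%R, +oo[) (expR (- (1 * x)))%:E)%E.
  by rewrite h ltry.
by apply: eq_integral => x _; rewrite mul1r gee0_abs// lee_fin expR_ge0.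
Qed.

Lemma measurable_pos_cont (f : R -> R) :
  (forall x : R, 0 < x -> f y @[y --> x] --> f x) -> measurable_fun (`]0%R, +oo[%classic : set R) f.
Proof.
move=> cf; apply: open_continuous_measurable_fun => //.
by apply/in_continuous_mksetP => x; rewrite in_itv/= andbT => x0; exact: cf.
Qed.

Lemma integrable_pos_cont (f : R -> R) (c : R) : measurable_fun (`]0%R, +oo[%classic : set R) f ->
  (forall x : R, 0 < x -> `|f x| <= c * expR (- x)) ->
  mu.-integrable (`]0%R, +oo[%classic : set R) (EFin \o f).
Proof.
move=> mf fc; apply: le_integrable (integrable_expRN c) => //.
  exact/measurable_EFinP.
move=> x; rewrite /= in_itv/= andbT => x0; rewrite lee_fin.
by rewrite (le_trans (fc _ x0))// ler_norm.
Qed.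

(** [F] is differentiable on the open half-line only, so the fundamental theorem is applied on
    compact intervals exhausting it, and dominated convergence removes the truncation. *)
Lemma integral_derive_eq0 (f F : R -> R) (c : R) :
  (forall x : R, 0 < x -> is_derive x (1:R) F (f x)) ->
  (forall x : R, 0 < x -> f y @[y --> x] --> f x) ->
  (forall x : R, 0 < x -> `|f x| <= c * expR (- x)) ->
  F x @[x --> 0^'+] --> 0 -> F x @[x --> +oo] --> 0 ->
  \int[mu]_(x in `]0%R, +oo[) f x = 0.
Proof.
move=> dF cf fc F0 Fy.
have mf := measurable_pos_cont cf.
(* The shifts by 1 and 2 keep the interval nondegenerate at [n = 0], where it is [1, 2]. *)
pose E (n : nat) : set R := `[n.+1%:R^-1, n.+2%:R]%classic.
have EP n : E n `<=` `]0%R, +oo[.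
  by move=> x; rewrite /E/= !in_itv/= andbT => /andP[+ _]; apply: lt_le_trans; rewrite invr_gt0.
have mE n : measurable (E n) by exact: measurable_itv.
have [_ _] : [/\ mu.-integrable (`]0%R, +oo[%classic : set R) (EFin \o f),
    (fun n => \int[mu]_(x in `]0%R, +oo[) `|((EFin \o f) \_ (E n)) x - (EFin \o f) x|)%E @ \oo --> 0%E &
    (fun n => \int[mu]_(x in `]0%R, +oo[) ((EFin \o f) \_ (E n)) x)%E @ \oo -->
     (\int[mu]_(x in `]0%R, +oo[) (EFin \o f) x)%E].
  apply: (@dominated_convergence _ _ R mu _ _ _ _ (fun x => (c * expR (- x))%:E)) => //.
  - move=> n; apply/(measurable_restrict _ _ _).1 => //; first exact: mE.
    by apply/measurable_EFinP; rewrite setIidr//; apply: measurable_funS mf.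
  - exact/measurable_EFinP.
  - apply: aeW => x; rewrite /= in_itv/= andbT => x0.
    apply: cvg_near_cst; near=> n.
    have h1 : x^-1 <= n%:R by near: n; exact: nbhs_infty_ger.
    have h2 : x <= n%:R by near: n; exact: nbhs_infty_ger.
    rewrite patchE mem_set// /E/= in_itv/=; apply/andP; split.
      by rewrite invf_ple ?posrE// (le_trans h1)// ler_nat.
    by rewrite (le_trans h2)// ler_nat ltnW.
  - exact: integrable_expRN.
  - apply: aeW => x n; rewrite /= in_itv/= andbT => x0.
    rewrite patchE; case: ifPn => _; first by rewrite lee_fin fc.
    by rewrite abse0 lee_fin (le_trans (normr_ge0 _) (fc _ x0)).
have -> : (fun n => \int[mu]_(x in `]0%R, +oo[) ((EFin \o f) \_ (E n)) x)%E =
    (fun n => (F n.+2%:R - F (n.+1%:R^-1))%:E).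
  apply/funext => n; rewrite -integral_mkcondr setIidr// EFinB.
  have lt : n.+1%:R^-1 < n.+2%:R :> R.
    by rewrite (@le_lt_trans _ _ 1) ?invf_le1 ?ler1n ?ltr1n.
  have p0 : 0 < n.+1%:R^-1 :> R by rewrite invr_gt0.
  apply: FTC2 => //.
  - apply: (@continuous_in_subspaceT _ _ _ _) => x; rewrite inE/= in_itv/= => /andP[x0 _].
    by apply: cf; exact: lt_le_trans x0.
  - apply: (@continuous_in_subspaceT _ _ _ _) => x; rewrite inE/= in_itv/= => /andP[x0 _].
    by apply: (cvg_is_derive (dF _ _)); exact: lt_le_trans x0.
  - by move=> x /andP[x0 _]; apply: dF; exact: lt_trans x0.
move=> cv1.
have cv2 : (fun n => (F n.+2%:R - F n.+1%:R^-1)%:E) @ \oo --> 0%E.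
  apply: cvg_EFin; first by apply: nearW.
  rewrite -[X in _ --> X](subrr 0); apply: cvgB.
    apply: (cvg_comp _ _ _ Fy).
    have := @cvgr_idn R; rewrite -(@cvg_shiftn 2) => h.
    by under eq_fun do rewrite -addn2.
  move/cvg_at_rightP : F0; apply; split; first by move=> n; rewrite invr_gt0.
  exact: cvg_harmonic.
by rewrite /Rintegral (cvg_unique _ cv1 cv2).
Unshelve. all: by end_near. Qed.

End contour.

Section contour_shift.
Context {R : realType}.
Notation mu := (@lebesgue_measure R).

(** Completes a square: Gaussian decay absorbs linear growth in [y], so that every domination below
    can use a multiple of [expR (- y)]. *)
Lemma gauss_bound (k1 k2 y : R) : 0 <= y ->
  k1 + k2 * y - y ^+ 2 / 2 <= (k1 + (k2 + 1) ^+ 2 / 2) - y.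
Proof. by move=> y0; have := sqr_ge0 (y - (k2 + 1)); rewrite !expr2; lra. Qed.

(* [P r y] and [Q r y] are the real and imaginary parts of a function analytic in
   [r + iy], so that [expR P * cos Q] is the real part of its exponential, whose
   integral along vertical half-lines does not depend on [r]. *)
Variables (P Q p q : R -> R -> R) (u v k1 k2 : R).
Hypothesis k1_ge0 : 0 <= k1.
Hypothesis k2_ge0 : 0 <= k2.
(** Cauchy-Riemann equations: [p + i q] is the complex derivative, and differentiating along [y]
    multiplies it by i. *)
Hypothesis dPr : forall r y : R, u < r < v -> 0 < y -> is_derive r (1:R) (P^~ y) (p r y).
Hypothesis dQr : forall r y : R, u < r < v -> 0 < y -> is_derive r (1:R) (Q^~ y) (q r y).
Hypothesis dPy : forall r y : R, u < r < v -> 0 < y -> is_derive y (1:R) (P r) (- q r y).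
Hypothesis dQy : forall r y : R, u < r < v -> 0 < y -> is_derive y (1:R) (Q r) (p r y).
Hypothesis cp : forall r y : R, u < r < v -> 0 < y -> p r z @[z --> y] --> p r y.
Hypothesis cq : forall r y : R, u < r < v -> 0 < y -> q r z @[z --> y] --> q r y.
Hypothesis bP : forall r y : R, u < r < v -> 0 < y -> P r y <= k1 + k2 * y - y ^+ 2 / 2.
Hypothesis bp : forall r y : R, u < r < v -> 0 < y -> `|p r y| <= k1 + k2 * y.
Hypothesis bq : forall r y : R, u < r < v -> 0 < y -> `|q r y| <= k1 + k2 * y.
(** The function is real on the real axis; this kills the boundary term of the imaginary part [B] at
    [y = 0]. *)
Hypothesis Q0 : forall r : R, u < r < v -> Q r y @[y --> 0^'+] --> 0.

Let A r y := expR (P r y) * cos (Q r y).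
Let B r y := expR (P r y) * sin (Q r y).
(** Both the [r]-derivative of [A] and the [y]-derivative of [B]. Hence the integral of [A] has for
    [r]-derivative a boundary term of [B], which vanishes. *)
Let C r y := expR (P r y) * (p r y * cos (Q r y) - q r y * sin (Q r y)).
(** The 3 arises so: with w = k1 + k2 y, the factor 1 + 2 w is at most e^(2 w), and the bound on [P]
    adds one more w. *)
Let c := expR (3 * k1 + (3 * k2 + 1) ^+ 2 / 2).

Let bound (r y : R) : u < r < v -> 0 < y ->
  expR (P r y) * (1 + (k1 + k2 * y) + (k1 + k2 * y)) <= c * expR (- y).
Proof.
move=> ruv y0; pose w := k1 + k2 * y.
rewrite -/w (@le_trans _ _ (expR (P r y) * expR (w + w)))//.
  by rewrite ler_wpM2l ?expR_ge0// -addrA expR_ge1Dx.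
rewrite -!expRD ler_expR.
have := bP ruv y0; have := gauss_bound (3 * k1) (3 * k2) (ltW y0); rewrite /w.
by rewrite !expr2; lra.
Qed.

Let dA (r y : R) : u < r < v -> 0 < y -> is_derive r (1:R) (A^~ y) (C r y).
Proof.
move=> ruv y0; have d1 := dPr ruv y0; have d2 := dQr ruv y0.
have d3 := is_derive1_comp (is_derive_expR (P r y)) d1.
have d4 := is_derive1_comp (is_derive_cos (Q r y)) d2.
rewrite /A; apply: is_derive_eq; rewrite /GRing.scale/= /C; ring.
Qed.

Let dB (r y : R) : u < r < v -> 0 < y -> is_derive y (1:R) (B r) (C r y).
Proof.
move=> ruv y0; have d1 := dPy ruv y0; have d2 := dQy ruv y0.
have d3 := is_derive1_comp (is_derive_expR (P r y)) d1.
have d4 := is_derive1_comp (is_derive_sin (Q r y)) d2.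
rewrite /B; apply: is_derive_eq; rewrite /GRing.scale/= /C; ring.
Qed.

Let cos_le1N (x : R) : `|cos x| <= 1.
Proof. by rewrite ler_norml cos_geN1 cos_le1. Qed.

Let sin_le1N (x : R) : `|sin x| <= 1.
Proof. by rewrite ler_norml sin_geN1 sin_le1. Qed.

Let bA (r y : R) : u < r < v -> 0 < y -> `|A r y| <= c * expR (- y).
Proof.
move=> ruv y0; apply: le_trans (bound ruv y0).
rewrite normrM ger0_norm ?expR_ge0// ler_wpM2l ?expR_ge0//.
rewrite (le_trans (cos_le1N _))// -addrA lerDl.
by rewrite !addr_ge0 ?mulr_ge0 ?(ltW y0).
Qed.

Let bB (r y : R) : u < r < v -> 0 < y -> `|B r y| <= c * expR (- y).
Proof.
move=> ruv y0; apply: le_trans (bound ruv y0).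
rewrite normrM ger0_norm ?expR_ge0// ler_wpM2l ?expR_ge0//.
rewrite (le_trans (sin_le1N _))// -addrA lerDl.
by rewrite !addr_ge0 ?mulr_ge0 ?(ltW y0).
Qed.

Let bC (r y : R) : u < r < v -> 0 < y -> `|C r y| <= c * expR (- y).
Proof.
move=> ruv y0; apply: le_trans (bound ruv y0).
rewrite normrM ger0_norm ?expR_ge0// ler_wpM2l ?expR_ge0//.
rewrite (le_trans (ler_normB _ _))// -addrA -[leLHS]add0r lerD//.
by apply: lerD; rewrite normrM -[leRHS]mulr1; apply: ler_pM => //; [exact: bp|exact: bq].
Qed.

Let cC (r y : R) : u < r < v -> 0 < y -> C r z @[z --> y] --> C r y.
Proof.
move=> ruv y0.
have cP : P r z @[z --> y] --> P r y := cvg_is_derive (dPy ruv y0).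
have cQ : Q r z @[z --> y] --> Q r y := cvg_is_derive (dQy ruv y0).
apply: cvgM.
  by apply: (cvg_comp _ _ cP); exact: continuous_expR.
apply: cvgB; (apply: cvgM; [exact: cp || exact: cq|apply: (cvg_comp _ _ cQ)]).
  exact: continuous_cos.
exact: continuous_sin.
Qed.

Let cA (r y : R) : u < r < v -> 0 < y -> A r z @[z --> y] --> A r y.
Proof.
move=> ruv y0.
have cP : P r z @[z --> y] --> P r y := cvg_is_derive (dPy ruv y0).
have cQ : Q r z @[z --> y] --> Q r y := cvg_is_derive (dQy ruv y0).
apply: cvgM.
  by apply: (cvg_comp _ _ cP); exact: continuous_expR.
by apply: (cvg_comp _ _ cQ); exact: continuous_cos.
Qed.

Let intC r : u < r < v -> \int[mu]_(y in `]0%R, +oo[) C r y = 0.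
Proof.
move=> ruv; apply: (@integral_derive_eq0 _ _ (B r) c).
- by move=> y y0; exact: dB.
- by move=> y y0; exact: cC.
- by move=> y y0; exact: bC.
- have sQ : c * `|sin (Q r y)| @[y --> 0^'+] --> 0.
    rewrite -[X in _ --> X](mulr0 c); apply: cvgM; first exact: cvg_cst.
    apply/norm_cvg0P; rewrite -[X in _ --> X](@sin0 R).
    by apply: (cvg_comp _ _ (Q0 ruv)); exact: continuous_sin.
  apply/norm_cvg0P; apply: (squeeze_cvgr _ (cvg_cst 0) sQ).
  near=> y; have y0 : 0 < y by near: y; exact: nbhs_right_gt.
  rewrite normr_ge0/= normrM ger0_norm ?expR_ge0// ler_wpM2r//.
  have := bound ruv y0; rewrite -addrA mulrDr mulr1 => h.
  rewrite (@le_trans _ _ (c * expR (- y)))//.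
    rewrite (le_trans _ h)// lerDl mulr_ge0 ?expR_ge0//.
    by rewrite !addr_ge0 ?mulr_ge0 ?(ltW y0).
  by rewrite ler_piMr ?expR_ge0// expR_le1 oppr_le0 ltW.
- have sQ : c * expR (- y) @[y --> +oo] --> 0.
    rewrite -[X in _ --> X](mulr0 c); apply: cvgM; first exact: cvg_cst.
    exact: cvgr_expR.
  apply/norm_cvg0P; apply: (squeeze_cvgr _ (cvg_cst 0) sQ).
  near=> y; have y0 : 0 < y by near: y; exact: nbhs_pinfty_gt.
  by rewrite normr_ge0/= bB.
Unshelve. all: by end_near. Qed.

(** Differentiating under the integral sign leaves the integral of [C], which is 0; the mean value
    theorem then makes the integral constant across the strip. *)
Lemma contour_shift r s : u < r < v -> u < s < v ->
  \int[mu]_(y in `]0%R, +oo[) (expR (P r y) * cos (Q r y)) =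
  \int[mu]_(y in `]0%R, +oo[) (expR (P s y) * cos (Q s y)).
Proof.
wlog rs : r s / r <= s.
  by move=> h ruv suv; have [rs|sr] := leP r s; [|symmetry]; apply: h => //; exact: ltW.
move=> ruv suv.
pose K z := \int[mu]_(y in `]0%R, +oo[) A z y.
have dK z : u < z < v -> is_derive z (1:R) K 0.
  move=> zuv; have zI : (`]u, v[%classic : set R) z by rewrite /= in_itv/=.
  have intA x : (`]u, v[%classic : set R) x -> mu.-integrable (`]0%R, +oo[%classic : set R) (EFin \o A x).
    rewrite /= in_itv/= => xuv; apply: (@integrable_pos_cont _ _ c).
      by apply: measurable_pos_cont => y y0; exact: cA.
    by move=> y y0; exact: bA.
  have derA x y : (`]u, v[%classic : set R) x -> (`]0%R, +oo[%classic : set R) y -> derivable (A^~ y) x 1.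
    rewrite /= !in_itv/= andbT => xuv y0; have := dA xuv y0 => ?; exact: ex_derive.
  have G0 y : 0 <= c * expR (- y) by rewrite mulr_ge0 ?expR_ge0.
  have bG x y : (`]u, v[%classic : set R) x -> (`]0%R, +oo[%classic : set R) y ->
      `|partial1of2 A x y| <= c * expR (- y).
    rewrite /= !in_itv/= andbT => xuv y0; have := dA xuv y0 => ?.
    by rewrite partial1of2E derive_val bC.
  have mpos : measurable (`]0%R, +oo[%classic : set R) by exact: measurable_itv.
  have dd := @derivable_under_integral R _ _ mu A _ mpos z u v zI intA derA _ G0 (integrable_expRN c) bG.
  apply: DeriveDef => //.
  rewrite -derive1E (@differentiation_under_integral R _ _ mu A _ mpos z u v zI intA derA _ G0 (integrable_expRN c) bG).
  rewrite -[RHS](intC zuv); apply: eq_Rintegral => y; rewrite pos_itv => y0.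
  by have := dA zuv y0 => ?; rewrite partial1of2E derive_val.
have rsuv z : z \in `[r, s] -> u < z < v.
  rewrite in_itv/= => /andP[rz zs]; apply/andP; split.
    by case/andP: ruv => ur _; exact: lt_le_trans rz.
  by case/andP: suv => _ sv; exact: le_lt_trans sv.
have dK' x : x \in `]r, s[ -> is_derive x (1:R) K 0.
  by move=> xrs; apply/dK/rsuv; exact: subset_itv_oo_cc xrs.
have cK : {within `[r, s], continuous K}.
  by apply: continuous_in_subspaceT => x; rewrite inE => /rsuv /dK; exact: cvg_is_derive.
have [w _] := MVT_segment rs dK' cK.
by rewrite mul0r => /eqP; rewrite subr_eq0 => /eqP.
Qed.

End contour_shift.

(** * Fourier transform of the Gaussian weight *)

Section gaussian.
Context {R : realType}.
Notation mu := (@lebesgue_measure R).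

(* Normalising constant of the Gaussian weight; its value [sqrt (pi / 2)] plays no role. *)
Definition gauss0 : R := \int[mu]_(y in `]0%R, +oo[) expR (- (y ^+ 2 / 2)).

Let mexp (D : set R) (b : R) : measurable_fun D (fun y : R => expR (- (y ^+ 2 / 2)) * cos (b * y)).
Proof.
apply: measurable_funTS; apply: measurable_funM.
  do 2 apply: measurableT_comp => //; apply: measurable_funM => //.
apply: (@measurableT_comp _ _ _ _ _ _ (@cos R)) => //.
by apply: continuous_measurable_fun; exact: continuous_cos.
Qed.

Let gauss_le (y : R) : 0 < y -> expR (- (y ^+ 2 / 2)) <= expR (1 / 2) * expR (- y).
Proof.
move=> y0; rewrite -expRD ler_expR; have := gauss_bound 0 0 (ltW y0).
by rewrite !expr2; lra.
Qed.

Lemma integrable_gauss_cos (b : R) :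
  mu.-integrable (`]0%R, +oo[%classic : set R) (EFin \o (fun y : R => expR (- (y ^+ 2 / 2)) * cos (b * y))).
Proof.
apply: (@integrable_pos_cont _ _ (expR (1 / 2))); first exact: mexp.
move=> y y0; rewrite normrM ger0_norm ?expR_ge0//.
apply: le_trans (gauss_le y0); rewrite ler_piMr ?expR_ge0//.
by rewrite ler_norml cos_geN1 cos_le1.
Qed.

Lemma integrable_gauss : mu.-integrable (`]0%R, +oo[%classic : set R) (EFin \o (fun y : R => expR (- (y ^+ 2 / 2)))).
Proof.
have := integrable_gauss_cos 0; congr (_.-integrable _ _).
by apply/funext => y /=; rewrite mul0r cos0 mulr1.
Qed.

Lemma gauss0_gt0 : 0 < gauss0.
Proof.
have fin : (\int[mu]_(y in (`]0%R, +oo[%classic : set R)) (expR (- (y ^+ 2 / 2)))%:E)%E \is a fin_num.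
  by apply: integrable_fin_num => //; exact: integrable_gauss.
have sub : `]0%R, 1%R] `<=` (`]0%R, +oo[%classic : set R).
  by move=> y; rewrite /= !in_itv/= andbT => /andP[].
have mg (D : set R) : measurable_fun D (fun y : R => (expR (- (y ^+ 2 / 2)))%:E).
  apply/measurable_EFinP; apply: measurable_funTS; do 2 apply: measurableT_comp => //.
  exact: measurable_funM.
rewrite -lte_fin /gauss0 /Rintegral fineK//.
apply: (@lt_le_trans _ _ (\int[mu]_(y in `]0%R, 1%R]) (expR (- (1 / 2)))%:E)%E).
  by rewrite integral_cst//= lebesgue_measure_itv/= lte01 sube0 mule1 lte_fin expR_gt0.
apply: (@le_trans _ _ (\int[mu]_(y in `]0%R, 1%R]) (expR (- (y ^+ 2 / 2)))%:E)%E).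
  apply: ge0_le_integral => //; first exact: mg.
  move=> y; rewrite /= in_itv/= => /andP[y0 y1]; rewrite lee_fin ler_expR lerN2.
  by rewrite ler_wpM2r// exprn_ile1// ltW.
apply: ge0_subset_integral => //; exact: mg.
Qed.

(** [contour_shift] for e^(w^2 / 2) with w = r + iy, from the line r = 0 to the line r = b. *)
Lemma gauss_cos (b : R) :
  \int[mu]_(y in `]0%R, +oo[) (expR (- (y ^+ 2 / 2)) * cos (b * y)) = gauss0 * expR (- (b ^+ 2 / 2)).
Proof.
pose P (r y : R) : R := (r ^+ 2 - y ^+ 2) / 2.
pose Q (r y : R) : R := r * y.
pose M := `|b| + 1; pose k1 := M ^+ 2 / 2 + M.
have M0 : 0 < M by rewrite ltr_wpDl.
have bM : - M < b < M by rewrite -ltr_norml ltrDl.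
have k10 : 0 <= k1 by rewrite addr_ge0 ?(ltW M0)// divr_ge0// sqr_ge0.
have rM r : - M < r < M -> `|r| <= M by rewrite -ltr_norml => /ltW.
have := @contour_shift R P Q (fun r _ => r) (fun _ y => y) (- M) M k1 1 k10 ler01.
move=> /(_ _ _ _ _ _ _ _ _ _ _ 0 b) h.
have {}h : \int[mu]_(y in `]0, +oo[) (expR (P 0 y) * cos (Q 0 y)) =
    \int[mu]_(y in `]0, +oo[) (expR (P b y) * cos (Q b y)).
  apply: h => //.
  - by move=> r y _ _; apply: is_derive_eq; rewrite /GRing.scale/=; field.
  - by move=> r y _ _; apply: is_derive_eq; rewrite /GRing.scale/=; ring.
  - by move=> r y _ _; apply: is_derive_eq; rewrite /GRing.scale/=; field.
  - by move=> r y _ _; apply: is_derive_eq; rewrite /GRing.scale/=; ring.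
  - by move=> r y _ _; exact: cvg_cst.
  - move=> r y /rM rM' y0; rewrite /P /k1.
    have : r ^+ 2 <= M ^+ 2 by rewrite -real_normK ?num_real// lerXn2r ?nnegrE ?(ltW M0).
    by lra.
  - move=> r y /rM rM' y0; rewrite (le_trans rM')// /k1 mul1r.
    by have := sqr_ge0 M; lra.
  - move=> r y _ y0; rewrite gtr0_norm// mul1r lerDr//.
  - move=> r _; rewrite -[X in _ --> X](mulr0 r); apply: cvg_at_right_filter.
    by apply: cvgM; [exact: cvg_cst|exact: cvg_id].
  - by rewrite oppr_lt0 M0.
apply: (mulIf (x := expR (b ^+ 2 / 2))); first by rewrite gt_eqF// expR_gt0.
rewrite -[RHS]mulrA -[X in _ = _ * X]expRD addNr expR0 mulr1.
have <- : \int[mu]_(y in `]0, +oo[) (expR (P 0 y) * cos (Q 0 y)) = gauss0.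
  apply: eq_Rintegral => y _; rewrite /P /Q mul0r cos0 mulr1; congr expR.
  by rewrite expr0n sub0r mulNr.
rewrite h -RintegralZr//; last exact: integrable_gauss_cos.
apply: eq_Rintegral => y _; rewrite mulrAC -expRD; congr (expR _ * _).
by rewrite /P; lra.
Qed.

End gaussian.

(** * The exponent w (ln w - 1) on vertical lines *)

Section stable_contour.
Context {R : realType}.
Notation mu := (@lebesgue_measure R).
Variables (sg a : R).
Hypothesis sg0 : 0 < sg.
Hypothesis a0 : 0 < a.

(* Real part of the logarithm and argument of [sg (r + iy)], [y > 0]. *)
Definition logm (r y : R) : R := ln (sg ^+ 2 * (r ^+ 2 + y ^+ 2)) / 2.
Definition argm (r y : R) : R := pi / 2 - atan (r / y).

(* [stableP + i stableQ = w (ln w - 1) + (w / sg - a)^2 / 2] for [w = sg (r + iy)]. *)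
Definition stableP (r y : R) : R :=
  sg * (r * (logm r y - 1) - y * argm r y) + ((r - a) ^+ 2 - y ^+ 2) / 2.
Definition stableQ (r y : R) : R :=
  sg * (y * (logm r y - 1) + r * argm r y) + (r - a) * y.

Let sq0 (r y : R) : 0 < y -> 0 < r ^+ 2 + y ^+ 2.
Proof. by move=> y0; rewrite ltr_wpDl ?sqr_ge0// exprn_gt0. Qed.

Let sqs0 (r y : R) : 0 < y -> 0 < sg ^+ 2 * (r ^+ 2 + y ^+ 2).
Proof. by move=> y0; rewrite mulr_gt0 ?sq0// exprn_gt0. Qed.

Lemma is_derive_logm_re (r y : R) : 0 < r ^+ 2 + y ^+ 2 ->
  is_derive r (1:R) (logm^~ y) (r / (r ^+ 2 + y ^+ 2)).
Proof.
move=> ry; have s0 : 0 < sg ^+ 2 * (r ^+ 2 + y ^+ 2) by rewrite mulr_gt0// exprn_gt0.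
have d := is_derive1_ln s0.
have d1 : is_derive r (1:R) (fun r => sg ^+ 2 * (r ^+ 2 + y ^+ 2)) (sg ^+ 2 * (2 * r)).
  by apply: is_derive_eq; rewrite /GRing.scale/=; ring.
have d2 := @is_derive1_comp R (@ln R) (fun r : R => sg ^+ 2 * (r ^+ 2 + y ^+ 2)) r _ _ d d1.
rewrite /logm; apply: is_derive_eq; rewrite /GRing.scale/=; field.
by rewrite !gt_eqF.
Qed.

Lemma is_derive_logm_im (r y : R) : 0 < r ^+ 2 + y ^+ 2 ->
  is_derive y (1:R) (logm r) (y / (r ^+ 2 + y ^+ 2)).
Proof.
move=> ry; have s0 : 0 < sg ^+ 2 * (r ^+ 2 + y ^+ 2) by rewrite mulr_gt0// exprn_gt0.
have d := is_derive1_ln s0.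
have d1 : is_derive y (1:R) (fun y => sg ^+ 2 * (r ^+ 2 + y ^+ 2)) (sg ^+ 2 * (2 * y)).
  by apply: is_derive_eq; rewrite /GRing.scale/=; ring.
have d2 := @is_derive1_comp R (@ln R) (fun y : R => sg ^+ 2 * (r ^+ 2 + y ^+ 2)) y _ _ d d1.
rewrite /logm; apply: is_derive_eq; rewrite /GRing.scale/=; field.
by rewrite !gt_eqF.
Qed.

Lemma is_derive_argm_re (r y : R) : 0 < y ->
  is_derive r (1:R) (argm^~ y) (- (y / (r ^+ 2 + y ^+ 2))).
Proof.
move=> y0; have ry := sq0 r y0.
have d1 : is_derive r (1:R) (fun r => r / y) y^-1.
  by apply: is_derive_eq; rewrite /GRing.scale/=; ring.
have d2 := @is_derive1_comp R (@atan R) (fun r : R => r / y) r _ _ (is_derive1_atan (r / y)) d1.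
rewrite /argm; apply: is_derive_eq; rewrite /GRing.scale/=; field.
by rewrite !gt_eqF.
Qed.

Lemma is_derive_argm_im (r y : R) : 0 < y ->
  is_derive y (1:R) (argm r) (r / (r ^+ 2 + y ^+ 2)).
Proof.
move=> y0; have ry := sq0 r y0.
have d1 : is_derive y (1:R) (fun y => r / y) (- r / y ^+ 2).
  have y0' : y != 0 by rewrite gt_eqF.
  have dV : is_derive y (1:R) (fun y : R => y^-1) (- y ^- 2 *: (1 : R)).
    exact: (@is_deriveV _ (fun y : R => y) y 1 1 y0' (is_derive_id _ _)).
  by apply: is_derive_eq; rewrite /GRing.scale/=; field.
have d2 := @is_derive1_comp R (@atan R) (fun y : R => r / y) y _ _ (is_derive1_atan (r / y)) d1.
rewrite /argm; apply: is_derive_eq; rewrite /GRing.scale/=; field.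
by rewrite !gt_eqF.
Qed.

Lemma is_derive_stableP_re (r y : R) : 0 < y ->
  is_derive r (1:R) (stableP^~ y) (sg * logm r y + (r - a)).
Proof.
move=> y0; have ry := sq0 r y0.
have d1 := is_derive_logm_re ry; have d2 := is_derive_argm_re r y0.
rewrite /stableP; apply: is_derive_eq; rewrite /GRing.scale/=; field.
by rewrite gt_eqF.
Qed.

Lemma is_derive_stableP_im (r y : R) : 0 < y ->
  is_derive y (1:R) (stableP r) (- (sg * argm r y + y)).
Proof.
move=> y0; have ry := sq0 r y0.
have d1 := is_derive_logm_im ry; have d2 := is_derive_argm_im r y0.
rewrite /stableP; apply: is_derive_eq; rewrite /GRing.scale/=; field.
by rewrite gt_eqF.
Qed.

Lemma is_derive_stableQ_re (r y : R) : 0 < y ->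
  is_derive r (1:R) (stableQ^~ y) (sg * argm r y + y).
Proof.
move=> y0; have ry := sq0 r y0.
have d1 := is_derive_logm_re ry; have d2 := is_derive_argm_re r y0.
rewrite /stableQ; apply: is_derive_eq; rewrite /GRing.scale/=; field.
by rewrite gt_eqF.
Qed.

Lemma is_derive_stableQ_im (r y : R) : 0 < y ->
  is_derive y (1:R) (stableQ r) (sg * logm r y + (r - a)).
Proof.
move=> y0; have ry := sq0 r y0.
have d1 := is_derive_logm_im ry; have d2 := is_derive_argm_im r y0.
rewrite /stableQ; apply: is_derive_eq; rewrite /GRing.scale/=; field.
by rewrite gt_eqF.
Qed.

Lemma argm_ge0 r y : 0 <= argm r y.
Proof. by rewrite subr_ge0 ltW// atan_ltpi2. Qed.

Lemma argm_le_pi r y : argm r y <= pi.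
Proof. by have := atan_gtNpi2 (r / y); rewrite /argm; lra. Qed.

Lemma logm_le r y : 0 <= r -> 0 < y -> logm r y <= sg * (r + y).
Proof.
move=> r0 y0; have w0 : 0 < sg * (r + y) by rewrite mulr_gt0// ltr_wpDl.
have h : ln (sg ^+ 2 * (r ^+ 2 + y ^+ 2)) <= ln ((sg * (r + y)) ^+ 2).
  rewrite ler_ln ?posrE ?sqs0 ?exprn_gt0// exprMn ler_pM2l ?exprn_gt0//.
  by rewrite sqrrD lerD2r lerDl mulrn_wge0// mulr_ge0// ltW.
rewrite /logm ler_pdivrMr// (le_trans h)// lnXn// mulr2n.
by have := ln_sublinear w0; lra.
Qed.

Lemma logm_ge e r y : 0 < e -> e <= r -> 0 < y -> ln (sg * e) <= logm r y.
Proof.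
move=> e0 er y0; have w0 : 0 < sg * e by rewrite mulr_gt0.
rewrite /logm ler_pdivlMr// mulr_natr -lnXn// ler_ln ?posrE ?exprn_gt0 ?sqs0//.
rewrite exprMn ler_pM2l ?exprn_gt0// ler_wpDr ?sqr_ge0//.
by rewrite lerXn2r ?nnegrE ?(ltW e0)// (le_trans _ er)// ltW.
Qed.

(** Besides the Gaussian part, only r ln|w| can grow, and at most linearly in y since ln x <= x; the
    argument enters through - y arg w, which has a favourable sign. *)
Lemma stableP_le V r y : 0 <= r <= V -> a <= V -> 0 < y ->
  stableP r y <= sg ^+ 2 * V ^+ 2 + V ^+ 2 + sg ^+ 2 * V * y - y ^+ 2 / 2.
Proof.
move=> /andP[r0 rV] aV y0; have V0 := le_trans r0 rV.
have h1 : r * logm r y <= V * (sg * (V + y)).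
  have [L0|/ltW L0] := leP 0 (logm r y).
    by apply: ler_pM => //; apply: (le_trans (logm_le r0 y0)); rewrite ler_pM2l// lerD2r.
  rewrite (@le_trans _ _ 0)//; first by rewrite mulr_ge0_le0.
  by rewrite !mulr_ge0 ?addr_ge0 ?(ltW sg0) ?(ltW y0).
have h2 : 0 <= y * argm r y by rewrite mulr_ge0 ?argm_ge0 ?(ltW y0).
have h3 : (r - a) ^+ 2 <= V ^+ 2.
  rewrite -[leLHS]real_normK ?num_real// lerXn2r ?nnegrE// ler_norml.
  by apply/andP; split; have := ltW a0; lra.
have h4 := ler_wpM2l (ltW sg0) h1; have h5 := mulr_ge0 (ltW sg0) h2.
have h6 := mulr_ge0 (ltW sg0) r0; have h7 := sqr_ge0 V.
by rewrite /stableP !expr2 in h3 h7 *; lra.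
Qed.

(** [r = 0] is excluded: the bound on [p] needs ln|w| bounded below, which holds on the strip
    between r / 2 and a + 1 but not near the origin. *)
Lemma stable_contour_shift r : 0 < r <= a ->
  \int[mu]_(y in `]0%R, +oo[) (expR (stableP r y) * cos (stableQ r y)) =
  \int[mu]_(y in `]0%R, +oo[) (expR (stableP a y) * cos (stableQ a y)).
Proof.
move=> /andP[r0 ra].
pose e := r / 2; pose V := a + 1; have e0 : 0 < e by rewrite divr_gt0.
have V0 : 0 < V by rewrite addr_gt0.
pose l := `|ln (sg * e)|.
(* [contour_shift] takes a single pair of constants, so the bounds for [P], [p] and [q] are added,
   in this order. *)
pose k1 := sg ^+ 2 * V ^+ 2 + V ^+ 2 + (sg * (sg * V + l) + V + sg * pi).
pose k2 := sg ^+ 2 * V + (sg ^+ 2 + 1).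
have sg0' := ltW sg0; have V0' := ltW V0.
have u1 : 0 <= sg ^+ 2 * V ^+ 2 + V ^+ 2 by rewrite addr_ge0 ?mulr_ge0 ?sqr_ge0.
have u2 : 0 <= sg * (sg * V + l) by rewrite /l mulr_ge0 ?addr_ge0 ?mulr_ge0 ?normr_ge0.
have u3 : 0 <= sg * pi by rewrite mulr_ge0// pi_ge0.
have u4 : 0 <= sg ^+ 2 * V by rewrite mulr_ge0// sqr_ge0.
have k10 : 0 <= k1 by rewrite /k1; lra.
have k20 : 0 <= k2 by rewrite /k2; have := sqr_ge0 sg; lra.
have I z : e < z < V -> (0 < z) * (0 <= z <= V) * (e <= z) * (`|z - a| <= V).
  move=> /andP[ez zV]; have z0 := lt_trans e0 ez.
  rewrite z0 (ltW z0) (ltW zV) (ltW ez); do ! split => //.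
  by rewrite ler_norml; apply/andP; rewrite /V in zV *; split; lra.
apply: (@contour_shift R stableP stableQ (fun r y => sg * logm r y + (r - a))
  (fun r y => sg * argm r y + y) e V k1 k2); [exact: k10|exact: k20|..].
- by move=> z y _ y0; exact: is_derive_stableP_re.
- by move=> z y _ y0; exact: is_derive_stableQ_re.
- by move=> z y _ y0; exact: is_derive_stableP_im.
- by move=> z y _ y0; exact: is_derive_stableQ_im.
- move=> z y _ y0; apply: cvgD; last exact: cvg_cst.
  apply: cvgM; first exact: cvg_cst.
  exact: (cvg_is_derive (is_derive_logm_im (sq0 z y0))).
- move=> z y _ y0; apply: cvgD; last exact: cvg_id.
  apply: cvgM; first exact: cvg_cst.
  exact: (cvg_is_derive (is_derive_argm_im z y0)).
- move=> z y /I[[[z0 zV] ez] za] y0.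
  have := @stableP_le V z y zV _ y0; rewrite lerDl ler01 => /(_ isT).
  have := mulr_ge0 (addr_ge0 (sqr_ge0 sg) (ler01 : 0 <= 1 :> R)) (ltW y0).
  by rewrite /k1 /k2; lra.
- move=> z y /I[[[z0 zV] ez] za] y0.
  have /andP[z0' zV'] := zV.
  have h1 : `|logm z y| <= sg * (V + y) + l.
    have h2 := logm_le z0' y0; have h3 := logm_ge e0 ez y0.
    have h4 : sg * (z + y) <= sg * (V + y) by rewrite ler_pM2l// lerD2r.
    have y0w := ltW y0; have h5 : 0 <= sg * (V + y) by apply: mulr_ge0 => //; apply: addr_ge0.
    have h6 := normr_ge0 (ln (sg * e)).
    have h7 := lerNnormlW (lexx (`|ln (sg * e)|)).
    by rewrite ler_norml /l; apply/andP; split; lra.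
  rewrite (le_trans (ler_normD _ _))// normrM (gtr0_norm sg0).
  have h2 := ler_wpM2l (ltW sg0) h1.
  have h3 := mulr_ge0 u4 (ltW y0).
  have h4 : 0 <= (sg ^+ 2) * y by rewrite mulr_ge0 ?sqr_ge0 ?(ltW y0).
  by rewrite /k1 /k2 !expr2 in u1 u2 u3 u4 h3 h4 *; lra.
- move=> z y /I[[[z0 zV] ez] za] y0.
  rewrite ger0_norm; last by rewrite addr_ge0 ?(ltW y0)// mulr_ge0 ?argm_ge0 ?(ltW sg0).
  have h1 := ler_wpM2l (ltW sg0) (argm_le_pi z y).
  have h3 := mulr_ge0 u4 (ltW y0).
  have h4 : 0 <= (sg ^+ 2) * y by rewrite mulr_ge0 ?sqr_ge0 ?(ltW y0).
  by rewrite /k1 /k2; lra.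
- move=> z /I[[[z0 zV] ez] za].
  rewrite [X in _ --> X](_ : _ = sg * (0 * (logm z 0 - 1) + z * 0) + (z - a) * 0); last by ring.
  have zz : 0 < z ^+ 2 + 0 ^+ 2 by rewrite expr0n addr0 exprn_gt0.
  have cL : logm z y @[y --> 0^'+] --> logm z 0.
    by apply: cvg_at_right_filter; exact: (cvg_is_derive (is_derive_logm_im zz)).
  have cI : y @[y --> (0:R)^'+] --> (0:R) by apply: cvg_at_right_filter; exact: cvg_id.
  apply: cvgD.
    apply: cvgM; [exact: cvg_cst|apply: cvgD].
      by apply: cvgM => //; apply: cvgB => //; exact: cvg_cst.
    apply: cvgM; first exact: cvg_cst.
    rewrite -[X in _ --> X](subrr (pi / 2)); apply: cvgB; first exact: cvg_cst.
    (* The argument vanishes at the real axis because [z > 0] sends z / y to +oo, where atan tends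
       to pi / 2. *)
    have h : z / y @[y --> 0^'+] --> +oo.
      apply: gt0_cvgMry => //; apply/cvgrVy => //.
      by near=> y; near: y; exact: nbhs_right_gt.
    exact: (cvg_comp _ _ h (@cvgy_atan R)).
  by apply: cvgM; [exact: cvg_cst|].
- rewrite /V; apply/andP; split; last lra.
  by rewrite /e ltr_pdivrMr// ltr_pMr// ltr1n.
- rewrite /V; apply/andP; split; last lra.
  by rewrite (lt_le_trans _ ra)// /e ltr_pdivrMr// ltr_pMr// ltr1n.
Unshelve. all: by end_near. Qed.

End stable_contour.

Section contour_limit.
Context {R : realType}.
Notation mu := (@lebesgue_measure R).

Lemma Rdominated_pos (f_ : nat -> R -> R) (f : R -> R) (c : R) :
  (forall n, measurable_fun (`]0%R, +oo[%classic : set R) (f_ n)) ->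
  (forall y : R, 0 < y -> f_ n y @[n --> \oo] --> f y) ->
  (forall n (y : R), 0 < y -> `|f_ n y| <= c * expR (- y)) ->
  (\int[mu]_(y in `]0%R, +oo[) f_ n y) @[n --> \oo] --> \int[mu]_(y in `]0%R, +oo[) f y.
Proof.
move=> mf ff fc.
have mlim : measurable_fun (`]0%R, +oo[%classic : set R) f.
  apply: (measurable_fun_cvg (h := f_)) => // y.
  by rewrite /= in_itv/= andbT; exact: ff.
have [intf _ cv] : [/\ mu.-integrable `]0%R, +oo[ (EFin \o f),
    (fun n => \int[mu]_(x in `]0%R, +oo[) `|(EFin \o f_ n) x - (EFin \o f) x|)%E @ \oo --> 0%E &
    (fun n => \int[mu]_(x in `]0%R, +oo[) (EFin \o f_ n) x)%E @ \oo -->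
     (\int[mu]_(x in `]0%R, +oo[) (EFin \o f) x)%E].
  apply: (@dominated_convergence _ _ R mu _ _ _ _ (fun x => (c * expR (- x))%:E)) => //.
  - by move=> n; apply/measurable_EFinP; exact: mf.
  - exact/measurable_EFinP.
  - apply: aeW => x; rewrite /= in_itv/= andbT => x0.
    by apply: cvg_EFin; [by apply: nearW|exact: ff].
  - exact: integrable_expRN.
  - apply: aeW => x n; rewrite /= in_itv/= andbT => x0.
    by rewrite lee_fin fc.
apply: (@fine_cvg _ _ _ _ _ (\int[mu]_(y in `]0%R, +oo[) f y)) => //.
rewrite /Rintegral fineK //.
by apply: integrable_fin_num => //.
Qed.

Section limit0.
Variables (sg a : R).
Hypothesis sg0 : 0 < sg.
Hypothesis a0 : 0 < a.

Lemma cvg_stable_integrand (r y : R) : 0 < y ->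
  (expR (stableP sg a r z) * cos (stableQ sg a r z)) @[z --> y] -->
  expR (stableP sg a r y) * cos (stableQ sg a r y).
Proof.
move=> y0; apply: cvgM.
  by apply: (cvg_comp _ _ (cvg_is_derive (is_derive_stableP_im a sg0 r y0))); exact: continuous_expR.
by apply: (cvg_comp _ _ (cvg_is_derive (is_derive_stableQ_im a sg0 r y0))); exact: continuous_cos.
Qed.

Lemma stable_integrand_le (r y : R) : 0 <= r <= a -> 0 < y ->
  `|expR (stableP sg a r y) * cos (stableQ sg a r y)| <=
  expR (sg ^+ 2 * a ^+ 2 + a ^+ 2 + (sg ^+ 2 * a + 1) ^+ 2 / 2) * expR (- y).
Proof.
move=> ra y0; rewrite normrM ger0_norm ?expR_ge0//.
rewrite (@le_trans _ _ (expR (stableP sg a r y)))//.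
  by rewrite ler_piMr ?expR_ge0// ler_norml cos_geN1 cos_le1.
rewrite -expRD ler_expR (le_trans (@stableP_le R sg a sg0 a0 a _ _ ra (lexx _) y0))//.
exact: gauss_bound (ltW y0).
Qed.

(** The logarithm is singular at the origin, but the upper bound [stableP_le] is uniform down to r =
    0: dominated convergence along a / (n + 1) carries the shift to the imaginary axis. *)
Lemma stable_contour0 :
  \int[mu]_(y in `]0%R, +oo[) (expR (stableP sg a 0 y) * cos (stableQ sg a 0 y)) =
  \int[mu]_(y in `]0%R, +oo[) (expR (stableP sg a a y) * cos (stableQ sg a a y)).
Proof.
pose r (n : nat) : R := a / n.+1%:R.
have r0 n : 0 < r n by rewrite divr_gt0.
have ra n : r n <= a by rewrite ler_pdivrMr// ler_peMr ?(ltW a0)// ler1n.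
have cr : r n @[n --> \oo] --> (0 : R).
  by rewrite -[X in _ --> X](mulr0 a); apply: cvgM; [exact: cvg_cst|exact: cvg_harmonic].
pose c := expR (sg ^+ 2 * a ^+ 2 + a ^+ 2 + (sg ^+ 2 * a + 1) ^+ 2 / 2).
pose K z := \int[mu]_(y in `]0%R, +oo[) (expR (stableP sg a z y) * cos (stableQ sg a z y)).
have cv1 : K (r n) @[n --> \oo] --> K 0.
apply: (@Rdominated_pos (fun n y => expR (stableP sg a (r n) y) * cos (stableQ sg a (r n) y))
  (fun y => expR (stableP sg a 0 y) * cos (stableQ sg a 0 y)) c).
- by move=> n; apply: measurable_pos_cont => y y0; exact: cvg_stable_integrand.
- move=> y y0; apply: cvgM.
    have h := cvg_comp _ _ cr (cvg_is_derive (is_derive_stableP_re a sg0 0 y0)).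
    exact: (cvg_comp _ _ h (@continuous_expR R _)).
  have h := cvg_comp _ _ cr (cvg_is_derive (is_derive_stableQ_re a sg0 0 y0)).
  exact: (cvg_comp _ _ h (@continuous_cos R _)).
- by move=> n y y0; apply: stable_integrand_le => //; rewrite (ltW (r0 n)) ra.
have cv2 : K (r n) @[n --> \oo] --> K a.
  apply: cvg_near_cst; apply: nearW => n.
  by rewrite /K stable_contour_shift// r0 ra.
exact: (cvg_unique _ cv1 cv2).
Qed.

End limit0.
End contour_limit.

(** * Exponential moments of the logarithm of S *)

Section char_fun.
Local Open Scope complex_scope.
Context d (T : measurableType d) (R : realType) (P : probability T R).
Variable X : T -> R.
Hypothesis XP : log_S_law P X.

Lemma expect_cos (l : R) : \int[P]_t cos (l * X t) = expR (- (pi * `|l| / 2)) * cos (l * (ln `|l| - 1)).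
Proof.
have /(congr1 (@complex.Re R)) := XP l.
rewrite /char_fun /cexpectation /cexp /= sub0r subr0 => <-.
by apply: eq_Rintegral => t _; rewrite expR0 mul1r.
Qed.

Lemma expect_sin (l : R) : \int[P]_t sin (l * X t) = expR (- (pi * `|l| / 2)) * sin (l * (ln `|l| - 1)).
Proof.
have /(congr1 (@complex.Im R)) := XP l.
rewrite /char_fun /cexpectation /cexp /= sub0r subr0 => <-.
by apply: eq_Rintegral => t _; rewrite expR0 mul1r.
Qed.

Hypothesis mX : measurable_fun [set: T] X.

Lemma integrable_cosB (l b : R) : P.-integrable [set: T] (EFin \o (fun t => cos (l * X t - b))).
Proof.
apply: measurable_bounded_integrable => //.
- by rewrite (le_lt_trans (probability_le1 P measurableT))// ltry.
- apply: (measurableT_comp (continuous_measurable_fun (@continuous_cos R))).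
  by apply: measurable_funB => //; exact: measurable_funM.
- exists 1; split => // r r1 t _ /=.
  by rewrite (@le_trans _ _ 1)//; [rewrite ler_norml cos_geN1 cos_le1|exact: ltW].
Qed.

Lemma expect_cosB (l b : R) : \int[P]_t cos (l * X t - b) =
  expR (- (pi * `|l| / 2)) * cos (l * (ln `|l| - 1) - b).
Proof.
have bnd (f : R -> R) : continuous f -> (forall x, `|f x| <= 1) ->
    P.-integrable [set: T] (EFin \o (fun t => f (l * X t))).
  move=> cf f1; apply: measurable_bounded_integrable => //.
  - by rewrite (le_lt_trans (probability_le1 P measurableT))// ltry.
  - apply: (measurableT_comp (continuous_measurable_fun cf)).
    exact: measurable_funM.
  - by exists 1; split => // r r1 t _ /=; rewrite (le_trans (f1 _))// ltW.
have ic : P.-integrable [set: T] (EFin \o (fun t => cos (l * X t))).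
  by apply: bnd; [exact: continuous_cos|move=> x; rewrite ler_norml cos_geN1 cos_le1].
have is_ : P.-integrable [set: T] (EFin \o (fun t => sin (l * X t))).
  by apply: bnd; [exact: continuous_sin|move=> x; rewrite ler_norml sin_geN1 sin_le1].
have sc (r : R) (f : T -> R) : P.-integrable [set: T] (EFin \o f) ->
    P.-integrable [set: T] (EFin \o (fun t => r * f t)).
  by move=> /(integrableZl measurableT r); congr (_.-integrable _ _).
transitivity (\int[P]_t (cos b * cos (l * X t) + sin b * sin (l * X t))).
  by apply: eq_Rintegral => t _; rewrite cosB; ring.
rewrite RintegralD//; [|exact: sc|exact: sc].
by rewrite !RintegralZl// expect_cos expect_sin cosB; ring.
Qed.

Notation mu := (@lebesgue_measure R).

(** With a = s / sg the exponent is a^2 / 2 - (sg X - a)^2 / 2. By [gauss_cos] the Gaussian in X is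
    a cosine transform in y; Fubini puts the expectation inside, where the characteristic function
    at sg y produces exactly the integrand on the imaginary axis, and [stable_contour0] moves the
    line to r = a. *)
Lemma expect_gauss_damped (s sg : R) : 0 < s -> 0 < sg ->
  (\int[P]_t (expR (s * X t - sg ^+ 2 * X t ^+ 2 / 2))%:E =
   (gauss0^-1 * \int[mu]_(y in `]0%R, +oo[)
      (expR (stableP sg (s / sg) (s / sg) y) * cos (stableQ sg (s / sg) (s / sg) y)))%:E)%E.
Proof.
move=> s0 sg0; pose a := s / sg; have a0 : 0 < a by rewrite divr_gt0.
rewrite -/a -(stable_contour0 sg0 a0).
pose D := (`]0%R, +oo[%classic : set R).
pose G (z : T * R) : R := expR (- (z.2 ^+ 2 / 2)) * cos ((sg * X z.1 - a) * z.2) * \1_D z.2.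
have mD : measurable D by exact: measurable_itv.
have mG : measurable_fun [set: T * R] G.
  apply: measurable_funM; first apply: measurable_funM.
  - do 2 apply: measurableT_comp => //; apply: measurable_funM => //.
    by apply: measurable_funX.
  - apply: (measurableT_comp (continuous_measurable_fun (@continuous_cos R))).
    apply: measurable_funM => //; apply: measurable_funB => //.
    by apply: measurable_funM => //; exact: (measurableT_comp mX).
  - by apply: (@measurableT_comp _ _ _ _ _ _ (\1_D : R -> R)) => //; exact: measurable_indic.
have intG t : (\int[mu]_y (G (t, y))%:E)%E = (gauss0 * expR (- ((sg * X t - a) ^+ 2 / 2)))%:E.
  rewrite -gauss_cos /Rintegral fineK; last first.
    by apply: integrable_fin_num => //; exact: integrable_gauss_cos.
  rewrite [RHS]integral_mkcond; apply: eq_integral => y _.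
  by rewrite /G/= patchE indicE; case: (y \in D); rewrite ?mulr1 ?mulr0.
have iG : (P \x mu)%E.-integrable [set: T * R] (EFin \o G).
  pose g (z : T * R) : R := expR (- (z.2 ^+ 2 / 2)) * \1_D z.2.
  have mg : measurable_fun [set: T * R] g.
    apply: measurable_funM.
      do 2 apply: measurableT_comp => //; apply: measurable_funM => //.
      by apply: measurable_funX.
    by apply: (@measurableT_comp _ _ _ _ _ _ (\1_D : R -> R)) => //; exact: measurable_indic.
  have g0 z : 0 <= g z by rewrite mulr_ge0 ?expR_ge0.
  have ig : (P \x mu)%E.-integrable [set: T * R] (EFin \o g).
    apply/integrable12ltyP; first exact/measurable_EFinP.
    rewrite (eq_integral (cst (gauss0 : R)%:E)).
      rewrite integral_cst// ltey_eq fin_numM//.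
      by have := fin_num_measure P _ measurableT.
    move=> t _; rewrite /gauss0 /Rintegral fineK; last first.
      by apply: integrable_fin_num => //; exact: integrable_gauss.
    rewrite [RHS]integral_mkcond; apply: eq_integral => y _.
    rewrite gee0_abs ?lee_fin// patchE /g/= indicE.
    by case: (y \in D); rewrite ?mulr1 ?mulr0.
  apply: le_integrable ig => //; first exact/measurable_EFinP.
  move=> z _; rewrite lee_fin [leRHS]ger0_norm//.
  rewrite /G /g !normrM [X in X * _ * _]ger0_norm ?expR_ge0//.
  rewrite [`|\1_D _|]ger0_norm// ler_wpM2r// ler_piMr ?expR_ge0//.
  by rewrite ler_norml cos_geN1 cos_le1.
have iA : mu.-integrable D (EFin \o (fun y => expR (stableP sg a 0 y) * cos (stableQ sg a 0 y))).
  apply: (@integrable_pos_cont _ _ (expR (sg ^+ 2 * a ^+ 2 + a ^+ 2 + (sg ^+ 2 * a + 1) ^+ 2 / 2))).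
    by apply: measurable_pos_cont => y y0; exact: cvg_stable_integrand.
  by move=> y y0; rewrite stable_integrand_le// lexx ltW.
have iC y : P.-integrable [set: T] (EFin \o (fun t => cos (sg * y * X t - a * y))).
  exact: integrable_cosB.
have := Fubini iG; rewrite /comp.
under eq_integral do rewrite intG.
have -> : (\int[mu]_y \int[P]_x (G (x, y))%:E =
    (expR (- (a ^+ 2 / 2)))%:E * \int[mu]_(y in D) (expR (stableP sg a 0 y) * cos (stableQ sg a 0 y))%:E)%E.
  rewrite -integralZl//.
  rewrite [RHS]integral_mkcond; apply: eq_integral => y _.
  rewrite patchE /G/= indicE; case: ifPn => yD; last first.
    by rewrite integral0_eq// => t _; rewrite mulr0.
  move: yD; rewrite pos_itv => y0.
  rewrite (eq_integral (fun t => (expR (- (y ^+ 2 / 2)))%:E * (cos (sg * y * X t - a * y))%:E)%E); last first.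
    by move=> t _; rewrite mulr1 -EFinM; congr (_ * cos _)%:E; ring.
  rewrite integralZl//; last exact: iC.
  have -> : (\int[P]_t (cos (sg * y * X t - a * y))%:E = (\int[P]_t cos (sg * y * X t - a * y))%:E)%E.
    by rewrite /Rintegral fineK//; apply: integrable_fin_num => //; exact: iC.
  have sy0 : 0 < sg * y by rewrite mulr_gt0.
  have L : logm sg 0 y = ln (sg * y).
    rewrite /logm expr0n add0r -exprMn lnXn// mulr2n; lra.
  have A : argm 0 y = pi / 2 by rewrite /argm mul0r atan0 subr0.
  rewrite expect_cosB gtr0_norm// -!EFinM; congr (_%:E).
  rewrite !mulrA -!expRD; congr (expR _ * cos _).
    by rewrite /stableP L A; lra.
  by rewrite /stableQ L A; ring.
move=> eqG.
have e0 : gauss0 != 0 :> R by rewrite gt_eqF// gauss0_gt0.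
transitivity ((gauss0^-1 * expR (a ^+ 2 / 2))%:E * \int[P]_x (gauss0 * expR (- ((sg * X x - a) ^+ 2 / 2)))%:E)%E.
  rewrite -ge0_integralZl//.
  - apply: eq_integral => t _; rewrite -EFinM; congr (_%:E).
    have -> : s * X t - sg ^+ 2 * X t ^+ 2 / 2 = a ^+ 2 / 2 + - ((sg * X t - a) ^+ 2 / 2).
      by rewrite /a; field; rewrite gt_eqF.
    by rewrite expRD; field.
  - apply/measurable_EFinP; apply: measurable_funM => //.
    do 2 apply: measurableT_comp => //; apply: measurable_funM => //.
    by apply: measurable_funX; apply: measurable_funB => //; exact: measurable_funM.
  - by move=> t _; rewrite lee_fin mulr_ge0 ?expR_ge0// ltW// gauss0_gt0.
  - by rewrite lee_fin mulr_ge0 ?expR_ge0// invr_ge0 ltW// gauss0_gt0.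
rewrite eqG muleA -EFinM -mulrA -expRD subrr expR0 mulr1 EFinM.
by rewrite /Rintegral fineK//; apply: integrable_fin_num.
Qed.

End char_fun.

Section exponential_moments.
Context d (T : measurableType d) (R : realType) (P : probability T R).
Notation mu := (@lebesgue_measure R).
Variable X : T -> R.
Hypothesis XP : log_S_law P X.
Hypothesis mX : measurable_fun [set: T] X.

Let sg (n : nat) : R := n.+1%:R^-1.

Let sg_gt0 n : 0 < sg n. Proof. by rewrite invr_gt0. Qed.

Let sg_le1 n : sg n <= 1. Proof. by rewrite invf_le1// ler1n. Qed.

Let cvg_sg : sg n @[n --> \oo] --> (0 : R). Proof. exact: cvg_harmonic. Qed.

(** On the line r = s / sg the variable w is s + i sg y, which tends to s: the phase disappears in
    the limit and e^(s ln s - s) times the Gaussian weight remains. *)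
Let cvg_stable_integral (s : R) : 0 < s ->
  (\int[mu]_(y in `]0%R, +oo[)
     (expR (stableP (sg n) (s / sg n) (s / sg n) y) * cos (stableQ (sg n) (s / sg n) (s / sg n) y)))
   @[n --> \oo] --> gauss0 * expR (s * ln s - s).
Proof.
move=> s0.
have -> : gauss0 * expR (s * ln s - s) = \int[mu]_(y in `]0%R, +oo[) (expR (s * ln s - s) * expR (- (y ^+ 2 / 2))).
  by rewrite RintegralZl//; [rewrite mulrC|exact: integrable_gauss].
have a0 n : 0 < s / sg n by rewrite divr_gt0.
have sa n : sg n * (s / sg n) = s by field; rewrite gt_eqF.
have PE n y : stableP (sg n) (s / sg n) (s / sg n) y =
    s * (logm (sg n) (s / sg n) y - 1) - sg n * y * argm (s / sg n) y - y ^+ 2 / 2.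
  by rewrite /stableP subrr expr0n sub0r; field; rewrite gt_eqF.
have QE n y : stableQ (sg n) (s / sg n) (s / sg n) y =
    sg n * y * (logm (sg n) (s / sg n) y - 1) + s * argm (s / sg n) y.
  by rewrite /stableQ subrr mul0r addr0; field; rewrite gt_eqF.
apply: (@Rdominated_pos R _ _ (expR (s ^+ 2 + (s + 1) ^+ 2 / 2))).
- by move=> n; apply: measurable_pos_cont => y y0; exact: cvg_stable_integrand.
- move=> y y0.
  have cL : logm (sg n) (s / sg n) y @[n --> \oo] --> ln s.
    have -> : (fun n => logm (sg n) (s / sg n) y) = (fun n => ln (s ^+ 2 + (sg n * y) ^+ 2) / 2).
      apply/funext => n; rewrite /logm; congr (ln _ / 2).
      by field; rewrite gt_eqF.
    have -> : ln s = ln (s ^+ 2 + (0 * y) ^+ 2) / 2.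
      by rewrite mul0r expr0n addr0 lnXn// mulr2n; lra.
    apply: cvgM; last exact: cvg_cst.
    have h : (s ^+ 2 + (sg n * y) ^+ 2) @[n --> \oo] --> s ^+ 2 + (0 * y) ^+ 2.
      apply: cvgD; first exact: cvg_cst.
      by rewrite !expr2; apply: cvgM; apply: cvgM => //; exact: cvg_cst.
    apply: (cvg_comp _ _ h); apply: continuous_ln.
    by rewrite mul0r expr0n addr0 exprn_gt0.
  have cA : argm (s / sg n) y @[n --> \oo] --> (0 : R).
    rewrite -[X in _ --> X](subrr (pi / 2)); apply: cvgB; first exact: cvg_cst.
    have h : (s / sg n / y) @[n --> \oo] --> +oo.
      have -> : (fun n => s / sg n / y) = (fun n => (s / y) * n.+1%:R).
        by apply/funext => n; rewrite /sg invrK mulrAC.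
      have hn : (n.+1%:R : R) @[n --> \oo] --> +oo.
        by have := @cvgr_idn R; rewrite -(@cvg_shiftn 1); under eq_fun do rewrite addn1.
      have hM : (s / y * z) @[z --> +oo] --> +oo by apply: gt0_cvgMry; rewrite ?divr_gt0.
      exact: (cvg_comp _ _ hn hM).
    exact: (cvg_comp _ _ h (@cvgy_atan R)).
  have csy : sg n * y @[n --> \oo] --> (0 : R).
    by rewrite -[X in _ --> X](mul0r y); apply: cvgM => //; exact: cvg_cst.
  have cP : stableP (sg n) (s / sg n) (s / sg n) y @[n --> \oo] --> s * (ln s - 1) - 0 * 0 - y ^+ 2 / 2.
    under eq_fun do rewrite PE.
    apply: cvgB; last exact: cvg_cst; apply: cvgB; last exact: cvgM.
    by apply: cvgM; [exact: cvg_cst|apply: cvgB => //; exact: cvg_cst].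
  have cQ : stableQ (sg n) (s / sg n) (s / sg n) y @[n --> \oo] --> 0 * (ln s - 1) + s * 0.
    under eq_fun do rewrite QE.
    apply: cvgD; last by apply: cvgM => //; exact: cvg_cst.
    by apply: cvgM => //; apply: cvgB => //; exact: cvg_cst.
  rewrite mul0r mulr0 addr0 in cQ.
  rewrite -expRD -[X in _ --> X]mulr1; apply: cvgM.
    rewrite (_ : s * ln s - s + - (y ^+ 2 / 2) = s * (ln s - 1) - 0 * 0 - y ^+ 2 / 2); last by ring.
    exact: (cvg_comp _ _ cP (@continuous_expR R _)).
  by rewrite -(@cos0 R); exact: (cvg_comp _ _ cQ (@continuous_cos R _)).
- move=> n y y0; rewrite normrM ger0_norm ?expR_ge0//.
  rewrite (@le_trans _ _ (expR (stableP (sg n) (s / sg n) (s / sg n) y)))//.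
    by rewrite ler_piMr ?expR_ge0// ler_norml cos_geN1 cos_le1.
  rewrite -expRD ler_expR PE (le_trans _ (gauss_bound (s ^+ 2) s (ltW y0)))//.
  have h1 := logm_le (sg_gt0 n) (ltW (a0 n)) y0.
  rewrite mulrDr sa in h1.
  have h2 : sg n * y <= y by rewrite ler_piMl// ltW.
  have h3 := mulr_ge0 (mulr_ge0 (ltW (sg_gt0 n)) (ltW y0)) (argm_ge0 (s / sg n) y).
  have h4 := ler_wpM2l (ltW s0) (le_trans h1 (lerD (lexx s) h2)).
  by rewrite expr2; have := ltW s0; lra.
Qed.

(** The damping factor increases to 1 as [sg n] decreases to 0, so monotone convergence gives the
    value and the finiteness at once. *)
Lemma expect_expR (s : R) : 0 < s ->
  (\int[P]_t (expR (s * X t))%:E = (expR (s * ln s - s))%:E)%E.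
Proof.
move=> s0.
have cv1 : (\int[P]_t (expR (s * X t - sg n ^+ 2 * X t ^+ 2 / 2))%:E)%E @[n --> \oo] -->
    (expR (s * ln s - s))%:E.
  under eq_fun do rewrite expect_gauss_damped//.
  apply: cvg_EFin; first by apply: nearW.
  rewrite -[X in _ --> X](mulKf (x := gauss0)) ?gt_eqF ?gauss0_gt0//.
  by apply: cvgM; [exact: cvg_cst|exact: cvg_stable_integral].
have cv2 : (\int[P]_t (expR (s * X t - sg n ^+ 2 * X t ^+ 2 / 2))%:E)%E @[n --> \oo] -->
    (\int[P]_t (expR (s * X t))%:E)%E.
  have mf n : measurable_fun [set: T] (fun t => (expR (s * X t - sg n ^+ 2 * X t ^+ 2 / 2))%:E).
    apply/measurable_EFinP; apply: measurableT_comp => //; apply: measurable_funB.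
      exact: measurable_funM.
    by apply: measurable_funM => //; apply: measurable_funM => //; exact: measurable_funX.
  have -> : (\int[P]_t (expR (s * X t))%:E =
      \int[P]_t (limn (fun n => (expR (s * X t - sg n ^+ 2 * X t ^+ 2 / 2))%:E)))%E.
    apply: eq_integral => t _; apply/esym/cvg_lim => //.
    apply: cvg_EFin; first by apply: nearW.
    have h : s * X t - sg n ^+ 2 * X t ^+ 2 / 2 @[n --> \oo] --> s * X t - 0 * 0 * X t ^+ 2 / 2.
      apply: cvgB; first exact: cvg_cst.
      apply: cvgM; last exact: cvg_cst.
      by apply: cvgM; [exact: (cvgM cvg_sg cvg_sg)|exact: cvg_cst].
    rewrite !mul0r subr0 in h.
    exact: (cvg_comp _ _ h (@continuous_expR R _)).
  apply: cvg_monotone_convergence => //; try by [exact: mf|move=> n t _; rewrite lee_fin expR_ge0].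
  move=> t _ m n mn; rewrite lee_fin ler_expR lerD2l lerN2 ler_pM2r// ler_wpM2r ?sqr_ge0//.
  rewrite lerXn2r ?nnegrE ?(ltW (sg_gt0 _))//.
  by rewrite /sg lef_pV2 ?posrE// ler_nat.
by rewrite (cvg_unique _ cv1 cv2).
Qed.

End exponential_moments.

(** * Entire functions of exponential type *)

Section entire_series.
Context {R : realType}.
Implicit Types (a b r : nat -> R) (x : R).

Definition ev a x : R := limn (series (fun j => a j * x ^+ j)).

Definition exp_bounded (C L : R) a := forall j, `|a j| <= C * (L ^+ j / j`!%:R).

Definition exp_type a := exists C L, exp_bounded C L a.

Lemma cvg_exp_majorant (C L x : R) : series (fun j => C * exp_coeff (L * x) j) @ \oo --> C * expR (L * x).
Proof.
have -> : series (fun j => C * exp_coeff (L * x) j) = (fun n => C * series (exp_coeff (L * x)) n).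
  by apply/funext => n; rewrite /series/= mulr_sumr.
by apply: cvgM; [exact: cvg_cst|exact: is_cvg_series_exp_coeff].
Qed.

Section bounded.
Variables (C L x : R) (a : nat -> R).
Hypotheses (x0 : 0 <= x) (ba : exp_bounded C L a).

Let e j : R := C * exp_coeff (L * x) j.

Let le_e j : `|a j * x ^+ j| <= e j.
Proof.
rewrite normrM [X in _ * X]ger0_norm ?exprn_ge0//.
rewrite (le_trans (ler_wpM2r (exprn_ge0 j x0) (ba j)))//.
by rewrite /e /exp_coeff /= exprMn le_eqVlt; apply/orP; left; apply/eqP; ring.
Qed.

Let cvg_e := @cvg_exp_majorant C L x.

Lemma is_cvg_series_norm_ev : cvgn [normed series (fun j => a j * x ^+ j)].
Proof.
apply: (@series_le_cvg _ _ e) => //.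
- by move=> n /=.
- by move=> n; exact: (le_trans (normr_ge0 _) (le_e n)).
- by apply/cvg_ex; exists (C * expR (L * x)).
Qed.

Lemma cvg_ev : series (fun j => a j * x ^+ j) @ \oo --> ev a x.
Proof. exact: (normed_cvg is_cvg_series_norm_ev). Qed.

Lemma series_ev_le n : `|series (fun j => a j * x ^+ j) n| <= C * expR (L * x).
Proof.
apply: (@le_trans _ _ (series e n)).
  by rewrite /series/= (le_trans (ler_norm_sum _ _ _))// ler_sum.
have /cvg_lim <- // := cvg_e.
apply: nondecreasing_cvgn_le; last by apply/cvg_ex; exists (C * expR (L * x)).
apply/nondecreasing_seqP => k; rewrite /series/= big_nat_recr//= lerDl.
exact: (le_trans (normr_ge0 _) (le_e k)).
Qed.

(** The remainder is at most that of C e^(L x), hence uniform over all coefficient sequences with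
    the same [C] and [L]. *)
Lemma ev_tail n : `|ev a x - series (fun j => a j * x ^+ j) n| <= C * expR (L * x) - series e n.
Proof.
have h1 : `|series (fun j => a j * x ^+ j) m - series (fun j => a j * x ^+ j) n| @[m --> \oo] -->
    `|ev a x - series (fun j => a j * x ^+ j) n|.
  by apply: cvg_norm; apply: cvgB; [exact: cvg_ev|exact: cvg_cst].
have h2 : (series e m - series e n) @[m --> \oo] --> C * expR (L * x) - series e n.
  by apply: cvgB; [exact: cvg_e|exact: cvg_cst].
apply: (ler_cvg_to h1 h2); near=> m.
have nm : (n <= m)%N by near: m; exact: nbhs_infty_ge.
rewrite !sub_series_geq// (le_trans (ler_norm_sum _ _ _))// ler_sum.
Unshelve. all: by end_near. Qed.

End bounded.

(* Tannery's theorem *)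
Lemma cvg_ev_coeff (C L x : R) (a_ : nat -> nat -> R) (a : nat -> R) :
  0 <= x ->
  (forall m, exp_bounded C L (a_ m)) -> (forall j, a_ m j @[m --> \oo] --> a j) ->
  ev (a_ m) x @[m --> \oo] --> ev a x.
Proof.
move=> x0 ba ca.
have bl : exp_bounded C L a.
  by move=> j; apply: (cvgr_to_le (cvg_norm (ca j))); apply: nearW => m; exact: ba.
apply/cvgrPdist_le => eps e0.
have e3 : 0 < eps / 3 by rewrite divr_gt0.
have [N hN] : exists N, C * expR (L * x) - series (fun j => C * exp_coeff (L * x) j) N <= eps / 3.
  have := @cvg_exp_majorant C L x; move/cvgrPdist_le => /(_ _ e3)[N _ /(_ N (leqnn N))] h.
  by exists N; exact: le_trans (ler_norm _) h.
have cN : series (fun j => a_ m j * x ^+ j) N @[m --> \oo] --> series (fun j => a j * x ^+ j) N.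
  rewrite /series/=; elim: N {hN} => [|N ih].
    by under eq_fun do rewrite big_nil; rewrite big_nil; exact: cvg_cst.
  under eq_fun do rewrite big_nat_recr//=.
  rewrite big_nat_recr//=; apply: cvgD => //.
  by apply: cvgM; [exact: ca|exact: cvg_cst].
move/cvgrPdist_le : cN => /(_ _ e3) cN.
near=> m.
have h1 := ev_tail x0 bl N.
have h2 := ev_tail x0 (ba m) N.
have h3 : `|series (fun j => a j * x ^+ j) N - series (fun j => a_ m j * x ^+ j) N| <= eps / 3.
  by near: m.
have -> : ev a x - ev (a_ m) x = (ev a x - series (fun j => a j * x ^+ j) N) +
  (series (fun j => a j * x ^+ j) N - series (fun j => a_ m j * x ^+ j) N) -
  (ev (a_ m) x - series (fun j => a_ m j * x ^+ j) N) by ring.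
rewrite (le_trans (ler_normB _ _))// (_ : eps = eps / 3 + eps / 3 + eps / 3); last by lra.
rewrite lerD ?(le_trans h2)// (le_trans (ler_normD _ _))// lerD// (le_trans h1)//.
Unshelve. all: by end_near. Qed.

End entire_series.

Section dominated.
Context d (T : measurableType d) (R : realType) (mu : {measure set T -> \bar R}).

Lemma Rdominated_convergence (D : set T) (f_ : nat -> T -> R) (f g : T -> R) :
  measurable D -> (forall n, measurable_fun D (f_ n)) ->
  (forall x, D x -> f_ n x @[n --> \oo] --> f x) ->
  mu.-integrable D (EFin \o g) ->
  (forall n x, D x -> `|f_ n x| <= g x) ->
  mu.-integrable D (EFin \o f) /\
  (\int[mu]_(x in D) f_ n x) @[n --> \oo] --> \int[mu]_(x in D) f x.
Proof.
move=> mD mf ff ig fg.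
have mlim : measurable_fun D f by exact: (measurable_fun_cvg (h := f_)).
have [intf _ cv] : [/\ mu.-integrable D (EFin \o f),
    (fun n => \int[mu]_(x in D) `|(EFin \o f_ n) x - (EFin \o f) x|)%E @ \oo --> 0%E &
    (fun n => \int[mu]_(x in D) (EFin \o f_ n) x)%E @ \oo -->
     (\int[mu]_(x in D) (EFin \o f) x)%E].
  apply: (@dominated_convergence _ _ R mu _ _ _ _ (EFin \o g)) => //.
  - by move=> n; apply/measurable_EFinP; exact: mf.
  - exact/measurable_EFinP.
  - apply: aeW => x Dx.
    by apply: cvg_EFin; [by apply: nearW|exact: ff].
  - by apply: aeW => x n Dx; rewrite lee_fin fg.
split=> //; apply: (@fine_cvg _ _ _ _ _ (\int[mu]_(y in D) f y)) => //.
by rewrite /Rintegral fineK //; exact: integrable_fin_num.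
Qed.

Lemma integrable_mull (D : set T) (f : T -> R) (r : R) : measurable D ->
  mu.-integrable D (EFin \o f) -> mu.-integrable D (EFin \o (fun t => r * f t)).
Proof. by move=> mD /(integrableZl mD r); congr (_.-integrable _ _). Qed.

Lemma integrable_subR (D : set T) (f g : T -> R) : measurable D ->
  mu.-integrable D (EFin \o f) -> mu.-integrable D (EFin \o g) ->
  mu.-integrable D (EFin \o (fun t => f t - g t)).
Proof. by move=> mD fi gi; have := integrableB mD fi gi; congr (_.-integrable _ _). Qed.

(** The weight [h] is a Levy density in [contracts_integral] and the constant 1 in [integral_ev1].
    Domination is asked of the partial sums, because its source differs from one use to the
    other. *)
Lemma integral_ev (D : set T) (a : nat -> R) (Y h g : T -> R) (C L : R) :
  measurable D -> exp_bounded C L a ->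
  (forall t, D t -> 0 <= Y t) ->
  (forall j, mu.-integrable D (EFin \o (fun t => Y t ^+ j * h t))) ->
  mu.-integrable D (EFin \o g) ->
  (forall n t, D t -> `|series (fun j => a j * Y t ^+ j) n * h t| <= g t) ->
  mu.-integrable D (EFin \o (fun t => ev a (Y t) * h t)) /\
  series (fun j => a j * \int[mu]_(t in D) (Y t ^+ j * h t)) @ \oo -->
    \int[mu]_(t in D) (ev a (Y t) * h t).
Proof.
move=> mD ba Y0 iY ig hg.
have iS n : mu.-integrable D (EFin \o (fun t => series (fun j => a j * Y t ^+ j) n * h t)) /\
    \int[mu]_(t in D) (series (fun j => a j * Y t ^+ j) n * h t) =
    series (fun j => a j * \int[mu]_(t in D) (Y t ^+ j * h t)) n.
  rewrite /series/=; elim: n => [|n [ih1 ih2]].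
    have -> : (fun t => (\sum_(0 <= k < 0) a k * Y t ^+ k) * h t) = cst 0.
      by apply/funext => t; rewrite big_nil mul0r.
    rewrite big_nil; split; first exact: integrable0.
    by rewrite /Rintegral integral0.
  have -> : (fun t => (\sum_(0 <= k < n.+1) a k * Y t ^+ k) * h t) =
      (fun t => (\sum_(0 <= k < n) a k * Y t ^+ k) * h t + a n * (Y t ^+ n * h t)).
    by apply/funext => t; rewrite big_nat_recr//= mulrDl mulrA.
  have iZ : mu.-integrable D (EFin \o (fun t => a n * (Y t ^+ n * h t))).
    exact: integrable_mull.
  split; last by rewrite RintegralD// ih2 RintegralZl// big_nat_recr.
  by have := integrableD mD ih1 iZ; congr (_.-integrable _ _).
have [i1 cv] := @Rdominated_convergence D
  (fun n t => series (fun j => a j * Y t ^+ j) n * h t) (fun t => ev a (Y t) * h t) g mD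
  (fun n => (measurable_EFinP _ _).1 (measurable_int _ (iS n).1))
  (fun t Dt => cvgM (cvg_ev (Y0 t Dt) ba) (cvg_cst (h t))) ig hg.
split=> //; have -> : series (fun j => a j * \int[mu]_(t in D) (Y t ^+ j * h t)) =
  (fun n => \int[mu]_(t in D) (series (fun j => a j * Y t ^+ j) n * h t)) => //.
by apply/funext => n; rewrite (iS n).2.
Qed.

End dominated.

(** * Multiplicative contractions *)

Section contraction.
Context {R : realType}.
Notation mu := (@lebesgue_measure R).
Implicit Types (a r s : nat -> R) (p xi : R).

Definition increasing_ev a := forall x y : R, 0 <= x -> x <= y -> 0 <= ev a x <= ev a y.

(* [r] stands for the moments of a random variable [V] with values in [[0, 1]] such that
   [P(V <= xi) >= 1 - p], through its action [f |-> E f(x V)] on increasing entire functions. *)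
Definition contracts p xi r := (forall j, 0 <= r j <= 1) /\
  forall a, exp_type a -> increasing_ev a ->
    increasing_ev (fun j => r j * a j) /\
    forall x : R, 0 <= x -> ev (fun j => r j * a j) x <= p * ev a x + (1 - p) * ev a (xi * x).

Lemma exp_bounded_mul (C L : R) a r : (forall j, 0 <= r j <= 1) ->
  exp_bounded C L a -> exp_bounded C L (fun j => r j * a j).
Proof.
move=> r01 ba j; have /andP[r0 r1] := r01 j.
by rewrite normrM ger0_norm// (le_trans _ (ba j))// ler_piMl.
Qed.

Lemma exp_type_mul a r : (forall j, 0 <= r j <= 1) ->
  exp_type a -> exp_type (fun j => r j * a j).
Proof. by move=> r01 [C [L ba]]; exists C, L; exact: exp_bounded_mul. Qed.

Lemma evL (c e x : R) a s : exp_type a -> exp_type s -> 0 <= x ->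
  ev (fun j => c * a j + e * s j) x = c * ev a x + e * ev s x.
Proof.
move=> [C1 [L1 b1]] [C2 [L2 b2]] x0; apply/cvg_lim => //.
have -> : series (fun j => (c * a j + e * s j) * x ^+ j) =
   (fun n => c * series (fun j => a j * x ^+ j) n + e * series (fun j => s j * x ^+ j) n).
  apply/funext => n; rewrite /series/= !mulr_sumr -big_split/=.
  by apply: eq_bigr => j _; rewrite mulrDl !mulrA.
by apply: cvgD; (apply: cvgM; first exact: cvg_cst); [exact: cvg_ev b1|exact: cvg_ev b2].
Qed.

(** As all r_j lie in [0, 1], the products with [a] share one exponential bound and Tannery's
    theorem applies. This allows truncating the Poisson series and exhausting the Levy measure. *)
Lemma contracts_lim p xi (r_ : nat -> nat -> R) r : 0 <= xi ->
  (forall m, contracts p xi (r_ m)) -> (forall j, r_ m j @[m --> \oo] --> r j) ->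
  contracts p xi r.
Proof.
move=> xi0 cr cv; split.
  move=> j; apply/andP; split.
    by apply: (cvgr_to_ge (cv j)); apply: nearW => m; case/andP: ((cr m).1 j).
  by apply: (cvgr_to_le (cv j)); apply: nearW => m; case/andP: ((cr m).1 j).
move=> a [C [L ba]] ia; have ta : exp_type a by exists C, L.
have cvx x : 0 <= x -> ev (fun j => r_ m j * a j) x @[m --> \oo] --> ev (fun j => r j * a j) x.
  move=> x0; apply: (@cvg_ev_coeff _ C L) => //.
    by move=> m; exact: (exp_bounded_mul (cr m).1).
  by move=> j; apply: cvgM => //; exact: cvg_cst.
split.
  move=> x y x0 xy; have y0 := le_trans x0 xy; apply/andP; split.
    apply: (cvgr_to_ge (cvx x x0)); apply: nearW => m.
    by have /(_ x y x0 xy)/andP[] := ((cr m).2 a ta ia).1.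
  apply: (ler_cvg_to (cvx x x0) (cvx y y0)); apply: nearW => m.
  by have /(_ x y x0 xy)/andP[] := ((cr m).2 a ta ia).1.
move=> x x0; apply: (cvgr_to_le (cvx x x0)); apply: nearW => m.
exact: ((cr m).2 a ta ia).2.
Qed.

Lemma contracts1 p xi r : 0 <= p <= 1 -> 0 <= xi <= 1 -> contracts p xi r -> contracts 1 1 r.
Proof.
move=> /andP[p0 p1] /andP[xi0 xi1] [r01 cr]; split => // a ta ia.
have [h1 h2] := cr a ta ia; split => // x x0.
rewrite (le_trans (h2 x x0))// subrr mul0r addr0 mul1r.
have /andP[_ h3] : 0 <= ev a (xi * x) <= ev a x by apply: ia; rewrite ?mulr_ge0// ler_piMl.
have h4 : (1 - p) * ev a (xi * x) <= (1 - p) * ev a x by rewrite ler_wpM2l// subr_ge0.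
by rewrite mulrBl mul1r in h4; lra.
Qed.

(** Product of two independent variables: the factor known only to be at most 1 can but lower the
    function, and the other one keeps its tail bound. *)
Lemma contractsM p xi r s : 0 <= p <= 1 -> 0 <= xi ->
  contracts 1 1 r -> contracts p xi s -> contracts p xi (fun j => r j * s j).
Proof.
move=> /andP[p0 p1] xi0 [r01 cr] [s01 cs]; split.
  move=> j; have /andP[r0 r1] := r01 j; have /andP[s0 s1] := s01 j.
  by rewrite mulr_ge0//= mulr_ile1.
move=> a ta ia.
have [h1 h2] := cr a ta ia.
have [h3 h4] := cs _ (exp_type_mul r01 ta) h1.
have -> : (fun j => r j * s j * a j) = (fun j => s j * (r j * a j)).
  by apply/funext => j; ring.
split => // x x0; rewrite (le_trans (h4 x x0))//.
have e1 := h2 x x0; have e2 := h2 (xi * x) (mulr_ge0 xi0 x0).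
rewrite !mul1r subrr !mul0r !addr0 in e1 e2.
by rewrite lerD// ler_wpM2l// subr_ge0.
Qed.

Lemma contracts_cst1 xi : contracts 1 xi (fun=> 1).
Proof.
split => [j|a ta ia]; first by rewrite ler01 lexx.
have -> : (fun j => 1 * a j) = a by apply/funext => j; rewrite mul1r.
by split => // x x0; rewrite mul1r subrr mul0r addr0.
Qed.

(** [p = 0] means V <= xi almost surely; a product of at least one copy of V is still at most xi,
    whence the exponent [k.+1]. *)
Lemma contracts_pow xi r k : 0 <= xi <= 1 -> contracts 0 xi r -> contracts 0 xi (fun j => r j ^+ k.+1).
Proof.
move=> xi01 cr; have /andP[xi0 _] := xi01; elim: k => [|k ih].
  by rewrite (_ : (fun j => r j ^+ 1) = r)//; apply/funext => j; rewrite expr1.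
have -> : (fun j => r j ^+ k.+2) = (fun j => r j * r j ^+ k.+1) by apply/funext => j; rewrite exprS.
apply: contractsM => //; first by rewrite lexx ler01.
by apply: contracts1 cr => //; rewrite lexx ler01.
Qed.

(** Compound Poisson: N independent copies of V are multiplied, N being Poisson of parameter w, and
    the generating function of N gives e^(-w (1 - r_j)). Only the event N = 0, of probability
    e^(-w), escapes the bound by xi. *)
Lemma contracts_expR (w xi : R) r : 0 <= w -> 0 <= xi <= 1 -> contracts 0 xi r ->
  contracts (expR (- w)) xi (fun j => expR (- (w * (1 - r j)))).
Proof.
move=> w0 xi01 cr; have /andP[xi0 xi1] := xi01.
pose q k := expR (- w) * exp_coeff w k.
have q0 k : 0 <= q k by rewrite mulr_ge0 ?expR_ge0// exp_coeff_ge0.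
have qw : series q @ \oo --> (1 : R).
  have -> : series q = (fun n => expR (- w) * series (exp_coeff w) n).
    by apply/funext => n; rewrite /series/= mulr_sumr.
  rewrite -(expRxMexpNx_1 w) mulrC.
  by apply: cvgM; [exact: cvg_cst|exact: is_cvg_series_exp_coeff].
have qle n : series q n <= 1.
  have /cvg_lim <- // := qw; apply: nondecreasing_cvgn_le; last by apply/cvg_ex; exists 1.
  by apply/nondecreasing_seqP => k; rewrite /series/= big_nat_recr//= lerDl.
(* The Poisson series cut at n. Its total mass is below 1, which is harmless: [contracts] asks for
   r_j <= 1 and not for r_0 = 1. *)
pose S (n j : nat) := \sum_(0 <= k < n.+1) q k * r j ^+ k.
have r01 := cr.1.
have S01 n j : 0 <= S n j <= 1.
  have /andP[r0 r1] := r01 j; apply/andP; split.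
    by apply: sumr_ge0 => k _; rewrite mulr_ge0// exprn_ge0.
  rewrite (le_trans _ (qle n.+1))// ler_sum// => k _.
  by rewrite ler_piMr// exprn_ile1.
apply: (@contracts_lim _ _ S) => //; last first.
  move=> j.
  have -> : (fun m => S m j) = (fun m => expR (- w) * series (exp_coeff (w * r j)) m.+1).
    apply/funext => m; rewrite /S /series/= mulr_sumr; apply: eq_bigr => k _.
    by rewrite /q /exp_coeff/= exprMn -!mulrA; congr (_ * (_ * _)); rewrite mulrC.
  have -> : expR (- (w * (1 - r j))) = expR (- w) * expR (w * r j).
    by rewrite -expRD; congr expR; ring.
  apply: cvgM; first exact: cvg_cst.
  rewrite -/((fun n => series (exp_coeff (w * r j)) n.+1) @ \oo).
  by rewrite cvg_shiftS; exact: is_cvg_series_exp_coeff.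
move=> n; split; first exact: S01.
move=> a ta ia.
have tS m : exp_type (fun j => S m j * a j) by exact: exp_type_mul.
have tr m : exp_type (fun j => r j ^+ m * a j).
  apply: exp_type_mul => // j; have /andP[r0 r1] := r01 j.
  by rewrite exprn_ge0//= exprn_ile1.
have SS m x : 0 <= x -> ev (fun j => S m.+1 j * a j) x =
    ev (fun j => S m j * a j) x + q m.+1 * ev (fun j => r j ^+ m.+1 * a j) x.
  move=> x0; rewrite -[X in _ = X + _]mul1r -evL//; congr (ev _ x); apply/funext => j.
  by rewrite /S big_nat_recr//= mulrDl mul1r mulrA.
have S0 x : 0 <= x -> ev (fun j => S 0%N j * a j) x = expR (- w) * ev a x.
  move=> x0; rewrite -[RHS]addr0 -(mul0r (ev a x)) -evL//; congr (ev _ x); apply/funext => j.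
  by rewrite /S big_nat1 /q /exp_coeff/= !expr0 fact0 divr1 !mulr1 mul0r addr0.
have main m : increasing_ev (fun j => S m j * a j) /\
    forall x : R, 0 <= x -> ev (fun j => S m j * a j) x <=
      expR (- w) * ev a x + (series q m.+1 - expR (- w)) * ev a (xi * x).
  elim: m => [|m [ih1 ih2]].
    split=> [x y x0 xy|x x0].
      rewrite !S0//; last exact: le_trans xy.
      have /andP[e1 e2] := ia x y x0 xy.
      by rewrite mulr_ge0 ?expR_ge0//= ler_wpM2l// expR_ge0.
    rewrite S0// (_ : series q 1 = expR (- w)).
      by rewrite subrr mul0r addr0.
    by rewrite /series/= big_nat1 /q /exp_coeff/= expr0 fact0 divr1 mulr1.
  have [h1 h2] := (contracts_pow m xi01 cr).2 a ta ia.
  split=> [x y x0 xy|x x0].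
    rewrite !SS//; last exact: le_trans xy.
    have /andP[e1 e2] := ih1 x y x0 xy; have /andP[e3 e4] := h1 x y x0 xy.
    apply/andP; split; first by rewrite addr_ge0// mulr_ge0.
    by apply: lerD => //; apply: ler_wpM2l.
  rewrite SS// (_ : series q m.+2 = series q m.+1 + q m.+1); last by rewrite /series/= big_nat_recr.
  have e1 := ih2 x x0; have e2 := ler_wpM2l (q0 m.+1) (h2 x x0).
  by rewrite mul0r add0r subr0 mul1r in e2; lra.
have [h1 h2] := main n; split=> // x x0; rewrite (le_trans (h2 x x0))// lerD2l.
rewrite ler_wpM2r//; last by rewrite lerD2r qle.
by have /andP[] := ia (xi * x) (xi * x) (mulr_ge0 xi0 x0) (lexx _).
Qed.

(** These are the moments of e^(-t) for t with density n / w on [D], w being the mass; e^(-t) <= xi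
    throughout [D], whence [p = 0]. *)
Lemma contracts_integral (D : set R) (n : R -> R) (xi : R) : measurable D ->
  D `<=` `]0%R, +oo[ -> 0 <= xi -> (forall t, D t -> expR (- t) <= xi) ->
  (forall t, D t -> 0 <= n t) -> mu.-integrable D (EFin \o n) ->
  0 < \int[mu]_(t in D) n t ->
  contracts 0 xi (fun j => \int[mu]_(t in D) (expR (- (j%:R * t)) * n t) / \int[mu]_(t in D) n t).
Proof.
move=> mD Dpos xi0 Dxi n0 iN; set w := \int[mu]_(t in D) n t => w0.
have D0 t : D t -> 0 < t by move=> /Dpos; rewrite /= in_itv/= andbT.
have mn : measurable_fun D n by apply/measurable_EFinP; exact: measurable_int iN.
have e1 j t : D t -> 0 <= expR (- (j%:R * t)) * n t <= n t.
  move=> Dt; rewrite mulr_ge0 ?expR_ge0 ?n0//=.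
  by rewrite ler_piMl ?n0// expR_le1 oppr_le0 mulr_ge0// ltW// D0.
have mj j : measurable_fun D (fun t => expR (- (j%:R * t)) * n t).
  apply: measurable_funM => //; apply: measurable_funTS; do 2 apply: measurableT_comp => //.
have ij j : mu.-integrable D (EFin \o (fun t => expR (- (j%:R * t)) * n t)).
  apply: le_integrable iN => //; first by apply/measurable_EFinP; exact: mj.
  by move=> t Dt; have /andP[h1 h2] := e1 j t Dt; rewrite lee_fin !ger0_norm ?n0.
split.
  move=> j; apply/andP; split.
    by apply: divr_ge0; [apply: Rintegral_ge0 => t /(e1 j)/andP[]|exact: ltW].
  rewrite ler_pdivrMr// mul1r; apply: le_Rintegral => //.
  by move=> t /(e1 j)/andP[].
move=> a [C [L ba]] ia.
have key x : 0 <= x -> ev (fun j => \int[mu]_(t in D) (expR (- (j%:R * t)) * n t) / w * a j) x =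
    w^-1 * \int[mu]_(t in D) (ev a (x * expR (- t)) * n t) /\
    mu.-integrable D (EFin \o (fun t => ev a (x * expR (- t)) * n t)).
  move=> x0.
  have xe t : D t -> 0 <= x * expR (- t) <= x.
    move=> /D0 t0; rewrite mulr_ge0 ?expR_ge0//=.
    by rewrite ler_piMr// expR_le1 oppr_le0 ltW.
  have pw j t : (x * expR (- t)) ^+ j * n t = x ^+ j * (expR (- (j%:R * t)) * n t).
    by rewrite exprMn -expRM_natl mulrN mulrA.
  have [] := @integral_ev _ _ R mu D a (fun t => x * expR (- t)) n
    (fun t => C * expR (`|L| * x) * n t) C L mD ba.
  - by move=> t /xe/andP[].
  - move=> j; under eq_fun do rewrite pw.
    exact: integrable_mull.
  - exact: integrable_mull.
  - move=> m t Dt; have /andP[h1 h2] := xe t Dt.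
    rewrite normrM [X in _ * X]ger0_norm ?n0// ler_wpM2r ?n0//.
    rewrite (le_trans (series_ev_le h1 ba m))// ler_wpM2l//.
      by have := ba 0%N; rewrite expr0 fact0 divr1 mulr1; apply: le_trans.
    rewrite ler_expR (le_trans (ler_wpM2r h1 (ler_norm L)))//.
    by rewrite ler_wpM2l.
  move=> iev cv; split => //.
  apply/cvg_lim => //.
  rewrite [X in X @ _ --> _](_ : _ = (fun m => w^-1 *
      series (fun j => a j * \int[mu]_(t in D) ((x * expR (- t)) ^+ j * n t)) m)).
    exact: (cvgM (cvg_cst _) cv).
  apply/funext => m; rewrite /series/= mulr_sumr; apply: eq_bigr => j _.
  under [in RHS]eq_Rintegral do rewrite pw.
  by rewrite RintegralZl//; ring.
split.
  move=> x y x0 xy; have y0 := le_trans x0 xy.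
  have [-> ix] := key x x0; have [-> iy] := key y y0.
  have h t : D t -> 0 <= ev a (x * expR (- t)) * n t <= ev a (y * expR (- t)) * n t.
    move=> Dt; have /andP[h1 h2] : 0 <= ev a (x * expR (- t)) <= ev a (y * expR (- t)).
      by apply: ia; rewrite ?mulr_ge0 ?expR_ge0// ler_wpM2r ?expR_ge0.
    by rewrite mulr_ge0 ?n0//= ler_wpM2r ?n0.
  apply/andP; split.
    by apply: mulr_ge0; [rewrite invr_ge0 ltW|apply: Rintegral_ge0 => t /h/andP[]].
  rewrite ler_wpM2l ?invr_ge0 ?(ltW w0)//; apply: le_Rintegral => //.
  by move=> t /h/andP[].
move=> x x0; have [-> ix] := key x x0; rewrite mul0r add0r subr0 mul1r.
rewrite mulrC ler_pdivrMr// /w -RintegralZl//; apply: le_Rintegral => //.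
  exact: integrable_mull.
move=> t Dt; rewrite ler_wpM2r ?n0//.
have /andP[_ ->] // : 0 <= ev a (x * expR (- t)) <= ev a (xi * x).
by apply: ia; rewrite ?mulr_ge0 ?expR_ge0// mulrC ler_wpM2r// Dxi.
Qed.

End contraction.

(** * Infinite divisibility behind the moment ratios *)

Section stirling_contraction.
Context {R : realType}.
Notation mu := (@lebesgue_measure R).

Lemma expR_sinh_ge (h : R) : 0 <= h -> 2 * h <= expR h - expR (- h).
Proof.
move=> h0; pose g (x : R) : R := expR x - expR (- (1 * x)) - 2 * x.
pose g' (x : R) : R := expR x + expR (- (1 * x)) - 2.
have dg (x : R) : is_derive x (1:R) g (g' x).
  have d := is_derive_expRM 1 x.
  by apply: is_derive_eq; rewrite /GRing.scale/= /g'; ring.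
have cg : {within `[0, h], continuous g}.
  by apply: continuous_subspaceT => x; exact: (cvg_is_derive (dg x)).
have [c _ e] := MVT_segment h0 (fun x _ => dg x) cg.
have g00 : g 0 = 0 by rewrite /g !mulr0 oppr0 expR0; lra.
rewrite g00 !subr0 in e.
suff : 0 <= g h by rewrite /g mul1r; lra.
rewrite e mulr_ge0// /g' mul1r.
have e0 := expR_gt0 c; have eN := expRxMexpNx_1 c.
have := sqr_ge0 (expR c - 1); rewrite expr2 => s.
by rewrite -(pmulr_rge0 _ e0) mulrBr mulrDr eN; lra.
Qed.

(** The inequality t <= 2 sinh (t / 2), multiplied by e^(t/2) and squared; it gives the sign of the
    derivative of [binet_psi]. *)
Lemma sqr_expR_le (t : R) : 0 < t -> t ^+ 2 * expR t <= (expR t - 1) ^+ 2.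
Proof.
move=> t0; have h0 : 0 <= t / 2 by rewrite divr_ge0// ltW.
have := expR_sinh_ge h0; rewrite mulrC divfK// => h.
have e0 := expR_gt0 (t / 2).
have E : expR t = expR (t / 2) ^+ 2 by rewrite -expRM_natl mulrC divfK.
have {}h : t * expR (t / 2) <= expR t - 1.
  have := ler_wpM2r (ltW e0) h; rewrite mulrBl expRN mulVf ?gt_eqF//.
  by rewrite E expr2.
rewrite [X in _ * X]E -exprMn lerXn2r ?nnegrE ?mulr_ge0 ?(ltW t0) ?(ltW e0)//.
by rewrite subr_ge0 -(expR0 R) ler_expR ltW.
Qed.

(** By [binet_densE] the densities at all scales share the factor 1 / t, so comparing two of them
    means comparing this function at two points. *)
Definition binet_psi (t : R) : R := t^-1 - (expR t - 1)^-1.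

Lemma binet_psi_le (v w : R) : 0 < v -> v <= w -> binet_psi w <= binet_psi v.
Proof.
move=> v0 vw.
have e0 (t : R) : 0 < t -> 0 < expR t - 1 by move=> t0; exact: lt_trans (expRB1_gt t0).
pose psi' (t : R) : R := - t ^- 2 + expR t / (expR t - 1) ^+ 2.
have dpsi (t : R) : 0 < t -> is_derive t (1:R) binet_psi (psi' t).
  move=> t0; have t0' : t != 0 by rewrite gt_eqF.
  have e0' : expR t - 1 != 0 by rewrite gt_eqF// e0.
  have d1 := @is_deriveV _ (fun t : R => t) t 1 1 t0' (is_derive_id _ _).
  have d0 : is_derive t (1:R) (fun t : R => expR t - 1) (expR t).
    by apply: is_derive_eq; rewrite /GRing.scale/=; ring.
  have d2 := @is_deriveV _ (fun t : R => expR t - 1) t _ 1 e0' d0.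
  by apply: is_derive_eq; rewrite /GRing.scale/= /psi'; field; rewrite t0' e0'.
have inv t : t \in `]v, w[ -> 0 < t.
  by rewrite in_itv/= => /andP[vt _]; exact: lt_trans vt.
have cpsi : {within `[v, w], continuous binet_psi}.
  apply: continuous_in_subspaceT => t; rewrite inE/= in_itv/= => /andP[vt _].
  by apply: (cvg_is_derive (dpsi _ _)); exact: lt_le_trans vt.
have [c cvw] := MVT_segment vw (fun t tvw => dpsi t (inv t tvw)) cpsi.
move=> h; rewrite -subr_le0 h mulr_le0_ge0 ?subr_ge0//.
have c0 : 0 < c by move: cvw; rewrite in_itv/= => /andP[vc _]; exact: lt_le_trans vc.
rewrite /psi' addrC subr_le0 ler_pdivrMr ?exprn_gt0 ?e0// mulrC ler_pdivlMr ?exprn_gt0//.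
by rewrite mulrC sqr_expR_le.
Qed.

Lemma binet_densE (a t : R) : 0 < a -> 0 < t -> binet_dens a t = binet_psi (t / a) / t.
Proof.
move=> a0 t0; rewrite /binet_dens /binet_kernel /binet_psi.
have ta0 : 0 < t / a by rewrite divr_gt0.
have e0 : 0 < expR (t / a) - 1 by exact: lt_trans (expRB1_gt ta0).
by field; rewrite !gt_eqF.
Qed.

Lemma integrable_binet (a z : R) : 0 < a -> 0 <= z ->
  mu.-integrable (`]0%R, +oo[%classic : set R) (EFin \o (fun t => (1 - expR (- (z * (t / a)))) * binet_dens a t)) /\
  \int[mu]_(t in `]0%R, +oo[) ((1 - expR (- (z * (t / a)))) * binet_dens a t) = stirling z.
Proof.
move=> a0 z0; have fin := binetE_fin a0 z0.
have e := stirling_binet a0 z0.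
split; last by rewrite /Rintegral -[X in fine X]/(binetE a z) -e.
apply/integrableP; split.
  apply/measurable_EFinP/measurable_funTS; apply: measurable_funM; last exact: measurable_binet_dens.
  apply: measurable_funB => //; do 2 apply: measurableT_comp => //.
  by apply: measurable_funM => //; exact: measurable_funM.
rewrite (_ : (\int[mu]_(t in _) _)%E = binetE a z); first by rewrite ltey_eq fin.
apply: eq_integral => t; rewrite pos_itv => t0.
rewrite gee0_abs// lee_fin mulr_ge0 ?binet_dens_ge0// subr_ge0 expR_le1 oppr_le0.
by rewrite mulr_ge0// divr_ge0// ltW.
Qed.

Section alpha.
Variable alpha : R.
Hypothesis alpha0 : 0 < alpha.
Hypothesis alpha1 : alpha < 1.

(** The Levy density of T; it is nonnegative because [binet_psi] decreases and t <= t / alpha. *)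
Let n (t : R) : R := binet_dens 1 t - binet_dens alpha t.

Let n_ge0 t : 0 < t -> 0 <= n t.
Proof.
move=> t0; rewrite subr_ge0 !binet_densE// ler_pM2r ?invr_gt0// divr1.
by rewrite binet_psi_le// ler_pdivlMr// ler_piMr// ltW.
Qed.

(** As e^t - 1 >= t^2 / 2, the two values of [binet_psi] differ by at least (1 - alpha) / t - 2 /
    t^2, and beyond 4 / (1 - alpha) the second term is at most half the first. *)
Let n_lb t : 4 / (1 - alpha) <= t -> (1 - alpha) / 2 / t ^+ 2 <= n t.
Proof.
move=> lt; have a10 : 0 < 1 - alpha by rewrite subr_gt0.
have t0 : 0 < t by rewrite (lt_le_trans _ lt)// divr_gt0.
rewrite /n !binet_densE// divr1 /binet_psi invf_div.
have ta0 : 0 < t / alpha by rewrite divr_gt0.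
have e1 : 0 < expR t - 1 by exact: lt_trans (expRB1_gt t0).
have e2 : 0 < (expR (t / alpha) - 1)^-1 by rewrite invr_gt0; exact: lt_trans (expRB1_gt ta0).
have e3 : (expR t - 1)^-1 <= 2 / t ^+ 2.
  rewrite -[2 / _]invf_div lef_pV2 ?posrE ?divr_gt0 ?exprn_gt0//.
  by have := @expR_ge1Dxn R t 1 (ltW t0); rewrite lerBrDl.
have e4 : 2 / t ^+ 2 <= (1 - alpha) / 2 / t.
  rewrite ler_pdivrMr ?exprn_gt0// expr2 mulrA divfK ?gt_eqF//.
  by move: lt; rewrite ler_pdivrMr//; lra.
rewrite expr2 invfM mulrA -mulrBl ler_pM2r ?invr_gt0//.
have e5 := le_trans e3 e4; move: e5 e2.
by set u := t^-1; set v := (expR t - 1)^-1; set w := (_ - 1)^-1; lra.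
Qed.

Let mn (D : set R) : measurable_fun D n.
Proof. by apply: measurable_funTS; apply: measurable_funB; exact: measurable_binet_dens. Qed.

Let g (j : nat) (t : R) := (1 - expR (- (j%:R * t))) * n t.

Let g_int j : mu.-integrable (`]0%R, +oo[%classic : set R) (EFin \o g j) /\
  \int[mu]_(t in `]0%R, +oo[) g j t = stirling j%:R - stirling (alpha * j%:R).
Proof.
have aj0 : 0 <= alpha * j%:R by rewrite mulr_ge0// ltW.
have [i1 <-] := integrable_binet ltr01 (ler0n R j).
have [i2 <-] := integrable_binet alpha0 aj0.
have E : g j = (fun t => (1 - expR (- (j%:R * (t / 1)))) * binet_dens 1 t -
    (1 - expR (- (alpha * j%:R * (t / alpha)))) * binet_dens alpha t).
  apply/funext => t; rewrite /g /n mulrBr divr1.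
  by rewrite (_ : alpha * j%:R * (t / alpha) = j%:R * t)//; field; rewrite gt_eqF.
rewrite E; split; last by rewrite RintegralB.
exact: integrable_subR.
Qed.

Let g_ge0 j t : 0 < t -> 0 <= g j t <= n t.
Proof.
move=> t0; have e1 : expR (- (j%:R * t)) <= 1.
  by rewrite expR_le1 oppr_le0 mulr_ge0// ltW.
by rewrite mulr_ge0 ?n_ge0 ?subr_ge0//= ler_piMl ?n_ge0// lerBlDr lerDl.
Qed.

Let mg j (D : set R) : measurable_fun D (g j).
Proof.
apply: measurable_funM; last exact: mn.
apply: measurable_funB => //; apply: measurable_funTS.
by do 2 apply: measurableT_comp => //.
Qed.

(** Away from 0 the factor 1 - e^(-t) is bounded below, so the integrability of [g 1], known from
    Binet's formula, passes to [n]. *)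
Let n_int (D : set R) (e : R) : measurable D -> 0 < e -> D `<=` `[e, +oo[ ->
  mu.-integrable D (EFin \o n).
Proof.
move=> mD e0 De.
have De' t : D t -> e <= t by move=> /De; rewrite /= in_itv/= andbT.
have sub : D `<=` `]0%R, +oo[%classic.
  by move=> t /De'; rewrite /= in_itv/= andbT; exact: lt_le_trans.
have ee : 0 < 1 - expR (- e) by rewrite subr_gt0 expR_lt1 oppr_lt0.
have i1 : mu.-integrable D (EFin \o (fun t => (1 - expR (- e))^-1 * g 1 t)).
  apply: integrable_mull => //; apply: integrableS (g_int 1).1 => //.
apply: le_integrable i1 => //; first by apply/measurable_EFinP; exact: mn.
move=> t Dt; have t0 := lt_le_trans e0 (De' t Dt).
have /andP[g0 g1] := g_ge0 1 t0.
have h0 : 0 <= (1 - expR (- e))^-1 * g 1 t by apply: mulr_ge0 => //; rewrite invr_ge0 ltW.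
rewrite lee_fin ger0_norm ?n_ge0// (ger0_norm h0).
rewrite mulrC ler_pdivlMr// mulrC ler_wpM2r ?n_ge0// lerD2l lerN2 ler_expR lerN2.
by rewrite mul1r De'.
Qed.

(** The Levy measure restricted to [D] has finite mass, so it yields a compound Poisson product,
    with factors e^(-t) at most e^(-e). *)
Let contracts_levy (D : set R) (e : R) : measurable D -> 0 < e -> D `<=` `[e, +oo[ ->
  contracts (expR (- \int[mu]_(t in D) n t)) (expR (- e)) (fun j => expR (- \int[mu]_(t in D) g j t)).
Proof.
move=> mD e0 De; have iN := n_int mD e0 De.
have D0 t : D t -> 0 < t.
  by move=> /De; rewrite /= in_itv/= andbT; exact: lt_le_trans.
have xi01 : 0 <= expR (- e) <= 1 by rewrite expR_ge0 expR_le1 oppr_le0 ltW.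
have ij j : mu.-integrable D (EFin \o (fun t => expR (- (j%:R * t)) * n t)).
  apply: le_integrable iN => //.
    apply/measurable_EFinP; apply: measurable_funM; last exact: mn.
    apply: measurable_funTS.
    by do 2 apply: measurableT_comp => //.
  move=> t Dt; have t0 := D0 t Dt.
  rewrite lee_fin !ger0_norm ?mulr_ge0 ?expR_ge0 ?n_ge0//.
  by rewrite ler_piMl ?n_ge0// expR_le1 oppr_le0 mulr_ge0// ltW.
have gE j : \int[mu]_(t in D) g j t =
    \int[mu]_(t in D) n t - \int[mu]_(t in D) (expR (- (j%:R * t)) * n t).
  rewrite -RintegralB//; apply: eq_Rintegral => t _.
  by rewrite /g mulrBl mul1r.
have igD j : mu.-integrable D (EFin \o g j).
  apply: integrableS (g_int j).1 => //.
  by move=> t /D0; rewrite /= in_itv/= andbT.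
have w0 : 0 <= \int[mu]_(t in D) n t by apply: Rintegral_ge0 => t /D0; exact: n_ge0.
(* A zero mass cannot be normalised; then every [g j] integrates to 0 as well and V is 1. *)
move: w0; rewrite le_eqVlt => /predU1P[w0|w0].
  rewrite -w0 oppr0 expR0 (_ : (fun j => _) = fun=> 1); first exact: contracts_cst1.
  apply/funext => j; rewrite (_ : \int[mu]_(t in D) g j t = 0) ?oppr0 ?expR0//.
  apply/eqP; rewrite eq_le; apply/andP; split.
    by rewrite w0; apply: le_Rintegral => // t /D0/(g_ge0 j)/andP[].
  by apply: Rintegral_ge0 => t /D0/(g_ge0 j)/andP[].
have := contracts_expR (ltW w0) xi01 (contracts_integral mD _ _ _ _ iN w0).
rewrite (_ : (fun j => expR (- (_ * (1 - _ / _)))) = (fun j => expR (- \int[mu]_(t in D) g j t))).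
  apply => //.
  - by move=> t /D0; rewrite /= in_itv/= andbT.
  - by move=> t /De; rewrite /= in_itv/= andbT ler_expR lerN2.
  - by move=> t /D0; exact: n_ge0.
apply/funext => j; rewrite gE; congr (expR (- _)).
by field; rewrite gt_eqF.
Qed.

(** V is factored by the size of the jumps of T. Those beyond l give [xi] = e^(-l) and [p] = e^(-w),
    the probability that none occurs; the smaller ones contribute a factor in [0, 1]. *)
Lemma contracts_stirling : exists p xi, [/\ 0 <= p < 1, 0 <= xi <= 1 / 3 &
  contracts p xi (fun j => expR (stirling (alpha * j%:R) - stirling j%:R))].
Proof.
have a10 : 0 < 1 - alpha by rewrite subr_gt0.
(* The threshold of [n_lb], which makes w positive; being at least 4, it also gives e^(-l) <= 1 / (1
   + l) <= 1 / 3. *)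
pose l := 4 / (1 - alpha); have l4 : 4 <= l by rewrite ler_pdivlMr//; have := alpha0; lra.
have l0 : 0 < l by rewrite (lt_le_trans _ l4).
pose DL := (`[l, +oo[%classic : set R).
have mDL : measurable DL by exact: measurable_itv.
have cL := contracts_levy mDL l0 (@subset_refl _ _).
set w := \int[mu]_(t in DL) n t in cL.
have w0 : 0 < w.
  have iN := n_int mDL l0 (@subset_refl _ _).
  have sub : (`[l, l + 1]%classic : set R) `<=` DL.
    by move=> t; rewrite /DL/= !in_itv/= andbT => /andP[].
  have c0 : 0 < (1 - alpha) / 2 / (l + 1) ^+ 2 by rewrite !divr_gt0// exprn_gt0// addr_gt0.
  rewrite -lte_fin /w /Rintegral fineK; last exact: integrable_fin_num iN.
  apply: (@lt_le_trans _ _ (\int[mu]_(t in `[l, (l + 1)%R]) ((1 - alpha) / 2 / (l + 1) ^+ 2)%:E)%E).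
    rewrite integral_cst//= lebesgue_measure_itv/= lte_fin ltrDl ltr01.
    by rewrite -EFinB -EFinM lte_fin addrAC subrr add0r mulr1.
  apply: (@le_trans _ _ (\int[mu]_(t in `[l, (l + 1)%R]) (n t)%:E)%E).
    apply: ge0_le_integral => //.
    - by move=> t _; rewrite lee_fin ltW.
    - by apply/measurable_EFinP; exact: mn.
    - move=> t; rewrite /= in_itv/= => /andP[lt tl]; rewrite lee_fin.
      rewrite (le_trans _ (n_lb lt))// ler_pM2l ?divr_gt0// lef_pV2 ?posrE ?exprn_gt0 ?(lt_le_trans l0 lt) ?addr_gt0//.
      by rewrite lerXn2r ?nnegrE ?addr_ge0 ?(ltW l0) ?(le_trans (ltW l0) lt).
  apply: ge0_subset_integral => //; first by apply/measurable_EFinP; exact: mn.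
  move=> t; rewrite /DL/= in_itv/= andbT => lt.
  by rewrite lee_fin n_ge0// (lt_le_trans l0 lt).
pose Ds := (`]0%R, l[%classic : set R).
have mDs : measurable Ds by exact: measurable_itv.
have igs j (D : set R) : measurable D -> D `<=` `]0%R, +oo[ -> mu.-integrable D (EFin \o g j).
  by move=> mD sD; apply: integrableS (g_int j).1.
have subs : Ds `<=` `]0%R, +oo[ by move=> t; rewrite /Ds/= !in_itv/= andbT => /andP[].
(* [contracts_levy] needs a distance from 0, so the small jumps are obtained as the limit of the
   cuts at 1 / (m + 1). *)
have cs : contracts 1 1 (fun j => expR (- \int[mu]_(t in Ds) g j t)).
  pose Dm (m : nat) := (`[m.+1%:R^-1, l[%classic : set R).
  have mDm m : measurable (Dm m) by exact: measurable_itv.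
  have pm m : 0 < m.+1%:R^-1 :> R by rewrite invr_gt0.
  apply: (@contracts_lim _ _ _ (fun m j => expR (- \int[mu]_(t in Dm m) g j t))); first exact: ler01.
    move=> m; have sDm : Dm m `<=` `[m.+1%:R^-1, +oo[.
      by move=> t; rewrite /Dm/= !in_itv/= andbT => /andP[].
    apply: contracts1 (contracts_levy (mDm m) (pm m) sDm).
      rewrite expR_ge0 expR_le1 oppr_le0; apply: Rintegral_ge0 => t /sDm.
      by rewrite /= in_itv/= andbT => mt; rewrite n_ge0// (lt_le_trans (pm m) mt).
    by rewrite expR_ge0 expR_le1 oppr_le0 ltW.
  move=> j; have : \int[mu]_(t in Dm m) g j t @[m --> \oo] --> \int[mu]_(t in Ds) g j t.
    have hm m : measurable_fun Ds (g j \_ (Dm m)).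
      by apply/(measurable_restrict _ _ _).1; [exact: mDm|exact: mDs|exact: mg].
    have hc t : Ds t -> (g j \_ (Dm m)) t @[m --> \oo] --> g j t.
      rewrite /Ds/= in_itv/= => /andP[t0 tl].
      apply: cvg_near_cst; near=> m.
      have h1 : t^-1 <= m%:R by near: m; exact: nbhs_infty_ger.
      rewrite patchE mem_set// /Dm/= in_itv/= tl andbT.
      by rewrite invf_ple ?posrE// (le_trans h1)// ler_nat.
    have hb m t : Ds t -> `|(g j \_ (Dm m)) t| <= g j t.
      rewrite /Ds/= in_itv/= => /andP[t0 _]; have /andP[h1 h2] := g_ge0 j t0.
      by rewrite patchE; case: ifPn => _; rewrite ?normr0// ger0_norm.
    have [_ cv] := @Rdominated_convergence _ _ R mu Ds _ _ _ mDs hm hc (igs j Ds mDs subs) hb.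
    move: cv; under eq_fun do rewrite -Rintegral_mkcondr.
    rewrite (_ : (fun m => \int[mu]_(t in (Ds `&` Dm m)) g j t) = (fun m => \int[mu]_(t in Dm m) g j t))//.
    apply/funext => m; congr (Rintegral _ _ _); apply/setIidr => t.
    rewrite /Dm /Ds/= !in_itv/= => /andP[mt ->]; rewrite andbT.
    exact: lt_le_trans (pm m) mt.
  move=> cv.
  have cvN : (- \int[mu]_(t in Dm m) g j t) @[m --> \oo] --> - \int[mu]_(t in Ds) g j t by exact: cvgN.
  exact: (cvg_comp _ _ cvN (@continuous_expR R _)).
exists (expR (- w)), (expR (- l)); split.
- by rewrite expR_ge0 expR_lt1 oppr_lt0.
- rewrite expR_ge0/= expRN -[1 / 3]invf_div divr1 lef_pV2 ?posrE ?expR_gt0//.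
  by have := expR_ge1Dx l; lra.
have p01 : 0 <= expR (- w) <= 1 by rewrite expR_ge0 expR_le1 oppr_le0 ltW.
have := contractsM p01 (expR_ge0 (- l)) cs cL.
congr (contracts _ _ _); apply/funext => j; rewrite -expRD; congr expR.
have pos : (`]0%R, +oo[%classic : set R) = Ds `|` DL.
  apply/seteqP; split=> t; rewrite /Ds /DL/= !in_itv/= !andbT.
    by move=> t0; have [tl|lt] := ltP t l; [left; rewrite t0|right].
  by case=> [/andP[]//|]; exact: lt_le_trans.
have [gi ge] := g_int j.
rewrite -[stirling _ - _]opprB -ge pos Rintegral_setU//; last 2 first.
- by rewrite -pos.
- apply/disj_setPS => t; rewrite /Ds /DL/= !in_itv/= andbT => -[/andP[_ tl] lt].
  by have := lt_le_trans tl lt; rewrite ltxx.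
by rewrite opprD.
Unshelve. all: by end_near. Qed.

End alpha.
End stirling_contraction.

(** * The strict inequality a^a < Gamma(1+a) *)

Section gamma_lower_bound.
Context {R : realType}.
Notation mu := (@lebesgue_measure R).

Let dens (z t : R) : R := expR (- (z * t)) * ((1 - expR (- t)) * binet_kernel t).

Let dens_int z : 0 <= z ->
  mu.-integrable (`]0%R, +oo[%classic : set R) (EFin \o dens z) /\
  \int[mu]_(t in `]0%R, +oo[) dens z t = stirling_incr z.
Proof.
move=> z0; have := integral_stirling_incr ltr01 z0.
have E t : expR (- (z * (t / 1))) * ((1 - expR (- (t / 1))) * binet_dens 1 t) = dens z t.
  by rewrite /dens /binet_dens !divr1.
under eq_integral do rewrite E.
move=> e; split; last by rewrite /Rintegral e.
apply/integrableP; split.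
  apply/measurable_EFinP/measurable_funTS; apply: measurable_funM.
    by do 2 apply: measurableT_comp => //; exact: measurable_funM.
  apply: measurable_funM; last exact: measurable_binet_kernel.
  by apply: measurable_funB => //; do 2 apply: measurableT_comp => //.
rewrite (_ : (\int[mu]_(t in _) _)%E = (\int[mu]_(t in `]0%R, +oo[) (dens z t)%:E)%E).
  by rewrite e ltry.
apply: eq_integral => t; rewrite pos_itv => t0.
rewrite gee0_abs// lee_fin /dens mulr_ge0 ?expR_ge0// mulr_ge0 ?binet_kernel_ge0//.
by rewrite subr_ge0 expR_le1 oppr_le0 ltW.
Qed.

(** In terms of h the claim is h(a) > a h(1), a concavity: each 1 - e^(-z t) is concave in z. For
    strictness, the nonnegative concavity defect is weighted by 1 - e^(-t) <= 1; its integral then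
    consists of increments of h and equals a ln ((1 + a) / (2 a)) > 0. *)
Lemma powR_self_lt_gamma (a : R) : 0 < a -> a < 1 -> a `^ a < gamma a.
Proof.
move=> a0 a1.
suff h : a < stirling a.
  rewrite -ltr_ln ?posrE ?powR_gt0 ?gamma_gt0 ?(ltW a0)// ln_powR.
  by move: h; rewrite /stirling; lra.
have s1 : stirling 1 = 1 :> R.
  have -> : stirling 1 = ln (gamma 1) - 1 * ln 1 + 1 :> R by [].
  have -> : gamma 1 = 1 :> R by rewrite (@gamma_nat R 1).
  by rewrite ln1 mulr0 subr0 add0r.
have [i1 e1] := integrable_binet ltr01 (ltW a0).
have [i2 e2] := integrable_binet ltr01 (ler01 : 0 <= 1 :> R).
have [j0 d0] := dens_int (lexx 0).
have [ja da] := dens_int (ltW a0).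
have [j1 d1] := dens_int ler01.
have sub (f g : R -> R) : mu.-integrable (`]0%R, +oo[%classic : set R) (EFin \o f) ->
    mu.-integrable (`]0%R, +oo[%classic : set R) (EFin \o g) ->
    mu.-integrable (`]0%R, +oo[%classic : set R) (EFin \o (fun t => f t - g t)).
  by move=> fi gi; exact: integrable_subR.
have mull (c : R) (f : R -> R) : mu.-integrable (`]0%R, +oo[%classic : set R) (EFin \o f) ->
    mu.-integrable (`]0%R, +oo[%classic : set R) (EFin \o (fun t => c * f t)).
  by move=> fi; exact: integrable_mull.
have i2a := mull a _ i2; have j0a := sub _ _ j0 ja; have j01 := sub _ _ j0 j1.
have j01a := mull a _ j01; have k1 := sub _ _ i1 i2a; have k2 := sub _ _ j0a j01a.
have eL : \int[mu]_(t in `]0%R, +oo[) (dens 0 t - dens a t - a * (dens 0 t - dens 1 t)) =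
    stirling_incr 0 - stirling_incr a - a * (stirling_incr 0 - stirling_incr 1).
  by rewrite RintegralB// RintegralZl// !RintegralB// d0 da d1.
have eR : \int[mu]_(t in `]0%R, +oo[) ((1 - expR (- (a * (t / 1)))) * binet_dens 1 t -
    a * ((1 - expR (- (1 * (t / 1)))) * binet_dens 1 t)) = stirling a - a * stirling 1.
  by rewrite RintegralB// RintegralZl// e1 e2.
have : stirling_incr 0 - stirling_incr a - a * (stirling_incr 0 - stirling_incr 1) <=
    stirling a - a * stirling 1.
  rewrite -eL -eR.
  apply: le_Rintegral => // t; rewrite /= in_itv/= andbT => t0.
  rewrite /dens /binet_dens !divr1 mul0r oppr0 expR0 !mul1r.
  have k0 := binet_kernel_ge0 t0; set k := binet_kernel t in k0 *.
  have u0 := expR_gt0 (- t).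
  have := powR_bernoulli u0 (_ : 0 <= a <= 1); rewrite (ltW a0) (ltW a1) => /(_ isT).
  rewrite -expRM [- t * a]mulrC => h1.
  have -> : - (a * t) = a * - t by ring.
  have u1 : expR (- t) <= 1 by rewrite expR_le1 oppr_le0 ltW.
  move: u0 u1 h1; set u := expR (- t); set v := expR _ => u0 u1 h1.
  have g0 : 0 <= (1 - v) - a * (1 - u) by clear - h1; lra.
  have g1 := mulr_ge0 (mulr_ge0 g0 (ltW u0)) k0; clear - g1; lra.
rewrite /stirling_incr s1 ln1 !mul0r !mulr0 !mul1r => le_s.
have a10 : 0 < a + 1 by rewrite addr_gt0.
have gt_s : 0 < a * (ln (a + 1) - ln a - ln (1 + 1)).
  rewrite mulr_gt0// subr_gt0 -ln_div ?posrE// ltr_ln ?posrE ?divr_gt0//.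
  by rewrite ltr_pdivlMr//; clear - a0 a1; lra.
clear - le_s gt_s; lra.
Qed.

End gamma_lower_bound.

(** * From moments to tails *)

Section approximants.
Context {R : realType}.

Lemma exp_type_lin (c e : R) (a s : nat -> R) : exp_type a -> exp_type s ->
  exp_type (fun j => c * a j + e * s j).
Proof.
move=> [C1 [L1 b1]] [C2 [L2 b2]]; exists (`|c| * C1 + `|e| * C2), (`|L1| + `|L2|) => j.
have aux (C L : R) (b : nat -> R) : exp_bounded C L b -> `|L| <= `|L1| + `|L2| ->
    `|b j| <= C * ((`|L1| + `|L2|) ^+ j / j`!%:R).
  move=> bb LL; have C0 : 0 <= C.
    by have := bb 0%N; rewrite expr0 fact0 divr1 mulr1; exact: le_trans.
  rewrite (le_trans (bb j))// ler_wpM2l// ler_wpM2r ?invr_ge0//.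
  rewrite (le_trans (ler_norm _))// normrX.
  by rewrite lerXn2r ?nnegrE ?addr_ge0.
rewrite (le_trans (ler_normD _ _))// !normrM mulrDl -!mulrA lerD// ler_wpM2l//.
  by apply: aux => //; rewrite lerDl.
by apply: aux => //; rewrite lerDr.
Qed.

Lemma exp_bounded_expR (m : R) : exp_bounded 1 `|m| (fun j => m ^+ j / j`!%:R).
Proof. by move=> j; rewrite mul1r normrM normrX [X in _ * X]ger0_norm// invr_ge0. Qed.

Lemma ev_expR (m x : R) : ev (fun j => m ^+ j / j`!%:R) x = expR (m * x).
Proof.
apply/cvg_lim => //.
have -> : series (fun j => m ^+ j / j`!%:R * x ^+ j) = series (exp_coeff (m * x)).
  by apply/funext => n; apply: eq_bigr => j _; rewrite /exp_coeff/= exprMn mulrAC.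
exact: is_cvg_series_exp_coeff.
Qed.

Lemma ev_approx (N : R) (q : nat) : exists a, exp_type a /\
  forall x, 0 <= x -> ev a x = (1 - expR (- (N * x))) ^+ q.
Proof.
(* The extra factor e^(-m x) closes the induction: one more factor 1 - e^(-N x) is the difference of
   the cases m and m + N. *)
suff h (m : R) : exists a, exp_type a /\
    forall x, 0 <= x -> ev a x = expR (- (m * x)) * (1 - expR (- (N * x))) ^+ q.
  have [a [ta ea]] := h 0; exists a; split=> // x x0.
  by rewrite ea// mul0r oppr0 expR0 mul1r.
elim: q m => [|q ih] m.
  exists (fun j => (- m) ^+ j / j`!%:R); split.
    by exists 1, `|- m|; exact: exp_bounded_expR.
  by move=> x x0; rewrite ev_expR expr0 mulr1 mulNr.
have [a [ta ea]] := ih m; have [s [ts es]] := ih (m + N).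
exists (fun j => 1 * a j + (-1) * s j); split; first exact: exp_type_lin.
move=> x x0; rewrite evL// ea// es// exprS mulrDl opprD expRD; ring.
Qed.

Lemma approx_bounds (N x : R) (q : nat) : 0 <= N -> 0 <= x -> 0 <= (1 - expR (- (N * x))) ^+ q <= 1.
Proof.
move=> N0 x0; have e1 : expR (- (N * x)) <= 1 by rewrite expR_le1 oppr_le0 mulr_ge0.
by rewrite exprn_ge0 ?subr_ge0//= exprn_ile1 ?subr_ge0// gerBl expR_ge0.
Qed.

Lemma approx_increasing (N : R) (q : nat) a : 0 <= N ->
  (forall x, 0 <= x -> ev a x = (1 - expR (- (N * x))) ^+ q) -> increasing_ev a.
Proof.
move=> N0 ea x y x0 xy; have y0 := le_trans x0 xy; rewrite !ea//.
have /andP[-> _] := approx_bounds q N0 x0; apply: lerXn2r.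
- by rewrite nnegrE subr_ge0 expR_le1 oppr_le0 mulr_ge0.
- by rewrite nnegrE subr_ge0 expR_le1 oppr_le0 mulr_ge0.
by rewrite lerD2l lerN2 ler_expR lerN2 ler_wpM2l.
Qed.

End approximants.

Section moments.
Context d (T : measurableType d) (R : realType) (P : probability T R).

(** With nonnegative coefficients, monotone convergence turns a bound on the partial sums of moments
    into integrability. This is how exponential moments are reached from power moments. *)
Lemma integrable_ev_ge0 (b : nat -> R) (Y : T -> R) (C L K : R) :
  (forall j, 0 <= b j) -> exp_bounded C L b -> (forall t, 0 <= Y t) ->
  (forall j, P.-integrable [set: T] (EFin \o (fun t => Y t ^+ j))) ->
  (forall n, series (fun j => b j * \int[P]_t (Y t ^+ j)) n <= K) ->
  P.-integrable [set: T] (EFin \o (fun t => ev b (Y t))).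
Proof.
move=> b0 bb Y0 iY hK.
pose s n t := series (fun j => b j * Y t ^+ j) n.
have s0 n t : 0 <= s n t.
  by apply: sumr_ge0 => j _; rewrite mulr_ge0// exprn_ge0.
have is_ n : P.-integrable [set: T] (EFin \o s n) /\
    \int[P]_t (s n t) = series (fun j => b j * \int[P]_t (Y t ^+ j)) n.
  rewrite /s /series/=; elim: n => [|n [ih1 ih2]].
    have -> : (fun t => \sum_(0 <= k < 0) b k * Y t ^+ k) = cst 0.
      by apply/funext => t; rewrite big_nil.
    rewrite big_nil; split; first exact: integrable0.
    by rewrite /Rintegral integral0.
  have -> : (fun t => \sum_(0 <= k < n.+1) b k * Y t ^+ k) =
      (fun t => (\sum_(0 <= k < n) b k * Y t ^+ k) + b n * Y t ^+ n).
    by apply/funext => t; rewrite big_nat_recr.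
  have iZ : P.-integrable [set: T] (EFin \o (fun t => b n * Y t ^+ n)) by exact: integrable_mull.
  split; last by rewrite RintegralD// ih2 RintegralZl// big_nat_recr.
  by have := integrableD measurableT ih1 iZ; congr (_.-integrable _ _).
have ms n : measurable_fun [set: T] (s n).
  by apply/measurable_EFinP; exact: measurable_int (is_ n).1.
have cv t : s n t @[n --> \oo] --> ev b (Y t) by exact: cvg_ev (Y0 t) bb.
have mev : measurable_fun [set: T] (fun t => ev b (Y t)).
  by apply: (measurable_fun_cvg (h := s)) => // t _; exact: cv.
have ev0 t : 0 <= ev b (Y t).
  by apply: (cvgr_to_ge (cv t)); apply: nearW => n; exact: s0.
apply/integrableP; split; first exact/measurable_EFinP.
have -> : (\int[P]_t `|(EFin \o (fun t => ev b (Y t))) t|)%E = (\int[P]_t limn (fun n => (s n t)%:E))%E.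
  apply: eq_integral => t _ /=; rewrite ger0_norm//; apply/esym/cvg_lim => //.
  by apply: cvg_EFin; [by apply: nearW|exact: cv].
have mono t : {homo (fun n => (s n t)%:E) : n m / (n <= m)%N >-> (n <= m)%E}.
  apply/nondecreasing_seqP => n; rewrite lee_fin /s /series/= big_nat_recr//= lerDl.
  by rewrite mulr_ge0// exprn_ge0.
have := @cvg_monotone_convergence _ T R P [set: T] measurableT (fun n t => (s n t)%:E)
  (fun n => (measurable_EFinP _ _).2 (ms n)) (fun n t _ => s0 n t) (fun t _ n m => @mono t n m).
move=> cvI; apply: (@le_lt_trans _ _ K%:E); last by rewrite ltry.
apply: (cvge_to_le cvI); apply: nearW => n.
have -> : (\int[P]_t (s n t)%:E)%E = (\int[P]_t s n t)%:E.
  by rewrite /Rintegral fineK//; apply: integrable_fin_num => //; exact: (is_ n).1.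
by rewrite lee_fin (is_ n).2.
Qed.

End moments.

Section moment_comparison.
Context {R : realType}.

Lemma integral_ev1 d (T : measurableType d) (P : {measure set T -> \bar R}) (a : nat -> R)
    (Y g : T -> R) (C L : R) :
  exp_bounded C L a -> (forall t, 0 <= Y t) ->
  (forall j, P.-integrable [set: T] (EFin \o (fun t => Y t ^+ j))) ->
  P.-integrable [set: T] (EFin \o g) ->
  (forall n t, `|series (fun j => a j * Y t ^+ j) n| <= g t) ->
  P.-integrable [set: T] (EFin \o (fun t => ev a (Y t))) /\
  series (fun j => a j * \int[P]_t (Y t ^+ j)) @ \oo --> \int[P]_t (ev a (Y t)).
Proof.
move=> ba Y0 iY ig le_g.
have [|n t _|i1 cv] := @integral_ev _ T R P [set: T] a Y (cst 1) g C L measurableT ba (fun t _ => Y0 t) _ ig.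
- by move=> j; apply: eq_integrable (iY j) => // t _ /=; rewrite mulr1.
- by rewrite mulr1.
split; first by apply: eq_integrable i1 => // t _ /=; rewrite mulr1.
have e (f : T -> R) : \int[P]_t (f t * cst 1 t) = \int[P]_t f t.
  by apply: eq_Rintegral => t _; rewrite mulr1.
rewrite -[X in _ --> X]e; apply: cvg_trans cv; apply: near_eq_cvg; apply: nearW => n /=.
by apply: eq_bigr => j _; rewrite e.
Qed.

Lemma integrable_ev_le1 d (T : measurableType d) (P : probability T R) (V : T -> R)
    (a : nat -> R) (C L : R) :
  measurable_fun [set: T] V -> (forall t, 0 <= V t) -> exp_bounded C L a ->
  (forall x, 0 <= x -> 0 <= ev a x <= 1) ->
  P.-integrable [set: T] (EFin \o (fun t => ev a (V t))).
Proof.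
move=> mV V0 ba ev01; have mev : measurable_fun [set: T] (fun t => ev a (V t)).
  apply: (measurable_fun_cvg (h := fun n t => series (fun j => a j * V t ^+ j) n)) => //.
    move=> n; apply: measurable_sum => j; apply: measurable_funM => //.
    exact: measurable_funX.
  by move=> t _; exact: cvg_ev (V0 t) ba.
apply: (@le_integrable _ T R P [set: T] measurableT _ (EFin \o cst 1)).
- exact/measurable_EFinP.
- by move=> t _ /=; rewrite lee_fin normr1; have /andP[f0 f1] := ev01 _ (V0 t); rewrite ger0_norm.
- exact: finite_measure_integrable_cst.
Qed.

(** Term by term, E a(Y) is the sum of a_j r_j E W^j, that is E f(W) for f with coefficients r_j
    a_j, and the contraction bounds f pointwise. For Y the sums are dominated by C e^(|L| Y); for W,
    by the series with coefficients r_j b_j, whose moment sums are those of b(Y). *)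
Lemma moment_comparison d1 (T1 : measurableType d1) (P1 : probability T1 R)
    d2 (T2 : measurableType d2) (P2 : probability T2 R)
    (W : T1 -> R) (Y : T2 -> R) (r : nat -> R) (p xi : R) (a : nat -> R) :
  (forall t, 0 <= W t) -> (forall t, 0 <= Y t) -> 0 <= xi ->
  (forall j, P1.-integrable [set: T1] (EFin \o (fun t => W t ^+ j))) ->
  (forall j, P2.-integrable [set: T2] (EFin \o (fun t => Y t ^+ j))) ->
  (forall j, \int[P2]_t (Y t ^+ j) = r j * \int[P1]_t (W t ^+ j)) ->
  (forall l : R, 0 <= l -> P2.-integrable [set: T2] (EFin \o (fun t => expR (l * Y t)))) ->
  contracts p xi r -> exp_type a -> increasing_ev a ->
  (forall x, 0 <= x -> ev a x <= 1) ->
  \int[P2]_t (ev a (Y t)) <= p * \int[P1]_t (ev a (W t)) + (1 - p) * \int[P1]_t (ev a (xi * W t)).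
Proof.
move=> W0 Y0 xi0 iW iY mom iexp cr ta ia a1.
have [C [L ba]] := ta; have r01 := cr.1.
have C0 : 0 <= C.
  by have := ba 0%N; rewrite expr0 fact0 divr1 mulr1; exact: le_trans.
pose b j := C * (`|L| ^+ j / j`!%:R).
have b0 j : 0 <= b j by rewrite mulr_ge0// divr_ge0// exprn_ge0.
have bb : exp_bounded C `|L| b by move=> j; rewrite ger0_norm.
have ab j : `|a j| <= b j.
  apply: (le_trans (ba j)); rewrite ler_wpM2l// ler_wpM2r// ?invr_ge0//.
  by rewrite (le_trans (ler_norm _))// normrX.
have rb0 j : 0 <= r j * b j by have /andP[r0 _] := r01 j; rewrite mulr_ge0.
have iCe : P2.-integrable [set: T2] (EFin \o (fun t => C * expR (`|L| * Y t))).
  by apply: integrable_mull => //; exact: iexp.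
have b_le n t : series (fun j => b j * Y t ^+ j) n <= C * expR (`|L| * Y t).
  exact: le_trans (ler_norm _) (series_ev_le (Y0 t) bb n).
have [_ cvY] := @integral_ev1 _ T2 P2 a Y _ C `|L| (fun j => le_trans (ab j) (lexx _)) Y0 iY iCe
  (fun n t => series_ev_le (Y0 t) (fun j => le_trans (ab j) (lexx _)) n).
have [ib cvb] := @integral_ev1 _ T2 P2 b Y _ C `|L| bb Y0 iY iCe
  (fun n t => series_ev_le (Y0 t) bb n).
have bW : exp_bounded C `|L| (fun j => r j * b j) by exact: exp_bounded_mul.
have igW : P1.-integrable [set: T1] (EFin \o (fun t => ev (fun j => r j * b j) (W t))).
  apply: (@integrable_ev_ge0 _ T1 R P1 _ W C `|L| (\int[P2]_t ev b (Y t))) => // n.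
  have -> : series (fun j => r j * b j * \int[P1]_t (W t ^+ j)) n =
      series (fun j => b j * \int[P2]_t (Y t ^+ j)) n.
    by apply: eq_bigr => j _; rewrite mom; ring.
  have /cvg_lim <- // := cvb; apply: nondecreasing_cvgn_le.
    apply/nondecreasing_seqP => k; rewrite /series/= big_nat_recr//= lerDl.
    by rewrite mulr_ge0// Rintegral_ge0// => t _; rewrite exprn_ge0.
  by apply/cvg_ex; eexists; exact: cvb.
have bra : exp_bounded C `|L| (fun j => r j * a j) by apply: exp_bounded_mul => // j; exact: ab.
have le_W n t : `|series (fun j => r j * a j * W t ^+ j) n| <= ev (fun j => r j * b j) (W t).
  apply: (@le_trans _ _ (series (fun j => r j * b j * W t ^+ j) n)).
    rewrite /series/= (le_trans (ler_norm_sum _ _ _))// ler_sum// => j _.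
    rewrite !normrM (ger0_norm (exprn_ge0 _ (W0 t))) ler_wpM2r ?exprn_ge0//.
    by have /andP[r0 _] := r01 j; rewrite (ger0_norm r0) ler_wpM2l.
  have cv := cvg_ev (W0 t) bW; have /cvg_lim <- // := cv.
  apply: nondecreasing_cvgn_le; last by apply/cvg_ex; eexists; exact: cv.
  apply/nondecreasing_seqP => k; rewrite /series/= big_nat_recr//= lerDl.
  by rewrite mulr_ge0// exprn_ge0.
have [iraW cvW] := @integral_ev1 _ T1 P1 (fun j => r j * a j) W _ C `|L| bra W0 iW igW le_W.
have -> : \int[P2]_t ev a (Y t) = \int[P1]_t ev (fun j => r j * a j) (W t).
  have E : series (fun j => a j * \int[P2]_t (Y t ^+ j)) =
      series (fun j => r j * a j * \int[P1]_t (W t ^+ j)).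
    by apply/funext => n; apply: eq_bigr => j _; rewrite mom; ring.
  by rewrite E in cvY; exact: (cvg_unique _ cvY cvW).
have mW : measurable_fun [set: T1] W.
  by apply/measurable_EFinP; have /measurable_int := iW 1%N.
have ev01 x : 0 <= x -> 0 <= ev a x <= 1.
  by move=> x0; rewrite a1// andbT; have /andP[] := ia _ _ x0 (lexx _).
have iW1 := integrable_ev_le1 P1 mW W0 ba ev01.
have iWx : P1.-integrable [set: T1] (EFin \o (fun t => ev a (xi * W t))).
  by apply: integrable_ev_le1 ba ev01 => [|t]; [exact: measurable_funM|rewrite mulr_ge0].
rewrite -!RintegralZl// -RintegralD//; [|exact: integrable_mull..].
apply: le_Rintegral => //.
  by have := integrableD measurableT (integrable_mull p measurableT iW1)
    (integrable_mull (1 - p) measurableT iWx); congr (_.-integrable _ _).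
by move=> t _; exact: (cr.2 a ta ia).2.
Qed.

End moment_comparison.

Section tail_comparison.
Context {R : realType}.

(** With this exponent, (1 - e^(-N x))^q behaves like exp (- e^(N (b - x))), a step at b that
    sharpens as N grows. *)
Definition approx_exponent (N b : R) : nat := (Num.truncn (expR (N * b))).+1.

(** With u = e^(-N x) and y = e^(N (b - x)): (1 - u)^q <= e^(-q u) <= e^(-y) <= 1 / y. *)
Lemma approx_le (N b x : R) : 0 <= N -> 0 <= x ->
  (1 - expR (- (N * x))) ^+ approx_exponent N b <= expR (- (N * (b - x))).
Proof.
move=> N0 x0; set q := approx_exponent N b.
have qb : expR (N * b) <= q%:R by rewrite ltW// /q /approx_exponent truncnS_gt.
have e1 : expR (- (N * x)) <= 1 by rewrite expR_le1 oppr_le0 mulr_ge0.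
have h1 : 1 - expR (- (N * x)) <= expR (- expR (- (N * x))) by exact: expR_ge1Dx.
apply: (@le_trans _ _ (expR (- expR (- (N * x))) ^+ q)).
  by apply: lerXn2r => //; rewrite nnegrE ?expR_ge0// subr_ge0.
rewrite -expRM_natl.
set y := expR (N * (b - x)).
have y0 : 0 < y by exact: expR_gt0.
have qy : y <= q%:R * expR (- (N * x)).
  rewrite /y mulrBr expRD ler_wpM2r ?expR_ge0//.
apply: (@le_trans _ _ (expR (- y))); first by rewrite ler_expR mulrN lerN2.
rewrite [leRHS]expRN expRN -/y lef_pV2 ?posrE ?expR_gt0//.
by apply: le_trans (expR_ge1Dx y); rewrite lerDr.
Qed.

(** Bernoulli's inequality; the 2 absorbs the rounding of the exponent, since q <= e^(N b) + 1 <= 2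
    e^(N b) for b >= 0. *)
Lemma approx_ge (N b x : R) : 0 <= N -> 0 <= b -> 0 <= x ->
  1 - 2 * expR (- (N * (x - b))) <= (1 - expR (- (N * x))) ^+ approx_exponent N b.
Proof.
move=> N0 b0 x0; set q := approx_exponent N b.
have qb : q%:R <= expR (N * b) + 1.
  by rewrite /q /approx_exponent -natr1 lerD2r truncn_le ?expR_ge0.
have e1 : expR (- (N * x)) <= 1 by rewrite expR_le1 oppr_le0 mulr_ge0.
have bern (u : R) n : 0 <= u -> u <= 1 -> 1 - n%:R * u <= (1 - u) ^+ n.
  move=> u0 u1; elim: n => [|n ih]; first by rewrite mul0r subr0 expr0.
  rewrite exprS (le_trans _ (ler_wpM2l _ ih)) ?subr_ge0// -natr1.
  have h : 0 <= n%:R * u * u by rewrite !mulr_ge0.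
  nra.
apply: le_trans (bern _ q (expR_ge0 _) e1); rewrite lerD2l lerN2.
apply: (@le_trans _ _ (2 * expR (N * b) * expR (- (N * x)))).
  rewrite ler_wpM2r ?expR_ge0// (le_trans qb)// mulr_natl mulr2n lerD2l.
  by rewrite -expR0 ler_expR mulr_ge0.
by rewrite -mulrA -expRD ler_wpM2l// ler_expR; lra.
Qed.

Lemma cvg_expR_natM (e : R) : 0 < e -> expR (- (n%:R * e)) @[n --> \oo] --> 0.
Proof.
move=> e0; have -> : (fun n : nat => expR (- (n%:R * e))) = (fun n => expR (- e) ^+ n).
  by apply/funext => n; rewrite -mulrN expRM_natl.
by apply: cvg_expr; rewrite ger0_norm ?expR_ge0// expR_lt1; lra.
Qed.

Lemma Rintegral_indicM d (T : measurableType d) (P : probability T R) (A : set T) (c : R) :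
  measurable A -> P.-integrable [set: T] (EFin \o (fun t => c * \1_A t)) /\
    \int[P]_t (c * \1_A t) = c * fine (P A).
Proof.
move=> mA; have i1 : P.-integrable [set: T] (EFin \o \1_A).
  by apply: integrable_indic => //; rewrite (le_lt_trans (probability_le1 P mA)) ?ltry.
split; first exact: integrable_mull.
by rewrite RintegralZl// /Rintegral integral_indic// setIT.
Qed.

Lemma tail_comparison d1 (T1 : measurableType d1) (P1 : probability T1 R)
    d2 (T2 : measurableType d2) (P2 : probability T2 R)
    (W : T1 -> R) (Y : T2 -> R) (r : nat -> R) (p xi c e : R) :
  (forall t, 0 <= W t) -> (forall t, 0 <= Y t) -> 0 <= xi -> 0 <= p <= 1 ->
  (forall j, P1.-integrable [set: T1] (EFin \o (fun t => W t ^+ j))) ->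
  (forall j, P2.-integrable [set: T2] (EFin \o (fun t => Y t ^+ j))) ->
  (forall j, \int[P2]_t (Y t ^+ j) = r j * \int[P1]_t (W t ^+ j)) ->
  (forall l : R, 0 <= l -> P2.-integrable [set: T2] (EFin \o (fun t => expR (l * Y t)))) ->
  contracts p xi r -> 0 <= c -> c < e ->
  fine (P2 [set t | e <= Y t]) <=
    p * fine (P1 [set t | c < W t]) + (1 - p) * fine (P1 [set t | c < xi * W t]).
Proof.
move=> W0 Y0 xi0 /andP[p0 p1] iW iY mom iexp cr c0 ce.
have mW : measurable_fun [set: T1] W.
  by apply/measurable_EFinP; have /measurable_int := iW 1%N.
have mY : measurable_fun [set: T2] Y.
  by apply/measurable_EFinP; have /measurable_int := iY 1%N.
(* The step sits midway: it is at most [eps n] below c and at least 1 - 2 [eps n] above e. *)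
pose b := (c + e) / 2; pose delta := (e - c) / 2.
have b0 : 0 <= b by rewrite /b; lra.
have delta0 : 0 < delta by rewrite /delta; lra.
pose eps n := expR (- (n%:R * delta)).
have eps0 n : 0 <= eps n by exact: expR_ge0.
have upper (V : T1 -> R) a n : measurable_fun [set: T1] V -> (forall t, 0 <= V t) ->
    exp_type a -> (forall x, 0 <= x -> ev a x = (1 - expR (- (n%:R * x))) ^+ approx_exponent n%:R b) ->
    \int[P1]_t ev a (V t) <= fine (P1 [set t | c < V t]) + eps n.
  move=> mV V0 [C [L ba]] ea; pose A := [set t | c < V t].
  have mA : measurable A.
    rewrite (_ : A = V @^-1` `]c, +oo[%classic); last first.
      by apply/seteqP; split=> t /=; rewrite in_itv/= andbT.
    by rewrite -[X in measurable X]setTI; apply: mV.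
  have ev01 x : 0 <= x -> 0 <= ev a x <= 1 by move=> x0; rewrite ea// approx_bounds.
  have [iA eA] := Rintegral_indicM P1 1 mA.
  have ic : P1.-integrable [set: T1] (EFin \o cst (eps n)) by exact: finite_measure_integrable_cst.
  have -> : fine (P1 A) + eps n = \int[P1]_t (1 * \1_A t + eps n).
    rewrite RintegralD// eA mul1r Rintegral_cst//.
    by have := congr1 fine (probability_setT P1); rewrite /= => ->; rewrite mulr1.
  apply: le_Rintegral => //.
  - exact: integrable_ev_le1 ba ev01.
  - by have := integrableD measurableT iA ic; congr (_.-integrable _ _).
  move=> t _; rewrite mul1r indicE; case: (boolP (t \in A)) => tA.
    by have /andP[_ h] := ev01 _ (V0 t); rewrite (le_trans h)// lerDl.
  rewrite add0r ea// (le_trans (approx_le b _ (V0 t)))// /eps ler_expR lerN2 ler_wpM2l//.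
  have : V t <= c by rewrite leNgt; apply: contra tA => h; rewrite inE.
  by rewrite /b /delta; lra.
have main n : (1 - 2 * eps n) * fine (P2 [set t | e <= Y t]) <=
    p * (fine (P1 [set t | c < W t]) + eps n) +
    (1 - p) * (fine (P1 [set t | c < xi * W t]) + eps n).
  have [a [ta ea]] := @ev_approx R n%:R (approx_exponent n%:R b).
  have ev01 x : 0 <= x -> 0 <= ev a x <= 1 by move=> x0; rewrite ea// approx_bounds.
  apply: (@le_trans _ _ (\int[P2]_t ev a (Y t))).
    pose A := [set t | e <= Y t].
    have mA : measurable A.
      rewrite (_ : A = Y @^-1` `[e, +oo[%classic); last first.
        by apply/seteqP; split=> t /=; rewrite in_itv/= andbT.
      by rewrite -[X in measurable X]setTI; apply: mY.
    have [iA <-] := Rintegral_indicM P2 (1 - 2 * eps n) mA.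
    have [C [L ba]] := ta.
    apply: le_Rintegral => //; first exact: integrable_ev_le1 ba ev01.
    move=> t _; rewrite indicE; case: (boolP (t \in A)) => tA.
      rewrite mulr1 ea// (le_trans _ (approx_ge _ b0 (Y0 t)))//.
      rewrite lerD2l lerN2 ler_wpM2l// ler_expR lerN2 ler_wpM2l//.
      by have := set_mem tA; rewrite /A/= /b /delta; lra.
    by rewrite mulr0; have /andP[] := ev01 _ (Y0 t).
  apply: (le_trans (moment_comparison W0 Y0 xi0 iW iY mom iexp cr ta _ _)).
  - by apply: (@approx_increasing R n%:R (approx_exponent n%:R b)) => //.
  - by move=> x x0; have /andP[] := ev01 x x0.
  have q0 : 0 <= 1 - p by rewrite subr_ge0.
  rewrite lerD// ler_wpM2l//; apply: upper => //; first exact: measurable_funM.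
  by move=> t; rewrite mulr_ge0.
have cveps : eps n @[n --> \oo] --> (0 : R) by exact: cvg_expR_natM.
set u := fine _; set v := fine _; set w := fine _.
have cl : (1 - 2 * eps n) * u @[n --> \oo] --> (1 - 2 * 0) * u.
  by apply: cvgMl; apply: cvgB; [exact: cvg_cst|apply: cvgMr].
have cr' : p * (v + eps n) + (1 - p) * (w + eps n) @[n --> \oo] --> p * (v + 0) + (1 - p) * (w + 0).
  by apply: cvgD; apply: cvgMr; apply: cvgD => //; exact: cvg_cst.
have : (1 - 2 * 0) * u <= p * (v + 0) + (1 - p) * (w + 0).
  by apply: (ler_cvg_to cl cr'); apply: nearW => n; exact: main.
by rewrite mulr0 subr0 mul1r !addr0.
Qed.

End tail_comparison.

(** * The median of the Mittag-Leffler variable *)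

Section laws.
Context {R : realType}.

Lemma eq_in_law_expectation d1 (T1 : measurableType d1) (P1 : probability T1 R)
    (X1 : {RV P1 >-> R}) d2 (T2 : measurableType d2) (P2 : probability T2 R)
    (X2 : {RV P2 >-> R}) :
  eq_in_law P1 X1 P2 X2 -> ('E_P1[X1] = 'E_P2[X2])%E.
Proof.
move=> X12; rewrite unlock.
have ge0_eq (f : R -> \bar R) : measurable_fun [set: R] f -> (forall y, 0 <= f y)%E ->
    (\int[P1]_t f (X1 t) = \int[P2]_t f (X2 t))%E.
  move=> mf f0; transitivity (\int[distribution P1 X1]_y f y)%E.
    by rewrite ge0_integral_distribution.
  transitivity (\int[distribution P2 X2]_y f y)%E; last by rewrite ge0_integral_distribution.
  by apply: eq_measure_integral => A mA _; exact: X12.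
rewrite integralE [RHS]integralE; congr (_ - _)%E.
  have := ge0_eq (fun x => maxe x%:E 0%E); rewrite [funepos]unlock; apply.
    exact: measurable_maxe.
  by move=> y; rewrite le_max lexx orbT.
have := ge0_eq (fun x => maxe (- x)%:E 0%E); rewrite [funeneg]unlock; apply.
  by apply: measurable_maxe => //; apply/measurable_EFinP.
by move=> y; rewrite le_max lexx orbT.
Qed.

Lemma ae_eq_in_law d (T : measurableType d) (P : probability T R) (X1 X2 : T -> R) :
  measurable_fun [set: T] X1 -> measurable_fun [set: T] X2 ->
  {ae P, forall t, X1 t = X2 t} -> eq_in_law P X1 P X2.
Proof.
move=> m1 m2 X12 A mA; rewrite /pushforward.
have mp (X : T -> R) : measurable_fun [set: T] X -> measurable (X @^-1` A).
  by move=> mX; rewrite -[_ @^-1` _]setTI; exact: mX.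
rewrite -[X1 @^-1` A]setIT -[X2 @^-1` A]setIT -!integral_indic//; [|exact: mp..].
apply: ge0_ae_eq_integral => //.
- by apply/measurable_EFinP; apply: measurable_indic; exact: mp.
- by apply/measurable_EFinP; apply: measurable_indic; exact: mp.
- apply: filterS X12 => t e _; rewrite !indicE (_ : (t \in X1 @^-1` A) = (t \in X2 @^-1` A))//.
  by apply/idP/idP; rewrite !inE /= e.
Qed.

End laws.

Section stable_moments.
Context d (T : measurableType d) (R : realType) (P : probability T R).
Variables (alpha : R) (Z : T -> R).
Hypothesis alpha0 : 0 < alpha.
Hypothesis mZ : measurable_fun [set: T] Z.
Hypothesis Z0 : forall t, 0 < Z t.
Hypothesis LZ : forall l : R, 0 <= l ->
  (\int[P]_t (expR (- (l * Z t)))%:E = (expR (- (l `^ alpha)))%:E)%E.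

Let W t := Z t `^ (- alpha).

Let W0 t : 0 <= W t. Proof. exact: powR_ge0. Qed.

Lemma measurable_mittag_leffler : measurable_fun [set: T] W.
Proof. exact: (@measurableT_comp _ _ _ _ _ _ (fun x => x `^ (- alpha))). Qed.

Lemma mittag_leffler_moment n :
  P.-integrable [set: T] (EFin \o (fun t => W t ^+ n)) /\
  \int[P]_t (W t ^+ n) = n`!%:R / gamma (alpha * n%:R).
Proof.
have g0 : 0 < gamma (alpha * n%:R) by rewrite gamma_gt0// mulr_ge0// ltW.
have eI : (\int[P]_t (W t ^+ n)%:E = (n`!%:R / gamma (alpha * n%:R))%:E)%E.
  have := stable_moment n alpha0 mZ Z0 LZ => /(congr1 (fun x => (gamma (alpha * n%:R))^-1%:E * x)%E).
  by rewrite muleA -!EFinM mulVf ?gt_eqF// mul1e mulrC.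
split; last by rewrite /Rintegral eI.
apply/integrableP; split.
  by apply/measurable_EFinP; apply: measurable_funX; exact: measurable_mittag_leffler.
under eq_integral do rewrite /= ger0_norm ?exprn_ge0//.
by rewrite eI ltry.
Qed.

End stable_moments.

Section log_S_moments.
Context d (T : measurableType d) (R : realType) (P : probability T R).
Variable X : T -> R.
Hypothesis XP : log_S_law P X.
Hypothesis mX : measurable_fun [set: T] X.

Lemma integrable_expRM (s : R) : 0 < s ->
  P.-integrable [set: T] (EFin \o (fun t => expR (s * X t))) /\
  \int[P]_t expR (s * X t) = expR (s * ln s - s).
Proof.
move=> s0; have eI := expect_expR XP mX s0; split; last by rewrite /Rintegral eI.
apply/integrableP; split.
  by apply/measurable_EFinP; apply: measurableT_comp => //; exact: measurable_funM.
under eq_integral do rewrite /= ger0_norm ?expR_ge0//.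
by rewrite eI ltry.
Qed.

(** E e^(S/2) is the sum of 2^(-j) j^j e^(-j) / j!, and j^j / j! <= e^j as a single term of the
    exponential series: a geometric series dominates. *)
Lemma integrable_expR_half : P.-integrable [set: T] (EFin \o (fun t => expR (2^-1 * expR (X t)))).
Proof.
have Xn j t : expR (X t) ^+ j.+1 = expR (j.+1%:R * X t) by rewrite expRM_natl.
have := @integrable_ev_ge0 _ T R P (fun j => 2^-1 ^+ j / j`!%:R) (fun t => expR (X t)) 1 `|2^-1| 2 _
  (exp_bounded_expR 2^-1) (fun t => expR_ge0 _).
move=> h; have {}h : P.-integrable [set: T] (EFin \o (fun t => ev (fun j => 2^-1 ^+ j / j`!%:R) (expR (X t)))).
  apply: h => [j|[|j]|n].
  - by rewrite divr_ge0// exprn_ge0// invr_ge0.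
  - have -> : (fun t => expR (X t) ^+ 0) = cst 1 by apply/funext => t; rewrite expr0.
    exact: finite_measure_integrable_cst.
  - under eq_fun do rewrite Xn.
    exact: (integrable_expRM _).1.
  apply: (@le_trans _ _ (series (geometric 1 2^-1) n)); last first.
    have z1 : 2^-1 != 1 :> R by rewrite lt_eqF//; lra.
    rewrite geometric_seriesE// -[leLHS]/(1 * (1 - 2^-1 ^+ n) / (1 - 2^-1)) mul1r.
    rewrite ler_pdivrMr; last lra.
    have : 0 <= 2^-1 ^+ n :> R by rewrite exprn_ge0// invr_ge0.
    lra.
  apply: ler_sum => -[|j] _ /=.
    have -> : (fun t => expR (X t) ^+ 0) = cst 1 by apply/funext => t; rewrite expr0.
    rewrite Rintegral_cst// expr0 fact0 divr1 !mul1r.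
    by have := congr1 fine (probability_setT P); rewrite /= => ->.
  under [X in _ * X]eq_Rintegral do rewrite Xn.
  have j0 : 0 < j.+1%:R :> R by rewrite ltr0n.
  rewrite (integrable_expRM j0).2 mul1r -[leRHS]mulr1 -mulrA ler_wpM2l ?exprn_ge0 ?invr_ge0//.
  have f0 : 0 < j.+1`!%:R :> R by rewrite ltr0n fact_gt0.
  rewrite mulrC ler_pdivrMr// mul1r expRB expRM_natl lnK ?posrE//.
  rewrite ler_pdivrMr ?expR_gt0// mulrC -ler_pdivrMr//.
  by apply: le_trans (expR_ge1Dxn j (ltW j0)); rewrite lerDr.
by apply: eq_integrable h => // t _ /=; rewrite ev_expR.
Qed.

(** As s < 1, S^s is at most eps S plus a constant for every eps > 0, which reduces each exponential
    moment of S^s to that of S / 2. *)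
Lemma integrable_expR_powS (l k s : R) : 0 <= l -> 0 <= k -> 0 < s -> s < 1 ->
  P.-integrable [set: T] (EFin \o (fun t => expR (l * (k * expR (s * X t))))).
Proof.
(* [eps] is chosen for l k eps <= 1 / 2, the + 1 covering l k = 0; [m] below is the point from which
   e^(s x) <= eps e^x. *)
move=> l0 k0 s0 s1; pose eps := (2 * (l * k + 1))^-1.
have lk : 0 <= l * k by rewrite mulr_ge0.
have eps0 : 0 < eps by rewrite invr_gt0; lra.
pose m := - (ln eps / (1 - s)).
have me : expR (- ((1 - s) * m)) = eps.
  by rewrite /m mulrN opprK mulrC divfK ?lnK// gt_eqF// subr_gt0.
have bound x : expR (s * x) <= eps * expR x + expR (s * m).
  have [xm|mx] := leP x m.
    have := expR_ge0 x; have : expR (s * x) <= expR (s * m) by rewrite ler_expR ler_pM2l.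
    nra.
  have : expR (s * x) <= eps * expR x.
    rewrite -me -expRD ler_expR; nra.
  have := expR_ge0 (s * m); lra.
have lk_eps : l * k * eps <= 2^-1.
  by rewrite /eps invfM mulrCA -[leRHS]mulr1 ler_wpM2l ?invr_ge0// ler_pdivrMr; lra.
apply: (@le_integrable _ T R P [set: T] measurableT _
  (EFin \o (fun t => expR (l * k * expR (s * m)) * expR (2^-1 * expR (X t))))).
- apply/measurable_EFinP; do 4 (apply: measurableT_comp => //).
  exact: measurable_funM.
- move=> t _ /=; rewrite lee_fin !ger0_norm ?mulr_ge0 ?expR_ge0// -expRD ler_expR mulrA.
  have := bound (X t); have := expR_ge0 (X t); nra.
- by apply: integrable_mull => //; exact: integrable_expR_half.
Qed.

End log_S_moments.

Section median_comparison.
Context {R : realType}.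

Lemma mittag_leffler_tail (alpha : R) d0 (T0 : measurableType d0) (P0 : probability T0 R)
    (Z : T0 -> R) d2 (T2 : measurableType d2) (P2 : probability T2 R) (X : T2 -> R) (mS : R) :
  0 < alpha -> alpha < 1 -> measurable_fun [set: T0] Z -> (forall t, 0 < Z t) ->
  (forall l : R, 0 <= l -> (\int[P0]_t (expR (- (l * Z t)))%:E = (expR (- (l `^ alpha)))%:E)%E) ->
  log_S_law P2 X -> measurable_fun [set: T2] X ->
  P2 [set t | mS <= expR (X t)] = (2^-1)%:E -> 1 - mS <= alpha ->
  2^-1 < fine (P0 [set t | (gamma alpha)^-1 < Z t `^ (- alpha)]).
Proof.
move=> a0 a1 mZ Z0 LZ XP mX PS hm.
pose beta := 1 - alpha; have b0 : 0 < beta by rewrite /beta; lra.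
(* Chosen so that [Y t] is alpha^(-alpha) (S / beta)^beta. *)
pose c0 := - alpha * ln alpha - beta * ln beta.
pose W t := Z t `^ (- alpha).
pose Y t := expR (c0 + beta * X t).
have [p [xi [/andP[p0 p1] /andP[xi0 xi3] cr]]] := contracts_stirling a0 a1.
have W0 t : 0 <= W t by exact: powR_ge0.
have mW : measurable_fun [set: T0] W by exact: measurable_mittag_leffler.
have iW j : P0.-integrable [set: T0] (EFin \o (fun t => W t ^+ j)).
  exact: (mittag_leffler_moment a0 mZ Z0 LZ j).1.
have Yj j : (fun t => Y t ^+ j.+1) = (fun t => expR (j.+1%:R * c0) * expR (j.+1%:R * beta * X t)).
  by apply/funext => t; rewrite -expRM_natl -expRD; congr expR; ring.
have jb j : 0 < j.+1%:R * beta by rewrite mulr_gt0// ltr0n.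
have Y00 : (fun t => Y t ^+ 0) = cst 1 by apply/funext => t; rewrite expr0.
have iY j : P2.-integrable [set: T2] (EFin \o (fun t => Y t ^+ j)).
  case: j => [|j]; first by rewrite Y00; exact: finite_measure_integrable_cst.
  by rewrite Yj; apply: integrable_mull => //; exact: (integrable_expRM XP mX (jb j)).1.
have mom j : \int[P2]_t (Y t ^+ j) =
    expR (stirling (alpha * j%:R) - stirling j%:R) * \int[P0]_t (W t ^+ j).
  rewrite (mittag_leffler_moment a0 mZ Z0 LZ j).2; case: j => [|j].
    rewrite mulr0 subrr expR0 (@gamma_nat R 0) Y00 Rintegral_cst// fact0 divff// mulr1.
    by have := congr1 fine (probability_setT P2); rewrite /= => ->; rewrite mulr1.
  have [i e] := integrable_expRM XP mX (jb j).
  rewrite Yj RintegralZl// e.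
  have j0 : 0 < j.+1%:R :> R by rewrite ltr0n.
  have f0 : 0 < j.+1`!%:R :> R by rewrite ltr0n fact_gt0.
  have g0 : 0 < gamma (alpha * j.+1%:R) by rewrite gamma_gt0// mulr_ge0// ltW.
  have -> : j.+1`!%:R / gamma (alpha * j.+1%:R) =
      expR (ln j.+1`!%:R - ln (gamma (alpha * j.+1%:R))).
    by rewrite expRB !lnK ?posrE.
  rewrite -!expRD; congr expR.
  (* The Gamma factors cancel, and the terms in ln j match because alpha + beta = 1. *)
  rewrite /stirling gamma_nat !lnM ?posrE// /c0 /beta; ring.
have iexp (l : R) : 0 <= l -> P2.-integrable [set: T2] (EFin \o (fun t => expR (l * Y t))).
  have b1 : beta < 1 by rewrite /beta; lra.
  move=> l0; have h := integrable_expR_powS XP mX l0 (expR_ge0 c0) b0 b1.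
  have -> : Y = (fun t => expR c0 * expR (beta * X t)) by apply/funext => t; rewrite /Y expRD.
  exact: h.
have g0 : 0 < gamma alpha by rewrite gamma_gt0// ltW.
have ce : (gamma alpha)^-1 < alpha `^ (- alpha).
  by rewrite powRN ltf_pV2 ?posrE// ?powR_gt0// powR_self_lt_gamma.
have c00 : 0 <= (gamma alpha)^-1 by rewrite invr_ge0 ltW.
have p01 : 0 <= p <= 1 by rewrite p0 ltW.
have := tail_comparison W0 (fun t => expR_ge0 _) xi0 p01 iW iY mom iexp cr c00 ce.
have mle (A B : set T2) : measurable A -> measurable B -> A `<=` B -> fine (P2 A) <= fine (P2 B).
  move=> mA mB AB; apply: fine_le; [exact: fin_num_measure..|exact: le_measure (mem_set mA) (mem_set mB) AB].
have mge (c : R) (V : T2 -> R) : measurable_fun [set: T2] V -> measurable [set t | c <= V t].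
  move=> mV; rewrite (_ : [set t | _] = V @^-1` `[c, +oo[%classic); last first.
    by apply/seteqP; split=> t /=; rewrite in_itv/= andbT.
  by rewrite -[X in measurable X]setTI; apply: mV.
have half : 2^-1 <= fine (P2 [set t | alpha `^ (- alpha) <= Y t]).
  have <- : fine (P2 [set t | mS <= expR (X t)]) = 2^-1 by rewrite PS.
  apply: mle.
  - by apply: mge; exact: measurableT_comp.
  - by apply: mge; apply: measurableT_comp => //; apply: measurable_funD => //; exact: measurable_funM.
  (* In logarithms, alpha^(-alpha) <= Y reads beta ln beta <= beta X, that is S >= beta. *)
  move=> t /= St; have bS : beta <= expR (X t) by rewrite (le_trans _ St)// /beta; lra.
  rewrite /powR gt_eqF// ler_expR /c0.
  have : ln beta <= X t by rewrite -ler_expR lnK.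
  by move=> h; have := ler_wpM2l (ltW b0) h; lra.
have EW : \int[P0]_t W t = (gamma alpha)^-1.
  have := (mittag_leffler_moment a0 mZ Z0 LZ 1).2; rewrite mulr1 div1r => <-.
  by apply: eq_Rintegral => t _; rewrite expr1.
have mgt (c : R) (V : T0 -> R) : measurable_fun [set: T0] V -> measurable [set t | c < V t].
  move=> mV; rewrite (_ : [set t | _] = V @^-1` `]c, +oo[%classic); last first.
    by apply/seteqP; split=> t /=; rewrite in_itv/= andbT.
  by rewrite -[X in measurable X]setTI; apply: mV.
(* Markov's inequality, [xi * W] having mean [xi / gamma alpha] *)
have mark : fine (P0 [set t | (gamma alpha)^-1 < xi * W t]) <= xi.
  pose A := [set t | (gamma alpha)^-1 < xi * W t].
  have mA : measurable A by apply: mgt; exact: measurable_funM.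
  have [iA eA] := Rintegral_indicM P0 (gamma alpha)^-1 mA.
  have iW1 : P0.-integrable [set: T0] (EFin \o W) by exact: (iW 1%N).
  rewrite -(ler_pM2l (x := (gamma alpha)^-1)) ?invr_gt0// -eA [leRHS]mulrC -[in leRHS]EW -RintegralZl//.
  apply: le_Rintegral => //; first exact: integrable_mull.
  move=> t _; rewrite indicE; case: (boolP (t \in A)) => tA.
    by rewrite mulr1; have := set_mem tA; rewrite /A/= => /ltW.
  by rewrite mulr0 mulr_ge0.
rewrite -/W; set u := fine (P0 [set t | _ < W t]); move=> h.
(* If u <= 1 / 2, the right-hand side of [h] is at most p / 2 + (1 - p) / 3, which is below 1 / 2 as
   p < 1. *)
rewrite ltNge; apply/negP => u2.
have q0 : 0 <= 1 - p by rewrite subr_ge0 ltW.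
have := ler_wpM2l p0 u2; have := ler_wpM2l q0 (le_trans mark xi3).
by nra.
Qed.

End median_comparison.

Theorem proposition6 (R : realType) (alpha : R)
    (d0 : measure_display) (T0 : measurableType d0) (P0 : probability T0 R)
    (Z : {RV P0 >-> R})
    (d1 : measure_display) (T1 : measurableType d1) (P1 : probability T1 R)
    (M : {RV P1 >-> R})
    (d2 : measure_display) (T2 : measurableType d2) (P2 : probability T2 R)
    (X : {RV P2 >-> R}) (mM mS : R) :
  0 < alpha -> alpha < 1 ->
  positive_stable alpha P0 Z ->
  eq_in_law P1 M P0 (fun t => Z t `^ (- alpha)) -> is_median P1 M mM ->
  log_S_law P2 X -> is_median P2 (fun t => expR (X t)) mS ->
  1 - mS <= alpha ->
  ('E_P1[M] < mM%:E)%E.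
Proof.
move=> a0 a1 [Zpos LZ] MW [PM _] XP [_ PS] hm.
have mZ : measurable_fun [set: T0] Z by exact: measurable_funPT.
(* [Z] is positive only almost everywhere; the value 1 on the exceptional null set changes no
   law. *)
pose Z' t := if 0 < Z t then Z t else 1.
have mZ' : measurable_fun [set: T0] Z'.
  apply: measurable_fun_ifT => //; exact: measurable_fun_ltr.
have Z'0 t : 0 < Z' t by rewrite /Z'; case: ifP.
have ZZ' : {ae P0, forall t, Z t = Z' t}.
  by apply: filterS Zpos => t Zt; rewrite /Z' Zt.
have LZ' (l : R) : 0 <= l -> (\int[P0]_t (expR (- (l * Z' t)))%:E = (expR (- (l `^ alpha)))%:E)%E.
  move=> l0; have := LZ l l0; rewrite unlock => <-.
  apply: ge0_ae_eq_integral => //.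
  - apply/measurable_EFinP; do 2 (apply: measurableT_comp => //); exact: measurable_funM.
  - apply/measurable_EFinP; do 2 (apply: measurableT_comp => //); exact: measurable_funM.
  - by apply: (filterS _ ZZ') => t e _; rewrite e.
have mX : measurable_fun [set: T2] X by exact: measurable_funPT.
have half := mittag_leffler_tail a0 a1 mZ' Z'0 LZ' XP mX PS hm.
have mW : measurable_fun [set: T0] (fun t => Z' t `^ (- alpha)) by exact: measurable_mittag_leffler.
pose mW_mixin := isMeasurableFun.Build _ _ _ _ _ mW.
pose W : {RV P0 >-> R} := HB.pack (fun t => Z' t `^ (- alpha)) mW_mixin.
have MW' : eq_in_law P1 M P0 W.
  move=> A mA; rewrite MW//; apply: ae_eq_in_law => //.
    exact: (@measurableT_comp _ _ _ _ _ _ (fun x => x `^ (- alpha))).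
  by apply: filterS ZZ' => t ->.
have EM : ('E_P1[M] = ((gamma alpha)^-1)%:E)%E.
  rewrite (eq_in_law_expectation MW') unlock.
  have [i e] := mittag_leffler_moment a0 mZ' Z'0 LZ' 1.
  rewrite mulr1 div1r in e; rewrite -e /Rintegral fineK; last exact: integrable_fin_num.
  by apply: eq_integral => t _; rewrite expr1.
(* Were the median at most the mean, M would exceed its mean with probability at most P(M > mM) = 1
   / 2, against [half]. *)
rewrite EM lte_fin ltNge; apply/negP => mMg.
have le_half : fine (P0 [set t | (gamma alpha)^-1 < W t]) <= 2^-1.
  have mi : measurable (`](gamma alpha)^-1, +oo[%classic : set R) by exact: measurable_itv.
  have := MW' _ mi; rewrite /pushforward.
  have e T (V : T -> R) : V @^-1` `](gamma alpha)^-1, +oo[%classic = [set t | (gamma alpha)^-1 < V t].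
    by apply/seteqP; split=> t /=; rewrite in_itv/= andbT.
  rewrite !e => <-.
  have mle : measurable [set t | M t <= mM].
    rewrite (_ : [set t | _] = M @^-1` `]-oo, mM]%classic); last first.
      by apply/seteqP; split=> t /=; rewrite in_itv.
    exact: measurable_funPTI.
  have mlt : measurable [set t | (gamma alpha)^-1 < M t] by rewrite -e; exact: measurable_funPTI.
  have : (P1 [set t | ((gamma alpha)^-1 < M t)%R] <= P1 (~` [set t | (M t <= mM)%R]))%E.
    apply: le_measure; rewrite ?inE//; first exact: measurableC.
    by move=> t /= Mt; apply/negP; rewrite -ltNge (le_lt_trans mMg).
  rewrite probability_setC// PM -EFinB => h.
  have -> : 2^-1 = fine (1 - 2^-1)%:E :> R by rewrite /=; lra.
  by apply: fine_le => //; exact: fin_num_measure.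
by have := lt_le_trans half le_half; rewrite ltxx.
Qed.
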